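(* Let $\xi$ be a countable successor ordinal, $\xi-1$ its predecessor, and $(\beta_n)_{n=1}^\infty$ a nondecreasing sequence of ordinals with $\beta_n<\omega^\xi$ for all $n$ and $\sup_n\beta_n=\omega^\xi$. Let $\mathcal{F}_0$ be a regular family containing $\mathcal{S}_0$ with $\alpha_0=\iota(\mathcal{F}_0)<\omega^{\omega^\xi}$, and $(\theta_n)_{n=1}^\infty$ a nonincreasing null sequence in $(0,1)$. Using the standard Schreier families, for $\varepsilon>0$ and $m\in\mathbb{N}$ let $$\gamma(\varepsilon,m)=\max\{\ell(\alpha_0)+\beta_{n_s}+\dots+\beta_{n_1}: s,n_1,\dots,n_s\in\mathbb{N},\ \varepsilon\theta_{n_1}\theta_{n_2}\cdots\theta_{n_s}>\theta_m\}\quad(\max\emptyset=0).$$ If there exists $\varepsilon>0$ such that for all $\beta<\omega^\xi$ there exists $m\in\mathbb{N}$ with $\gamma(\varepsilon,m)+2+\beta<\beta_m$, then $I_b(T(\mathcal{F}_0,(\theta_n,\mathcal{S}_{\beta_n})_{n=1}^\infty))=\omega^{\omega^\xi\cdot2}$. Otherwise, $I_b(T(\mathcal{F}_0,(\theta_n,\mathcal{S}_{\beta_n})_{n=1}^\infty))=\omega^{\omega^\xi}$.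
   Context: Regular family: hereditary, spreading, compact subset of $[\mathbb{N}]^{<\infty}\subseteq2^{\mathbb{N}}$. $\iota(\mathcal{F})$: ordinal $\beta$ with $\mathcal{F}^{(\beta)}=\{\emptyset\}$ (iterated Cantor–Bendixson derived sets). $\ell(\eta)$: leading exponent of the Cantor normal form of $\eta$ ($\ell(0)=0$). $\mathcal{M}[\mathcal{N}]=\{\bigcup_{i=1}^kF_i:F_i\in\mathcal{N},F_1<\dots<F_k,\{\min F_i\}\in\mathcal{M}\}$ ($E<F$ means $\max E<\min F$). Standard Schreier families: $\mathcal{S}_0=\{\{n\}\}\cup\{\emptyset\}$, $\mathcal{S}_1=\{F:|F|\le\min F\}$, $\mathcal{S}_{\beta+1}=\mathcal{S}_1[\mathcal{S}_\beta]$, and for countable limit $\beta$, $\mathcal{S}_\beta=\{F:F\in\mathcal{S}_{\hat\beta_n}\text{ for some }n\le\min F\}$, where, fixing for each countable limit ordinal $\lambda$ a sequence $(\zeta_n)\uparrow\lambda$, for $\beta=\omega^{\beta_1}m_1+\dots+\omega^{\beta_k}m_k$ in Cantor normal form, $\hat\beta_n=\omega^{\beta_1}m_1+\dots+\omega^{\beta_k}(m_k-1)+\omega^{\beta_k-1}n$ if $\beta_k$ is a successor and $\hat\beta_n=\omega^{\beta_1}m_1+\dots+\omega^{\beta_k}(m_k-1)+\omega^{\zeta_n}$ if $\beta_k$ is a limit with sequence $(\zeta_n)$. $T(\mathcal{F}_0,(\theta_n,\mathcal{G}_n))$: completion of $c_{00}$ under the norm implicitly defined by $\|x\|=\max\{\|x\|_{\mathcal{F}_0},\sup_n\sup\theta_n\sum_i\|E_ix\|\}$,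 $\|\sum a_ke_k\|_{\mathcal{F}}=\sup_{F\in\mathcal{F}}\sum_{k\in F}|a_k|$, $Ex$ the restriction of $x$ to $E$, inner sup over $E_1<\dots<E_k$ with $\{\min E_i\}\in\mathcal{G}_n$. $I_b(E)=\sup_KI_b(E,K)$, $I_b(E,K)$ the supremum of orders of $\ell^1$-$K$ block trees (trees on the unit sphere, closed under initial segments, whose nodes are finite block bases of the unit vector basis with $\|\sum a_ix_i\|\ge K^{-1}\sum|a_i|$); order = least $\beta$ with $D^\beta(T)=\emptyset$, $D$ removing nodes without proper extensions, iterated transfinitely. *)

(* Defs.v *)
From Stdlib Require Import Reals.
From mathcomp Require Import all_boot.
Set Implicit Arguments.
Unset Strict Implicit.
Unset Printing Implicit Defensive.

(* Countable ordinals as Brouwer trees.  [OL f] denotes sup_n f n.     *)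
Inductive Ord : Type := OZ | OS (a : Ord) | OL (f : nat -> Ord).

Fixpoint ole (a b : Ord) {struct a} : Prop :=
  match a with
  | OZ => True
  | OS a' =>
      (fix lt (c : Ord) : Prop :=
         match c with
         | OZ => False
         | OS c' => ole a' c'
         | OL g => exists n, lt (g n)
         end) b
  | OL f => forall n, ole (f n) b
  end.

Definition olt (a b : Ord) : Prop := ole (OS a) b.
Definition oeq (a b : Ord) : Prop := ole a b /\ ole b a.

Definition fin (n : nat) : Ord := iter n OS OZ.
Definition omega : Ord := OL fin.

Fixpoint oadd (a b : Ord) : Ord :=
  match b with
  | OZ => a
  | OS b' => OS (oadd a b')
  | OL f => OL (fun n => oadd a (f n))
  end.

Fixpoint omul (a b : Ord) : Ord :=
  match b with
  | OZ => OZ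
  | OS b' => oadd (omul a b') a
  | OL f => OL (fun n => omul a (f n))
  end.

Fixpoint oexp (a b : Ord) : Ord :=
  match b with
  | OZ => OS OZ
  | OS b' => omul (oexp a b') a
  | OL f => OL (fun n => oexp a (f n))
  end.

Definition wexp (b : Ord) : Ord := oexp omega b.

Definition is_succ (a : Ord) : Prop := exists b, oeq a (OS b).
Definition is_limit (a : Ord) : Prop := ~ oeq a OZ /\ ~ is_succ a.

Definition lead_exp (eta d : Ord) : Prop :=
  (oeq eta OZ /\ oeq d OZ) \/ (ole (wexp d) eta /\ olt eta (wexp (OS d))).

(* A choice, for every countable limit ordinal lambda, of a sequence
   (zeta_n)_{n>=1} strictly increasing to lambda (depending only on lambda). *)
Definition fund_seqs (zeta : Ord -> nat -> Ord) : Prop :=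
  (forall l, is_limit l ->
     (forall n, (1 <= n)%N -> olt (zeta l n) (zeta l n.+1)) /\
     oeq (OL (fun n => zeta l n.+1)) l) /\
  (forall l l', is_limit l -> oeq l l' -> forall n, oeq (zeta l n) (zeta l' n)).

(* Finite subsets of N = {1,2,...}: strictly increasing seqs of        *)
(* positive naturals.  Families: predicates on such seqs.              *)
Definition fs (s : seq nat) : Prop := sorted ltn s /\ all (fun k => (0 < k)%N) s.
Definition fam := seq nat -> Prop.

Definition smin (s : seq nat) : nat := head 0%N s.
Definition smax (s : seq nat) : nat := last 0%N s.
Definition setlt (E F : seq nat) : Prop := (smax E < smin F)%N.

Definition blocks_ok (Es : seq (seq nat)) : Prop :=
  (forall E, E \in Es -> fs E /\ E <> [::]) /\
  (forall i j, (i < j < size Es)%N -> setlt (nth [::] Es i) (nth [::] Es j)).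

Definition comp (M N : fam) : fam := fun F =>
  exists Es : seq (seq nat),
    F = flatten Es /\ blocks_ok Es /\ (forall E, E \in Es -> N E) /\ M (map smin Es).

Definition S1 : fam := fun F => fs F /\ (size F <= smin F)%N.

(* Standard Schreier families S_beta (least fixed point of the defining
   transfinite recursion; beta limit is written uniquely as
   omega^d * (r+1) with d >= 1, and the hat ordinals are
   omega^d*r + omega^(d-1)*n (d successor) or omega^d*r + omega^(zeta_d n)
   (d limit)). *)
Inductive Sch (zeta : Ord -> nat -> Ord) : Ord -> seq nat -> Prop :=
| Sch_empty b : Sch zeta b [::]
| Sch_zero b k : oeq b OZ -> (0 < k)%N -> Sch zeta b [:: k]
| Sch_succ b g F : oeq b (OS g) -> fs F ->
    (exists Es : seq (seq nat),
        F = flatten Es /\ blocks_ok Es /\ (forall E, E \in Es -> Sch zeta g E)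
        /\ S1 (map smin Es)) ->
    Sch zeta b F
| Sch_lim_succ b d d0 r n F :
    oeq b (omul (wexp d) (OS r)) -> oeq d (OS d0) ->
    (1 <= n)%N -> F <> [::] -> (n <= smin F)%N ->
    Sch zeta (oadd (omul (wexp d) r) (omul (wexp d0) (fin n))) F ->
    Sch zeta b F
| Sch_lim_lim b d r n F :
    oeq b (omul (wexp d) (OS r)) -> is_limit d ->
    (1 <= n)%N -> F <> [::] -> (n <= smin F)%N ->
    Sch zeta (oadd (omul (wexp d) r) (wexp (zeta d n))) F ->
    Sch zeta b F.

Definition hereditary (F : fam) : Prop :=
  forall s t, F s -> fs t -> subseq t s -> F t.

Definition spreading (F : fam) : Prop :=
  forall s t, F s -> fs t -> size t = size s ->
    (forall i, (i < size s)%N -> (nth 0%N s i <= nth 0%N t i)%N) -> F t.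

(* compact (equivalently closed) in 2^N with the product topology *)
Definition compact_fam (F : fam) : Prop :=
  forall A : nat -> bool,
    (forall n, exists s, F s /\ forall k, (k <= n)%N -> (k \in s) = A k) ->
    exists s, F s /\ forall k, (k \in s) = A k.

Definition regular (F : fam) : Prop :=
  (forall s, F s -> fs s) /\ hereditary F /\ spreading F /\ compact_fam F.

Definition contains_S0 (F : fam) : Prop :=
  F [::] /\ forall k, (0 < k)%N -> F [:: k].

(* Cantor-Bendixson derivative in 2^N: remove isolated points *)
Definition deriv (X : fam) : fam := fun s =>
  X s /\ forall n, exists t, X t /\ t <> s /\
                    forall k, (k <= n)%N -> (k \in t) = (k \in s).

Fixpoint iter_deriv (X : fam) (b : Ord) : fam :=
  match b with
  | OZ => X
  | OS b' => deriv (iter_deriv X b')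
  | OL f => fun s => forall n, iter_deriv X (f n) s
  end.

Definition cb_index (X : fam) (a : Ord) : Prop :=
  forall s, iter_deriv X a s <-> s = [::].

(* (coordinates indexed by N = {1,2,...}; coordinate 0 unused)          *)
Local Open Scope R_scope.

Definition vec := nat -> R.
Definition c00 (x : vec) : Prop :=
  exists M : nat, forall k : nat, (k = 0%N \/ (M < k)%N) -> x k = 0.
Definition restr (E : seq nat) (x : vec) : vec :=
  fun k => if k \in E then x k else 0.
Definition sumabs (F : seq nat) (x : vec) : R :=
  foldr (fun k acc => Rabs (x k) + acc) 0 F.

Definition admissible (G : fam) (Es : seq (seq nat)) : Prop :=
  blocks_ok Es /\ G (map smin Es).

Definition norming_set (zeta : Ord -> nat -> Ord) (F0 : fam) (theta : nat -> R)
  (beta : nat -> Ord) (N : vec -> R) (x : vec) : R -> Prop := fun v =>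
  (exists F, F0 F /\ v = sumabs F x) \/
  (exists n Es, admissible (Sch zeta (beta n)) Es /\
     v = theta n * foldr (fun E acc => N (restr E x) + acc) 0 Es).

Definition is_T_norm (zeta : Ord -> nat -> Ord) (F0 : fam) (theta : nat -> R)
  (beta : nat -> Ord) (N : vec -> R) : Prop :=
  (forall x, c00 x -> is_lub (norming_set zeta F0 theta beta N x) (N x)) /\
  (forall x, c00 x -> 0 <= N x) /\
  (forall x, c00 x -> N x = 0 -> forall k, x k = 0) /\
  (forall a x, c00 x -> N (fun k => a * x k) = Rabs a * N x) /\
  (forall x y, c00 x -> c00 y -> N (fun k => x k + y k) <= N x + N y).

Definition vzero : vec := fun _ => 0.

Definition lincomb (a : nat -> R) (xs : seq vec) : vec :=
  fun k => foldr Rplus 0 (mkseq (fun i => a i * nth vzero xs i k) (size xs)).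
Definition sumabs_coef (a : nat -> R) (n : nat) : R :=
  foldr Rplus 0 (mkseq (fun i => Rabs (a i)) n).

Definition l1K_node (N : vec -> R) (K : R) (xs : seq vec) : Prop :=
  (forall i, (i < size xs)%N -> c00 (nth vzero xs i) /\ N (nth vzero xs i) = 1) /\
  (forall i j p q, (i < j < size xs)%N ->
     nth vzero xs i p <> 0 -> nth vzero xs j q <> 0 -> (p < q)%N) /\
  (forall a : nat -> R, N (lincomb a xs) >= / K * sumabs_coef a (size xs)).

Definition tree := seq vec -> Prop.

Definition l1K_tree (N : vec -> R) (K : R) (T : tree) : Prop :=
  (forall t, T t -> t <> [::] /\ l1K_node N K t) /\
  (forall t, T t -> forall m, (0 < m <= size t)%N -> T (take m t)).

Definition tderiv (T : tree) : tree := fun t =>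
  T t /\ exists t', T t' /\ (size t < size t')%N /\ take (size t) t' = t.

Fixpoint iter_tderiv (T : tree) (b : Ord) : tree :=
  match b with
  | OZ => T
  | OS b' => tderiv (iter_tderiv T b')
  | OL f => fun t => forall n, iter_tderiv T (f n) t
  end.

(* I_b = sup_{K >= 1} sup_T o(T) equals a *)
Definition Ib_eq (N : vec -> R) (a : Ord) : Prop :=
  (forall K, 1 <= K -> forall T, l1K_tree N K T -> forall t, ~ iter_tderiv T a t) /\
  (forall g, olt g a ->
     exists K, 1 <= K /\ exists T, l1K_tree N K T /\ exists t, iter_tderiv T g t).

Fixpoint osum (beta : nat -> Ord) (l : seq nat) : Ord :=
  match l with
  | [::] => OZ
  | n :: l' => oadd (osum beta l') (beta n)
  end.
(* osum beta [:: n1; ...; ns] = beta n_s + ... + beta n_1 *)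

Definition thprod (theta : nat -> R) (l : seq nat) : R :=
  foldr (fun n acc => theta n * acc) 1 l.

Definition gamma_adm (theta : nat -> R) (eps : R) (m : nat) (l : seq nat) : Prop :=
  l <> [::] /\ eps * thprod theta l > theta m.

Definition gamma_is (la : Ord) (beta : nat -> Ord) (theta : nat -> R)
  (eps : R) (m : nat) (g : Ord) : Prop :=
  (exists l, gamma_adm theta eps m l /\ oeq g (oadd la (osum beta l)) /\
     forall l', gamma_adm theta eps m l' -> ole (oadd la (osum beta l')) g) \/
  ((forall l, ~ gamma_adm theta eps m l) /\ oeq g OZ).

(* Main.v *)
(** If a family of finite sets has rank below [w^a], then in any tree of order [w^a] one finds a convex
combination along a branch with mass at most [d] on every set of the family: the average of many
successive such averages, each small on the finitely many remainders of sets determined by the past,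
works for rank below [w^(a+1)].

Upper bound.  Suppose [S_(beta_n)] lies in the composition of a family [H_n] of rank below [w^a] with
[S_(beta_(n_1))], ..., [S_(beta_(n_s))] whose product of [theta]s exceeds [theta_n / eps].  Averages [A_j]
that are small on the relevant [H_n] satisfy [theta_n sum_i |E_i A_j| <= theta_n + 2 eps] for all [n] except
at most one [j] for each [n].  An average of the [A_j] that is small on the finitely many compositions
with product of [theta]s above [d] then has small norm, so no [l1-K] tree has order [w^a w^(w^xi)].  One can
always take [a = w^xi]; writing [xi = z + 1] and comparing coefficients of [w^z], the failure of the
condition provides some [a < w^xi].

Lower bound.  The sets of [S_(beta_n)] give trees of order up to [w^(w^xi)].  Under the condition, for
suitable [m], averages of unit vectors supported on sets of [S_(beta_m)] have norm at most
[(1 + 1/eps) theta_m], so after normalization they span [l1] uniformly in [m]; these inner trees have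
orders up to [w^(w^xi)], and placing them on sets of [S_(beta_n)] gives orders up to [w^(w^xi 2)]. *)

Require Import Defs.
From Stdlib Require Import Reals Lra Classical ClassicalEpsilon FunctionalExtensionality.
From HB Require Import structures.
From mathcomp Require Import all_boot.
From mathcomp Require Import zify.
Set Implicit Arguments.
Unset Strict Implicit.
Unset Printing Implicit Defensive.

(** * Ordinal arithmetic on Brouwer trees *)

(** Schreier families of different index are not nested: a set of S_n with minimum below n need not
    lie in S_w. Exact inclusions are available below w^(z+1), where the sequences attached to limits
    commute with a prefix w^z k: for b < w^(z+1) the family S_(w^z k) is contained in S_(w^z k + b),
    which is contained in S_b[S_(w^z k)]. Sums of the ordinals beta_n are therefore reduced to their
    coefficient of w^z. These coefficients add like natural numbers, in any order, while [la] and
    the summand 2 shift them by a constant, which the quantifier over all b < w^xi absorbs.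

    Of a tree only its order is known, so the averaging takes place in a game whose states carry an
    ordinal that drops at each move. It is played on the nodes of a tree, on averages of such nodes,
    and on the elements of a Schreier set. Families enter with two notions of rank: [rk] bounds
    every descent through a set, [lr] promises long descents whose next element can be taken
    arbitrarily far out. *)

Lemma ole_sup a g n : ole a (g n) -> ole a (OL g).
Proof. by elim: a => [|a _|f IH] //= H; [exists n | move=> m; apply: IH; apply: H]. Qed.

Lemma ole_trans b a c : ole a b -> ole b c -> ole a c.
Proof.
elim: a b c => [|a IHa|f IHf] //= b c; last by move=> H bc n; exact: IHf (H n) bc.
rewrite -/(olt a b) -/(olt a c).
elim: b c => [|b _|g IHg] c //=.
- move=> ab; elim: c => [|c _|h IHh] //=; first exact: IHa.
  by case=> n /IHh H; exists n.
- by case=> n /IHg H Hc; apply: H; exact: Hc.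
Qed.

Lemma ole_refl a : ole a a.
Proof. by elim: a => //= f IH n; exact: (ole_sup (IH n)). Qed.
Hint Resolve ole_refl : core.

Lemma oleS a : ole a (OS a).
Proof. by elim: a => //= f IH n; apply: ole_trans (IH n) _; exact: (ole_sup (g := f)). Qed.

Lemma olt_ole a b : olt a b -> ole a b.
Proof. exact: ole_trans (oleS a). Qed.

Lemma ole_olt_trans b a c : ole a b -> olt b c -> olt a c.
Proof. by move=> ab; apply: (@ole_trans (OS b) (OS a)). Qed.

Lemma olt_ole_trans b a c : olt a b -> ole b c -> olt a c.
Proof. exact: ole_trans. Qed.

Lemma olt_trans b a c : olt a b -> olt b c -> olt a c.
Proof. by move=> ab /olt_ole; exact: ole_trans. Qed.

Lemma olt_sup a g : olt a (OL g) -> exists n, olt a (g n).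
Proof. by []. Qed.

Lemma ole_or_lt a b : ole a b \/ olt b a.
Proof.
elim: a b => [|a IH|f IH] b; first by left.
- elim: b => [|b _|g IHg]; first by right.
  + by case: (IH b); [left | right].
  + case: (classic (exists n, ole (OS a) (g n))) => [|H]; first by left.
    by right=> n; case: (IHg n) => // Hn; case: H; exists n.
- case: (classic (exists n, olt b (f n))) => [|H]; first by right.
  by left=> n; case: (IH n b) => // Hn; case: H; exists n.
Qed.

Lemma olt_irr a : ~ olt a a.
Proof.
elim: a => [|a IH|f IH] //= /olt_sup [n H]; apply: (IH n).
by apply: ole_olt_trans H; exact: (ole_sup (g := f)).
Qed.

Lemma olt_not_ole a b : olt a b -> ~ ole b a.
Proof. by move=> ab ba; exact: olt_irr (olt_ole_trans ab ba). Qed.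

Lemma not_ole_lt a b : ~ ole a b -> olt b a.
Proof. by case: (ole_or_lt a b). Qed.

Lemma olt_wf : well_founded olt.
Proof.
suff H a : forall b, ole b a -> Acc olt b by move=> a; exact: H (ole_refl a).
elim: a => [|a IH|f IH] b Hb; constructor=> c cb.
- by case: (olt_ole_trans cb Hb).
- exact: IH (olt_ole_trans cb Hb).
- by case: (olt_ole_trans cb Hb) => n /olt_ole/IH.
Qed.

Lemma ord_ind (P : Ord -> Prop) : (forall a, (forall b, olt b a -> P b) -> P a) -> forall a, P a.
Proof. exact: (well_founded_ind olt_wf). Qed.

Lemma oeq_refl a : oeq a a. Proof. by []. Qed.
Hint Resolve oeq_refl : core.
Lemma oeq_sym a b : oeq a b -> oeq b a. Proof. by case. Qed.
Lemma oeq_trans b a c : oeq a b -> oeq b c -> oeq a c.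
Proof. by move=> [h1 h2] [h3 h4]; split; [exact: ole_trans h1 h3 | exact: ole_trans h4 h2]. Qed.
(** The operations recurse on their right argument, so this and the next identities hold for the
    trees themselves, by extensionality of the sequences in [OL], and can be used for rewriting
    without [oeq]. *)
Lemma add0o a : oadd OZ a = a.
Proof. by elim: a => [//|a /= ->//|f IH] /=; congr OL; apply: functional_extensionality. Qed.

Lemma oaddA a b c : oadd (oadd a b) c = oadd a (oadd b c).
Proof. by elim: c => [//|c /= ->//|f IH] /=; congr OL; apply: functional_extensionality. Qed.

Lemma omulDr a b c : omul a (oadd b c) = oadd (omul a b) (omul a c).
Proof.
elim: c => [//|c /= ->|f IH] /=; first by rewrite oaddA.
by congr OL; apply: functional_extensionality.
Qed.

Lemma omulA a b c : omul (omul a b) c = omul a (omul b c).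
Proof.
elim: c => [//|c /= ->|f IH] /=; first by rewrite omulDr.
by congr OL; apply: functional_extensionality.
Qed.

Lemma omulo1 a : omul a (OS OZ) = a. Proof. exact: add0o. Qed.

Lemma oexpD a b c : oexp a (oadd b c) = omul (oexp a b) (oexp a c).
Proof.
elim: c => [|c /= ->|f IH] /=; first by rewrite add0o.
- by rewrite omulA.
- by congr OL; apply: functional_extensionality.
Qed.

Lemma wexpD b c : wexp (oadd b c) = omul (wexp b) (wexp c). Proof. exact: oexpD. Qed.
Lemma oadd_ge_l a b : ole a (oadd a b).
Proof.
elim: b => //= [b IH|f IH]; first exact: ole_trans IH (oleS _).
exact: (@ole_sup _ (fun n => oadd a (f n)) 0 (IH 0)).
Qed.

Lemma oadd_mono_r a b c : ole b c -> ole (oadd a b) (oadd a c).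
Proof.
elim: b c => [|b IHb|f IHf] c; first by move=> _; exact: oadd_ge_l.
- rewrite -/(olt b c) /= -/(olt (oadd a b) (oadd a c)).
  elim: c => [//|c _|g IHg] /=; first exact: IHb.
  by case=> n /IHg H; exists n.
- by move=> H n; apply: IHf; exact: H.
Qed.

Lemma oadd_mono_l a b c : ole a b -> ole (oadd a c) (oadd b c).
Proof.
move=> ab; elim: c => //= f IH n.
exact: (@ole_sup _ (fun n => oadd b (f n)) n (IH n)).
Qed.

Lemma oadd_mono a b c d : ole a b -> ole c d -> ole (oadd a c) (oadd b d).
Proof. by move=> ab cd; apply: ole_trans (oadd_mono_l _ ab) (oadd_mono_r _ cd). Qed.

Lemma oadd_lt_r a b c : olt b c -> olt (oadd a b) (oadd a c).
Proof. exact: (@oadd_mono_r a (OS b) c). Qed.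

Lemma oadd_ge_r a b : ole b (oadd a b).
Proof. by rewrite -{1}(add0o b); exact: oadd_mono_l. Qed.

Lemma oadd_cancel a b c : ole (oadd a b) (oadd a c) -> ole b c.
Proof.
by move=> H; case: (ole_or_lt b c) => // /(oadd_lt_r a) H2; case: (olt_irr (olt_ole_trans H2 H)).
Qed.

Lemma oadd_cancel_lt a b c : olt (oadd a b) (oadd a c) -> olt b c.
Proof. exact: (@oadd_cancel a (OS b) c). Qed.

(** The difference is formed termwise at a supremum; terms below [a] contribute zero. *)
Lemma osub_exists a b : ole a b -> exists c, oeq b (oadd a c).
Proof.
elim: b => [|b IH|f IH] H; first by exists OZ; split.
- case: (ole_or_lt a b) => [/IH [c [h1 h2]]|ba]; first by exists (OS c); split.
  by exists OZ; split.
- have Hn n : exists c, (ole a (f n) -> oeq (f n) (oadd a c)) /\ ole (oadd a c) (OL f).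
    case: (classic (ole a (f n))) => [|Ha]; last by exists OZ.
    move=> Ha; case: (IH _ Ha) => c Hc; exists c; split=> //.
    by apply: ole_trans (proj2 Hc) _; exact: (ole_sup (g := f)).
  have [c Hc] := ClassicalEpsilon.constructive_indefinite_description _
     (ex_intro (fun c : nat -> Ord => forall n, (ole a (f n) -> oeq (f n) (oadd a (c n))) /\ ole (oadd a (c n)) (OL f))
        (fun n => proj1_sig (ClassicalEpsilon.constructive_indefinite_description _ (Hn n)))
        (fun n => proj2_sig (ClassicalEpsilon.constructive_indefinite_description _ (Hn n)))).
  exists (OL c); split=> n /=; last by case: (Hc n).
  case: (ole_or_lt a (f n)) => [Ha|/olt_ole Ha].
    apply: (@ole_sup _ (fun n => oadd a (c n)) n); exact: (proj1 (proj1 (Hc n) Ha)).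
  by apply: ole_trans Ha _; exact: (@oadd_ge_l a (OL c)).
Qed.

(** The form in which sums are used in all descents: going down from a + b either lowers [b] or
    falls below [a]. *)
Lemma olt_add_split e a b : olt e (oadd a b) -> olt e a \/ exists b', olt b' b /\ ole e (oadd a b').
Proof.
case: (ole_or_lt a e) => [ae|]; last by left.
case: (osub_exists ae) => c [h1 h2] H; right; exists c; split=> //.
by apply: (@oadd_cancel_lt a); exact: ole_olt_trans h2 H.
Qed.

Lemma omul_mono_r a b c : ole b c -> ole (omul a b) (omul a c).
Proof.
elim: b c => [//|b IHb|f IHf] c; last by move=> H n; apply: IHf; exact: H.
rewrite -/(olt b c) /=.
elim: c => [//|c _|g IHg] /=; first by move=> bc; apply: oadd_mono_l; exact: IHb.
by case=> n /IHg H; exact: (@ole_sup _ (fun n => omul a (g n)) n).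
Qed.

Lemma omul_mono_l a b c : ole a b -> ole (omul a c) (omul b c).
Proof.
move=> ab; elim: c => [//|c IH|f IH] /=; first exact: oadd_mono.
move=> n; exact: (@ole_sup _ (fun n => omul b (f n)) n (IH n)).
Qed.

Lemma omul_mono a b c d : ole a b -> ole c d -> ole (omul a c) (omul b d).
Proof. by move=> ab cd; apply: ole_trans (omul_mono_l _ ab) (omul_mono_r _ cd). Qed.

Lemma omul_lt_r a b c : olt OZ a -> olt b c -> olt (omul a b) (omul a c).
Proof.
move=> a0 bc; apply: (@olt_ole_trans (omul a (OS b))); last exact: omul_mono_r.
exact: (oadd_lt_r (omul a b) a0).
Qed.

Lemma omul_cancel a b c : olt OZ a -> ole (omul a b) (omul a c) -> ole b c.
Proof.
by move=> a0 H; case: (ole_or_lt b c) => // /(omul_lt_r a0) H2; case: (olt_irr (olt_ole_trans H2 H)).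
Qed.

Lemma omul_cancel_lt a b c : olt (omul a b) (omul a c) -> olt b c.
Proof. by move=> H; apply: not_ole_lt => /(omul_mono_r a) /(olt_not_ole H). Qed.

Lemma olt_mul_split e a b : olt e (omul a b) -> exists b', olt b' b /\ olt e (oadd (omul a b') a).
Proof.
elim: b => [//|b IH|f IH] /=; first by exists b; split=> //; exact: ole_refl.
by case=> n /IH [b' [h1 h2]]; exists b'; split=> //; exists n.
Qed.

(** * Powers of omega *)

Lemma wexp_pos b : olt OZ (wexp b).
Proof.
elim: b => [//|b IH|f IH]; last by exists 0; exact: IH.
by exists 1; rewrite /= add0o.
Qed.
Hint Resolve wexp_pos : core.

Lemma fin_ole m n : m <= n -> ole (fin m) (fin n).
Proof. by elim: m n => [//|m IH] [//|n] /IH. Qed.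

Lemma fin_ole_inv m n : ole (fin m) (fin n) -> m <= n.
Proof. by elim: m n => [//|m IH] [//|n] /IH. Qed.

Lemma fin_olt m n : m < n -> olt (fin m) (fin n).
Proof. exact: (@fin_ole m.+1 n). Qed.

Lemma finD m n : oadd (fin m) (fin n) = fin (m + n).
Proof. by elim: n => [|n /= ->]; rewrite ?addn0 ?addnS. Qed.

Lemma omul_finD a m n : oadd (omul a (fin m)) (omul a (fin n)) = omul a (fin (m + n)).
Proof. by rewrite -omulDr finD. Qed.

Lemma wexp_mono b c : ole b c -> ole (wexp b) (wexp c).
Proof.
elim: b c => [|b IHb|f IHf] c; first by move=> _; exact: wexp_pos.
- rewrite -/(olt b c).
  elim: c => [//|c _|g IHg]; first by move=> bc; apply: omul_mono_l; exact: IHb.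
  by case=> n /IHg H; exact: (@ole_sup _ (fun n => wexp (g n)) n).
- by move=> H n; apply: IHf; exact: H.
Qed.

Lemma wexp_ltS b : olt (wexp b) (wexp (OS b)).
Proof. by exists 2; rewrite /= add0o; exact: (oadd_lt_r _ (wexp_pos b)). Qed.

Lemma wexp_lt b c : olt b c -> olt (wexp b) (wexp c).
Proof. by move=> bc; exact: olt_ole_trans (wexp_ltS b) (wexp_mono bc). Qed.

Lemma wexp_lt_inv b c : olt (wexp b) (wexp c) -> olt b c.
Proof. by move=> H; apply: not_ole_lt => /wexp_mono /(olt_not_ole H). Qed.

Lemma oeq_wexp b c : oeq b c -> oeq (wexp b) (wexp c).
Proof. by case=> h1 h2; split; exact: wexp_mono. Qed.

Lemma oeq_oadd a b c d : oeq a b -> oeq c d -> oeq (oadd a c) (oadd b d).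
Proof. by move=> [h1 h2] [h3 h4]; split; exact: oadd_mono. Qed.

Lemma oeq_omul a b c d : oeq a b -> oeq c d -> oeq (omul a c) (omul b d).
Proof. by move=> [h1 h2] [h3 h4]; split; exact: omul_mono. Qed.

Lemma ole_wexp b : ole b (wexp b).
Proof.
elim: b => [//|b IH|f IH]; last by move=> n; exact: (@ole_sup _ (fun n => wexp (f n)) n (IH n)).
exact: ole_olt_trans IH (wexp_ltS b).
Qed.

Lemma fin_olt_omega n : olt (fin n) omega.
Proof. by exists n.+1; exact: ole_refl. Qed.

(** Additive indecomposability of w^a. At a supremum, one index bounds [x] and another gives the
    term considered; the larger of the two exponents serves for both. *)
Lemma oadd_absorb a x : olt x (wexp a) -> ole (oadd x (wexp a)) (wexp a).
Proof.
elim: a x => [|a IH|f IH] x.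
- by rewrite [olt _ _]/(ole x OZ) /= => /(@oadd_mono_l _ OZ (OS OZ)) /=; rewrite ?add0o.
- case=> n Hn /= m.
  apply: ole_trans (oadd_mono_l _ (olt_ole Hn)) _; rewrite omul_finD.
  exact: (@ole_sup _ (fun n => omul (wexp a) (fin n)) (n + m)).
- case=> n Hn /= m; case: (ole_or_lt (wexp (f m)) (wexp (f n))) => H.
    apply: (@ole_sup _ (fun n => oexp omega (f n)) n).
    by apply: ole_trans (oadd_mono_r _ H) _; exact: IH Hn.
  by apply: (@ole_sup _ (fun n => oexp omega (f n)) m); apply: IH; exact: olt_trans Hn H.
Qed.

Lemma olt_oadd_wexp a x y : olt x (wexp a) -> olt y (wexp a) -> olt (oadd x y) (wexp a).
Proof. by move=> hx hy; exact: olt_ole_trans (oadd_lt_r x hy) (oadd_absorb hx). Qed.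

(** A tree [OL f] may denote zero or a successor, when its supremum is attained. The third case
    therefore asks that all terms lie strictly below. *)
Lemma ord_cases e : oeq e OZ \/ (exists d, oeq e (OS d)) \/
   (exists f, oeq e (OL f) /\ forall n, olt (f n) e).
Proof.
elim: e => [|e _|f IH]; [by left|by right; left; exists e|].
case: (classic (forall n, olt (f n) (OL f))) => [H|]; first by right; right; exists f.
move=> H; have [n Hn] := not_all_ex_not _ _ H.
have En : oeq (OL f) (f n).
  by split; [case: (ole_or_lt (OL f) (f n)) => // /Hn | exact: (ole_sup (g := f))].
case: (IH n) => [H0|[[d Hd]|[g [Hg H2]]]].
- by left; exact: oeq_trans En H0.
- by right; left; exists d; exact: oeq_trans En Hd.
- right; right; exists g; split; first exact: oeq_trans En Hg.
  by move=> m; apply: olt_ole_trans (H2 m) (proj2 En).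
Qed.

Lemma limit_no_succ e f b : oeq e (OL f) -> (forall n, olt (f n) e) -> olt b e -> olt (OS b) e.
Proof.
move=> [h1 h2] H /olt_ole_trans /(_ h1) /olt_sup [n Hn].
exact: ole_olt_trans Hn (H n).
Qed.

Lemma is_limit_of_sup e f : oeq e (OL f) -> (forall n, olt (f n) e) -> is_limit e.
Proof.
move=> Ef Hf; split=> [[h _]|[b [h1 h2]]]; first by case: (olt_ole_trans (Hf 0) h).
have H := limit_no_succ Ef Hf h2.
by case: (olt_irr (olt_ole_trans H h1)).
Qed.

Lemma zero_succ_limit e : oeq e OZ \/ is_succ e \/ is_limit e.
Proof.
case: (ord_cases e) => [|[|[f [H1 H2]]]]; [by left|by right; left|].
by right; right; exact: is_limit_of_sup H1 H2.
Qed.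

(** * Division with remainder and Cantor normal form *)

Lemma omul_div b a : olt OZ a -> exists q r, oeq b (oadd (omul a q) r) /\ olt r a.
Proof.
move=> a0; have Hb : olt b (omul a (OS b)).
  suff H c : ole c (omul a c) by exact: olt_ole_trans (H (OS b)) _.
  elim: c => [//|c IH|f IH]; last by move=> n; exact: (@ole_sup _ (fun n => omul a (f n)) n (IH n)).
  exact: ole_olt_trans IH (oadd_lt_r (omul a c) a0).
case: (olt_mul_split Hb) => q [_]; elim/ord_ind: q => q IH Hq.
case: (ole_or_lt (omul a q) b) => [H|H].
  case: (osub_exists H) => r [h1 h2]; exists q, r; split=> //.
  by apply: (@oadd_cancel_lt (omul a q)); exact: ole_olt_trans h2 Hq.
by case: (olt_mul_split H) => q' [h1 h2]; exact: (IH q' h1).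
Qed.

Lemma lead_exp_exists b : olt OZ b -> exists d, ole (wexp d) b /\ olt b (wexp (OS d)).
Proof.
move=> b0; have: olt b (wexp (OS b)) by exact: ole_olt_trans (ole_wexp b) (wexp_ltS b).
move: (OS b) => e; elim/ord_ind: e => e IH He.
case: (ord_cases e) => [[H0 _]|[[d [H1 H2]]|[f [[H1 _] H2]]]].
- by case: (olt_not_ole b0); exact: (olt_ole_trans He (wexp_mono H0)).
- have Hd : olt b (wexp (OS d)) by exact: olt_ole_trans He (wexp_mono H1).
  case: (ole_or_lt (wexp d) b) => [|H]; first by exists d.
  exact: IH H2 H.
- by case: (olt_ole_trans He (wexp_mono H1)) => n Hn; exact: IH (H2 n) Hn.
Qed.

(** The last term w^d of the normal form is factored out. Write b = w^d m + r with r < w^d. If r =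
    0, [m] is a successor; otherwise r = w^d1 (r1 + 1) with d1 < d by induction, and w^d m is a
    multiple of w^d1. *)
Lemma cnf_last b : olt OZ b -> exists d r, oeq b (omul (wexp d) (OS r)).
Proof.
elim/ord_ind: b => b IH b0.
have [d [h1 h2]] := lead_exp_exists b0.
have [q [r [Eb Hr]]] := omul_div b (wexp_pos d).
have [m Hm] : exists m, oeq q (fin m).
  have Hq : olt q omega.
    apply: (@omul_cancel_lt (wexp d)); apply: ole_olt_trans h2.
    exact: ole_trans (oadd_ge_l _ r) (proj2 Eb).
  case/olt_sup: Hq => n; elim: n q {Eb h1 h2} => [//|n IHn] q Hq.
  case: (ord_cases q) => [H0|[[q' [H1 H2]]|[f [[H1 H2] H3]]]]; first by exists 0.
    have [m [e1 e2]] := IHn q' (ole_trans H2 Hq).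
    exists m.+1; split; first by apply: ole_trans H1 _; exact: e1.
    by apply: ole_trans H2; exact: e2.
  case: (ole_or_lt (fin n) q) => [H|]; last exact: IHn.
  by exists n; split.
case: (ord_cases r) => [E0|Hr'].
  case: m Hm => [Hm|m Hm].
    case: (olt_not_ole b0); apply: ole_trans (proj1 Eb) _.
    exact: ole_trans (oadd_mono (omul_mono_r _ (proj1 Hm)) (proj1 E0)) _.
  exists d, (fin m); apply: oeq_trans Eb _.
  apply: oeq_trans (oeq_oadd (oeq_refl _) E0) _ => /=.
  exact: (oeq_omul (oeq_refl (wexp d)) Hm).
have r0 : olt OZ r.
  case: Hr' => [[d' [_ H]]|[f [_ H]]]; first exact: ole_trans (_ : ole (OS OZ) (OS d')) H.
  exact: ole_olt_trans _ (H 0).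
have [d1 [r1 E1]] := IH r (olt_ole_trans Hr h1) r0.
have d1d : olt d1 d.
  apply: wexp_lt_inv; apply: ole_olt_trans Hr; apply: ole_trans (proj2 E1).
  by rewrite /=; exact: oadd_ge_r.
have [e Ee] := osub_exists (olt_ole d1d).
exists d1, (oadd (omul (wexp e) q) r1); apply: oeq_trans Eb _.
rewrite -[OS (oadd _ _)]/(oadd _ (OS r1)) omulDr; apply: oeq_oadd => //.
rewrite -omulA -wexpD; apply: oeq_omul => //; exact: oeq_wexp.
Qed.

Lemma olt_S_wexp e y : olt OZ e -> olt y (wexp e) -> olt (OS y) (wexp e).
Proof.
move=> e0 Hy; apply: (@olt_oadd_wexp e y (OS OZ)) => //.
exact: (wexp_lt e0).
Qed.

Lemma cnf_not_succ d r g : olt OZ d -> ~ oeq (omul (wexp d) (OS r)) (OS g).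
Proof.
move=> d0 [h1 h2]; have := olt_ole_trans (ole_refl (OS g)) h2.
case/olt_add_split => [H|[y [Hy H]]].
- have : olt (OS g) (omul (wexp d) (OS r)).
    by apply: ole_olt_trans H _; exact: (oadd_lt_r _ (wexp_pos d)).
  by move/olt_not_ole.
- have : olt (OS g) (omul (wexp d) (OS r)).
    apply: (@ole_olt_trans (oadd (omul (wexp d) r) (OS y))); first exact: H.
    exact: (oadd_lt_r _ (olt_S_wexp d0 Hy)).
  by move/olt_not_ole.
Qed.

(** If the exponents differed, cancelling the smaller power would make a successor equal to w^e (r2
    + 1) with e > 0, which is never one. *)
Lemma cnf_last_unique d r d' r' :
  oeq (omul (wexp d) (OS r)) (omul (wexp d') (OS r')) -> oeq d d' /\ oeq r r'.
Proof.
have key d1 r1 d2 r2 : oeq (omul (wexp d1) (OS r1)) (omul (wexp d2) (OS r2)) -> ole d2 d1.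
  move=> E; case: (ole_or_lt d2 d1) => // lt12.
  have [e Ee] := osub_exists (olt_ole lt12).
  have e0 : olt OZ e.
    by apply: not_ole_lt => e0; apply: (olt_not_ole lt12); apply: ole_trans (proj1 Ee) (oadd_mono_r _ e0).
  case: (@cnf_not_succ e r2 r1 e0); suff: oeq (omul (wexp d1) (OS r1)) (omul (wexp d1) (omul (wexp e) (OS r2))).
    by case=> h1 h2; split; apply: (omul_cancel (wexp_pos d1)).
  apply: oeq_trans E _; rewrite -omulA -wexpD; apply: oeq_omul => //; exact: oeq_wexp.
move=> E; have Ed : oeq d d' by split; [exact: key (oeq_sym E) | exact: key E].
split=> //.
have [h1 h2] : oeq (omul (wexp d) (OS r)) (omul (wexp d) (OS r')).
  by apply: oeq_trans E _; apply: oeq_omul => //; apply: oeq_wexp; exact: oeq_sym.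
by split; [exact: (omul_cancel (wexp_pos d) h1) | exact: (omul_cancel (wexp_pos d) h2)].
Qed.

(** Coefficients of w^z add: if [y] reaches w^z, the part of [x] below w^z is absorbed; if not, the
    two parts below w^z have a sum below w^z. *)
Lemma olt_omul_finD z x y k j : olt x (omul (wexp z) (fin k.+1)) -> olt y (omul (wexp z) (fin j.+1)) ->
  olt (oadd x y) (omul (wexp z) (fin (k + j).+1)).
Proof.
elim: j x y k => [|j IH] x y k Hx Hy.
  rewrite addn0; rewrite /= add0o in Hy.
  case/olt_add_split: Hx => [Hx|[x' [Hx' Hx]]].
    apply: olt_ole_trans (oadd_lt_r x Hy) _ => /=; exact: (oadd_mono_l _ (olt_ole Hx)).
  apply: ole_olt_trans (oadd_mono_l _ Hx) _; rewrite oaddA /=.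
  by apply: oadd_lt_r; exact: olt_oadd_wexp.
case: (ole_or_lt (wexp z) y) => [H|H].
  have [y1 [E1 E2]] := osub_exists H.
  have Hy1 : olt y1 (omul (wexp z) (fin j.+1)).
    apply: (@oadd_cancel_lt (wexp z)); apply: ole_olt_trans E2 _.
    by rewrite -[X in oadd X _](omulo1 (wexp z)) (omul_finD _ 1).
  apply: ole_olt_trans (oadd_mono_r x E1) _; rewrite -oaddA.
  rewrite -addSnnS; apply: IH => //.
  case/olt_add_split: Hx => [Hx|[x' [Hx' Hx]]].
    apply: ole_olt_trans (oadd_mono_l _ (olt_ole Hx)) _.
    exact: (omul_lt_r (wexp_pos z) (fin_olt (ltnSn k.+1))).
  apply: ole_olt_trans (oadd_mono_l _ Hx) _; rewrite oaddA.
  apply: ole_olt_trans (oadd_mono_r _ (oadd_absorb Hx')) _.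
  exact: (omul_lt_r (wexp_pos z) (fin_olt (ltnSn k.+1))).
apply: olt_ole_trans (IH x y k Hx _) (omul_mono_r _ (fin_ole _)); last by lia.
by apply: olt_ole_trans H _; exact: oadd_ge_r.
Qed.

Lemma digit_exists z x : olt x (wexp (OS z)) ->
  exists k, ole (omul (wexp z) (fin k)) x /\ olt x (omul (wexp z) (fin k.+1)).
Proof.
case=> n; elim: n => [//|n IH] Hn.
by case: (ole_or_lt (omul (wexp z) (fin n)) x) => [|/IH]; first by exists n.
Qed.

(** * Families of finite sets *)

Local Notation comp := Defs.comp.

Lemma fs_cat s t : fs (s ++ t) <-> [/\ fs s, fs t & forall x y, x \in s -> y \in t -> x < y].
Proof.
rewrite /fs !(sorted_pairwise ltn_trans) pairwise_cat all_cat; split.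
- case=> /and3P[/allrelP H -> ->] /andP[-> ->]; split=> //; exact: H.
- case=> [[-> ->] [-> ->] H]; split=> //; rewrite !andbT; apply/allrelP; exact: H.
Qed.

Lemma fs_cons k s : fs (k :: s) <-> [/\ 0 < k, fs s & forall y, y \in s -> k < y].
Proof.
rewrite -cat1s fs_cat; split.
- case=> [[_ /=]]; rewrite andbT => -> ? H; split=> // y ys; exact: H (mem_head _ _) ys.
- case=> k0 ? H; split=> //; first by rewrite /fs /= k0.
  by move=> x y; rewrite inE => /eqP-> /H.
Qed.

Lemma fs_nil : fs [::]. Proof. by []. Qed.
Lemma fs_seq1 k : 0 < k -> fs [:: k]. Proof. by rewrite /fs /= => ->. Qed.
Hint Resolve fs_nil : core.

Lemma fs_subseq s t : fs t -> subseq s t -> fs s.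
Proof.
move=> [h1 h2] st; split; first exact: (subseq_sorted ltn_trans st).
by apply/allP => x /(mem_subseq st); apply/allP.
Qed.

Lemma fs_smin s x : fs s -> x \in s -> smin s <= x.
Proof. by case: s => [//|y s] /fs_cons[_ _ H]; rewrite inE /= => /predU1P[->//|/H/ltnW]. Qed.

Lemma fs_smax s x : fs s -> x \in s -> x <= smax s.
Proof.
case/lastP: s => [//|s y]; rewrite -cats1 => /fs_cat[_ _ H].
rewrite mem_cat /smax last_cat /= inE => /orP[xs|/eqP->//].
by apply/ltnW/H => //; rewrite inE.
Qed.

Lemma smin_in s : s <> [::] -> smin s \in s.
Proof. by case: s => // x s _; exact: mem_head. Qed.

Lemma smax_in s : s <> [::] -> smax s \in s.
Proof. by case: s => // x s _; exact: mem_last. Qed.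

Lemma fs_smin_gt0 s : fs s -> s <> [::] -> 0 < smin s.
Proof. by case: s => [//|x s] /fs_cons[]. Qed.

(** * Successive blocks *)

Lemma blocks_cons E Es : blocks_ok (E :: Es) <->
  [/\ fs E, E <> [::], blocks_ok Es & forall E', E' \in Es -> setlt E E'].
Proof.
split.
- case=> H1 H2; have [? ?] := H1 E (mem_head _ _); split=> //.
  + split=> [E' H'|i j ij]; first by apply: H1; rewrite inE H' orbT.
    by apply: (H2 i.+1 j.+1).
  + move=> E' H'; have := H2 0 (index E' Es).+1; rewrite /= nth_index // ltnS index_mem.
    by apply.
- case=> h1 h2 [h3 h4] h5; split=> [E'|[|i] [|j]] //=.
  + by rewrite inE => /predU1P[->//|/h3].
  + by move=> H; apply/h5/mem_nth.
  + by move=> H; apply: h4; lia.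
Qed.

Lemma blocks_nil : blocks_ok [::]. Proof. by split=> // i j; rewrite /= ltn0 andbF. Qed.
Hint Resolve blocks_nil : core.

Lemma setlt_lt E E' x y : fs E -> fs E' -> setlt E E' -> x \in E -> y \in E' -> x < y.
Proof.
move=> h1 h2 H xE yE; apply: leq_ltn_trans (fs_smax h1 xE) _.
exact: leq_trans H (fs_smin h2 yE).
Qed.

(** Turns conditions on pairs of blocks into one condition on the concatenation; nearly all later
    checks of [blocks_ok] go through this form. *)
Lemma blocks_fs Es : blocks_ok Es <-> fs (flatten Es) /\ [::] \notin Es.
Proof.
elim: Es => [|E Es IH] //=; rewrite blocks_cons fs_cat inE negb_or; split.
- case=> h1 h2 h3 h4; have [h5 ->] := proj1 IH h3; split; last by case: (E) h2.
  split=> // x y xE /flattenP[E' HE' yE'].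
  exact: setlt_lt h1 (proj1 (proj1 h3 _ HE')) (h4 _ HE') xE yE'.
- case=> [[h1 h2 h3] /andP[h4 h5]]; split=> //; try exact: (proj2 IH).
    by case: (E) h4.
  move=> E' HE'; have E'0 : E' <> [::] by move=> E0; rewrite -E0 HE' in h5.
  apply: h3; first by apply: smax_in; case: (E) h4.
  by apply/flattenP; exists E' => //; exact: smin_in.
Qed.

Lemma blocks_in_fs Es E : blocks_ok Es -> E \in Es -> fs E. Proof. by move=> [H _] /H[]. Qed.
Lemma blocks_in_nil Es E : blocks_ok Es -> E \in Es -> E <> [::]. Proof. by move=> [H _] /H[]. Qed.

Lemma mins_sub Es : blocks_ok Es -> {subset map smin Es <= flatten Es}.
Proof.
move=> H x /mapP[E HE ->]; apply/flattenP; exists E => //.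
exact: smin_in (blocks_in_nil H HE).
Qed.

Lemma mins_fs Es : blocks_ok Es -> fs (map smin Es).
Proof.
elim: Es => [//|E Es IH] /blocks_cons[h1 h2 h3 h4] /=; apply/fs_cons; split.
- exact: fs_smin_gt0.
- exact: IH.
- move=> y /mapP[E' HE' ->]; apply: leq_ltn_trans (h4 _ HE').
  by apply: fs_smax => //; exact: smin_in.
Qed.

(* [dom F' F]: [F'] is obtained from [F] by spreading an initial segment.  For families of
   increasing sequences, closure under [dom] amounts to being both hereditary and spreading. *)
Fixpoint dom (F' F : seq nat) : bool :=
  match F', F with
  | [::], _ => true
  | x :: F1, y :: F2 => (y <= x) && dom F1 F2
  | _, [::] => false
  end.

Definition pclosed (G : fam) := forall F F', G F -> fs F' -> dom F' F -> G F'.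

Lemma dom_nthP F' F : reflect (size F' <= size F /\ forall i, i < size F' -> nth 0 F i <= nth 0 F' i) (dom F' F).
Proof.
elim: F' F => [|x F' IH] [|y F] /=; try by constructor.
- by constructor; case.
- apply: (iffP andP) => [[xy /IH[h1 h2]]|[h1 h2]]; first by split=> // -[|i] //=; exact: h2.
  by split; [exact: (h2 0)|apply/IH; split=> // i; exact: (h2 i.+1)].
Qed.

Lemma dom_refl F : dom F F. Proof. by elim: F => //= x F ->; rewrite leqnn. Qed.

Lemma dom_size F' F : dom F' F -> size F' <= size F. Proof. by case/dom_nthP. Qed.

Lemma dom_smin F' F : dom F' F -> F' <> [::] -> smin F <= smin F'.
Proof. by case: F' F => [//|x F'] [//|y F] /= /andP[]. Qed.

Lemma dom_trans F2 F1 F3 : dom F1 F2 -> dom F2 F3 -> dom F1 F3.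
Proof.
elim: F1 F2 F3 => [//|x F1 IH] [//|y F2] [//|z F3] /= /andP[h1 h2] /andP[h3 h4].
by rewrite (leq_trans h3 h1) (IH _ _ h2 h4).
Qed.

Lemma dom_catl F' E R : dom F' (E ++ R) -> dom (take (size E) F') E /\ dom (drop (size E) F') R.
Proof.
elim: E F' => [|y E IH] F' /=; first by rewrite take0 drop0.
by case: F' => [//|x F'] /= /andP[-> /IH].
Qed.

Lemma dom_cons_skip y F F' : fs (y :: F) -> dom F' F -> dom F' (y :: F).
Proof.
elim: F y F' => [|z F IH] y [//|x F'] // H /= /andP[h1 h2].
have /fs_cons[_ H2 /(_ z (mem_head _ _)) yz] := H.
by rewrite (leq_trans (ltnW yz) h1); exact: IH.
Qed.

Lemma subseq_dom F F' : fs F -> subseq F' F -> dom F' F.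
Proof.
elim: F F' => [|y F IH] F' H /=; first by move/eqP->.
have /fs_cons[_ H2 _] := H.
case: F' => [//|x F'] /=; case: eqP => [->|_] S; first by rewrite leqnn; exact: IH.
exact: (dom_cons_skip H (IH _ H2 S)).
Qed.

Lemma regular_pclosed F0 : regular F0 -> pclosed F0.
Proof.
move=> [h1 [h2 [h3 _]]] F F' HF HF' /dom_nthP[Hs Hn].
have H : F0 (take (size F') F).
  apply: (h2 _ _ HF _ (take_subseq _ _)); exact: fs_subseq (h1 _ HF) (take_subseq _ _).
apply: h3 H HF' _ _; first by rewrite size_takel.
by move=> i; rewrite size_takel // => Hi; rewrite nth_take //; exact: Hn.
Qed.

Lemma S1_pclosed : pclosed S1.
Proof.
move=> F F' [h1 h2] HF' D; split=> //.
case: F' HF' D => [//|x F'] _ D; apply: leq_trans (dom_size D) _; apply: leq_trans h2 _.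
exact: dom_smin D _.
Qed.

(** * Composition of families *)

Lemma comp_fs M N F : comp M N F -> fs F.
Proof. by case=> Es [-> [/blocks_fs[]]]. Qed.

Lemma comp_nil (M N : fam) : M [::] -> comp M N [::]. Proof. by exists [::]. Qed.

Lemma comp_single (M N : fam) F : fs F -> F <> [::] -> M [:: smin F] -> N F -> comp M N F.
Proof.
move=> h1 h2 h3 h4; exists [:: F]; split; first by rewrite /= cats0.
split; first by apply/blocks_cons.
by split=> // E; rewrite inE => /eqP->.
Qed.

Lemma comp_mono (M N M' N' : fam) F :
  (forall E, M E -> M' E) -> (forall E, N E -> N' E) -> comp M N F -> comp M' N' F.
Proof. by move=> HM HN [Es [-> [h1 [h2 h3]]]]; exists Es; do !split=> //; auto; case: h1. Qed.

(** The dominating set is cut at the sizes of the given blocks. Each piece is dominated by its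
    block, and so are the minima. *)
Lemma comp_pclosed M N : pclosed M -> pclosed N -> pclosed (comp M N).
Proof.
move=> HM HN F F' [Es [-> [HB [HNE HME]]]] fsF' D.
suff [Es' [E1 E2 E3 E4]] : exists Es', [/\ F' = flatten Es', [::] \notin Es',
    forall E, E \in Es' -> N E & dom (map smin Es') (map smin Es)].
  have B : blocks_ok Es' by apply/blocks_fs; rewrite -E1.
  by exists Es'; do !split=> //; try (by case: B); exact: HM HME (mins_fs B) E4.
elim: Es F' HB HNE D fsF' {HME} => [|E Es IH] F' HB HNE D fsF'.
  by exists [::]; case: (F') D.
have /blocks_cons[h1 h2 h3 h4] := HB.
case: (F' =P [::]) => [->|F'0]; first by exists [::].
have [D1 D2] := dom_catl D.
have := fsF'; rewrite -{1}(cat_take_drop (size E) F') => /fs_cat[f1 f2 _].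
have [|Es' [e1 e2 e3 e4]] := IH _ h3 _ D2 f2.
  by move=> E' H'; apply: HNE; rewrite inE H' orbT.
have t0 : take (size E) F' <> [::] by case: (F') (E) F'0 h2 => [//|x ?] [].
exists (take (size E) F' :: Es'); split.
- by rewrite /= -e1 cat_take_drop.
- by rewrite inE negb_or e2 andbT; apply/eqP => H; apply: t0.
- move=> E'; rewrite inE => /predU1P[->|/e3//].
  by apply: HN D1 => //; apply: HNE; exact: mem_head.
- by rewrite /= e4 andbT; exact: dom_smin.
Qed.

(** Passing to subsets of the blocks moves minima to the right, and discarding the empty ones
    removes some of them; both are covered by [dom]. *)
Lemma shrink_blocks (Es : seq (seq nat)) (D : seq nat -> seq nat) : blocks_ok Es ->
  (forall E, E \in Es -> fs (D E) /\ {subset D E <= E}) ->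
  let Es' := filter (fun E => E != [::]) (map D Es) in
  [/\ blocks_ok Es', dom (map smin Es') (map smin Es) & flatten Es' = flatten (map D Es)].
Proof.
move=> HB HD Es'.
suff [e1 [e2 e3] e4] : [/\ flatten Es' = flatten (map D Es),
    fs (flatten Es') /\ {subset flatten Es' <= flatten Es} & dom (map smin Es') (map smin Es)].
  by split=> //; apply/blocks_fs; split=> //; rewrite mem_filter eqxx.
rewrite {}/Es'; elim: Es HB HD => [|E Es IH] HB HD //=.
have /blocks_cons[h1 h2 h3 h4] := HB.
have [|e1 [e2 e3] e4] := IH h3.
  by move=> E' H'; apply: HD; rewrite inE H' orbT.
have [d1 d2] := HD _ (mem_head _ _).
case: (D E =P [::]) => [D0|D0] /=.
  split; first by rewrite D0.
    by split=> // x /e3; rewrite mem_cat orbC => ->.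
  exact: (@dom_cons_skip (smin E) (map smin Es) _ (mins_fs HB) e4).
split; first by rewrite e1.
  split; last by move=> x; rewrite !mem_cat => /orP[/d2->//|/e3->]; rewrite orbT.
  apply/fs_cat; split=> // x y /d2 xE /e3 yE.
  by have /blocks_fs[/= /fs_cat[_ _ H] _] := HB; exact: H.
by rewrite e4 andbT; apply: fs_smin => //; apply: d2; exact: smin_in.
Qed.

Lemma comp_of_subsets (M P : fam) (Es : seq (seq nat)) (D : seq nat -> seq nat) :
  pclosed M -> blocks_ok Es -> M (map smin Es) ->
  (forall E, E \in Es -> [/\ fs (D E), {subset D E <= E} & D E <> [::] -> P (D E)]) ->
  comp M P (flatten (map D Es)).
Proof.
move=> HM HB HME HD; have [|B d1 <-] := shrink_blocks (D := D) HB; first by move=> E /HD[].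
eexists; split=> //; split=> //; split; last exact: HM HME (mins_fs B) d1.
by move=> E; rewrite mem_filter => /andP[/eqP E0 /mapP[F HF EF]]; have [_ _] := HD _ HF; rewrite -EF; apply.
Qed.

Lemma choice_on (T U : Type) (P : T -> Prop) (Q : T -> U -> Prop) (u0 : U) :
  (forall x, P x -> exists y, Q x y) -> exists f : T -> U, forall x, P x -> Q x (f x).
Proof.
move=> H; have H' x : exists y, P x -> Q x y.
  by case: (classic (P x)) => [/H[y Hy]|Hx]; [exists y|exists u0].
exists (fun x => proj1_sig (constructive_indefinite_description _ (H' x))) => x.
exact: (proj2_sig (constructive_indefinite_description _ (H' x))).
Qed.

Lemma flatten_flatten (T : Type) (s : seq (seq (seq T))) : flatten (flatten s) = flatten (map flatten s).
Proof. by elim: s => //= x s <-; rewrite flatten_cat. Qed.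

Lemma map_flatten (T U : Type) (f : T -> U) (s : seq (seq T)) : map f (flatten s) = flatten (map (map f) s).
Proof. by elim: s => //= x s <-; rewrite map_cat. Qed.

Lemma smin_flatten Es : blocks_ok Es -> smin (flatten Es) = smin (map smin Es).
Proof. by case: Es => [//|[|x E] Es] // /blocks_cons[_ H]. Qed.

Lemma flatten_nil Es : blocks_ok Es -> flatten Es = [::] -> Es = [::].
Proof. by case: Es => [//|[|x E] Es] // /blocks_cons[_ H]. Qed.

Lemma comp_assoc (M N P : fam) F : comp M (comp N P) F -> comp (comp M N) P F.
Proof.
case=> Es [-> [HB [HNP HM]]].
have [f Hf] := @choice_on _ _ (fun E => E \in Es) (fun E Ds => E = flatten Ds /\ blocks_ok Ds /\
   (forall D, D \in Ds -> P D) /\ N (map smin Ds)) [::] HNP.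
have Ef : Es = map flatten (map f Es).
  by rewrite -map_comp -[LHS]map_id; apply/eq_in_map => E /Hf[].
have no_nil : [::] \notin flatten (map f Es).
  apply/flattenP => -[Ds /mapP[E HE ->]]; have [_ [/blocks_fs[_ H] _]] := Hf _ HE.
  by move=> H'; rewrite H' in H.
have EF : flatten Es = flatten (flatten (map f Es)) by rewrite flatten_flatten -Ef.
have B : blocks_ok (flatten (map f Es)).
  by apply/blocks_fs; rewrite -EF; split=> //; case/blocks_fs: HB.
exists (flatten (map f Es)); split=> //; split=> //; split.
  by move=> D /flattenP[Ds /mapP[E HE ->]]; have [_ [_ [H _]]] := Hf _ HE; exact: H.
exists (map (map smin) (map f Es)); split; first by rewrite map_flatten.
have Emin : map smin (map (map smin) (map f Es)) = map smin Es.
  rewrite -!map_comp; apply/eq_in_map => E HE /=.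
  by have [E1 [/smin_flatten H _]] := Hf _ HE; rewrite -H -E1.
split; last split.
- apply/blocks_fs; rewrite -map_flatten; split; first exact: mins_fs.
  apply/negP => /mapP[Ds /mapP[E HE ->]]; case: (f E) (Hf _ HE) => // -[E0 _].
  by case: (blocks_in_nil HB HE).
- by move=> ? /mapP[Ds /mapP[E HE ->] ->]; have [_ [_ []]] := Hf _ HE.
- by rewrite Emin.
Qed.

(** A decomposition of the set of minima is transported to the blocks themselves: neighbouring
    blocks are merged into superblocks with minima in [M], each carrying a family with minima in
    [P]. *)
Lemma comp_group (M P : fam) Es : blocks_ok Es -> comp M P (map smin Es) ->
  exists Ess : seq (seq (seq nat)), [/\ Es = flatten Ess, blocks_ok (map flatten Ess),
    M (map smin (map flatten Ess)) & forall G, G \in Ess -> blocks_ok G /\ P (map smin G)].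
Proof.
move=> HB [Ms [E0 [HBM [HP HM]]]].
exists (reshape (shape Ms) Es).
have Esz : sumn (shape Ms) = size Es by rewrite -[RHS](size_map smin) E0 size_flatten.
have EE : flatten (reshape (shape Ms) Es) = Es by rewrite reshapeKr ?Esz.
have Em : map (map smin) (reshape (shape Ms) Es) = Ms by rewrite map_reshape E0 flattenK.
have Hin G : G \in reshape (shape Ms) Es -> blocks_ok G /\ map smin G \in Ms.
  move=> HG; split; last by rewrite -Em; exact: map_f.
  have /blocks_fs[h1 h2] := HB; apply/blocks_fs; split; last first.
    by apply: contra h2 => H; rewrite -EE; apply/flattenP; exists G.
  apply: fs_subseq h1 _; rewrite -EE flatten_flatten.
  elim: (reshape _ _) HG => //= G' R IH; rewrite inE => /predU1P[->|/IH S].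
    exact: prefix_subseq.
  exact: subseq_trans S (suffix_subseq _ _).
split=> //.
- apply/blocks_fs; rewrite -flatten_flatten EE; split; first by case/blocks_fs: HB.
  apply/negP => /mapP[G HG H]; have [B H2] := Hin _ HG.
  by rewrite (flatten_nil B (esym H)) in H2; case: (blocks_in_nil HBM H2).
- suff -> : map smin (map flatten (reshape (shape Ms) Es)) = map smin Ms by [].
  rewrite -{2}Em -!map_comp; apply/eq_in_map => G /Hin[B _] /=; exact: smin_flatten.
- by move=> G /Hin[B H]; split=> //; exact: HP.
Qed.

(** * Schreier families *)

Section Schreier.
Variable zeta : Ord -> nat -> Ord.

Section SchInd.
Variable P : Ord -> seq nat -> Prop.
Hypothesis Pnil : forall b, P b [::].
Hypothesis Pzero : forall b k, oeq b OZ -> 0 < k -> P b [:: k].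
Hypothesis Psucc : forall b g F, oeq b (OS g) -> comp S1 (P g) F -> P b F.
Hypothesis Plim_succ : forall b d d0 r n F, oeq b (omul (wexp d) (OS r)) -> oeq d (OS d0) ->
  1 <= n -> F <> [::] -> n <= smin F ->
  P (oadd (omul (wexp d) r) (omul (wexp d0) (fin n))) F -> P b F.
Hypothesis Plim_lim : forall b d r n F, oeq b (omul (wexp d) (OS r)) -> is_limit d ->
  1 <= n -> F <> [::] -> n <= smin F ->
  P (oadd (omul (wexp d) r) (wexp (zeta d n))) F -> P b F.

(* The generated principle has no induction hypothesis for the nested occurrence in [Sch_succ]. *)
Fixpoint Sch_nested_ind b F (H : Sch zeta b F) {struct H} : P b F :=
  match H with
  | Sch_empty b => Pnil b
  | Sch_zero b k h1 h2 => Pzero h1 h2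
  | Sch_succ b g F h1 _ h3 =>
      match h3 with
      | ex_intro Es (conj e1 (conj e2 (conj e3 e4))) =>
          Psucc h1 (ex_intro _ Es (conj e1 (conj e2 (conj (fun E HE => Sch_nested_ind (e3 E HE)) e4))))
      end
  | Sch_lim_succ b d d0 r n F h1 h2 h3 h4 h5 h6 => Plim_succ h1 h2 h3 h4 h5 (Sch_nested_ind h6)
  | Sch_lim_lim b d r n F h1 h2 h3 h4 h5 h6 => Plim_lim h1 h2 h3 h4 h5 (Sch_nested_ind h6)
  end.
End SchInd.

Lemma Sch_fs b F : Sch zeta b F -> fs F.
Proof.
elim/Sch_nested_ind => // [b' k _ k0|b' g F' _ /comp_fs//].
exact: fs_seq1.
Qed.

Lemma Sch_oeq b b' F : oeq b b' -> Sch zeta b F -> Sch zeta b' F.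
Proof.
move=> /oeq_sym E H; case: H E.
- by move=> *; exact: Sch_empty.
- by move=> b0 k h1 h2 E; apply: Sch_zero => //; exact: oeq_trans h1.
- by move=> b0 g F0 h1 h2 h3 E; apply: Sch_succ (oeq_trans E h1) h2 h3.
- by move=> b0 d d0 r n F0 h1 h2 h3 h4 h5 h6 E; exact: Sch_lim_succ (oeq_trans E h1) h2 h3 h4 h5 h6.
- by move=> b0 d r n F0 h1 h2 h3 h4 h5 h6 E; exact: Sch_lim_lim (oeq_trans E h1) h2 h3 h4 h5 h6.
Qed.

Lemma Sch_succE b g F : oeq b (OS g) -> comp S1 (Sch zeta g) F -> Sch zeta b F.
Proof. by move=> E H; exact: Sch_succ E (comp_fs H) H. Qed.

Lemma Sch_pclosed b : pclosed (Sch zeta b).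
Proof.
(* The motive is itself closed under [dom], so that [comp_pclosed] applies to the induction
   hypothesis in the successor case. *)
pose Q b F := forall F', fs F' -> dom F' F -> Sch zeta b F'.
suff H b0 F : Sch zeta b0 F -> Q b0 F by move=> F F' /H; apply.
elim/Sch_nested_ind => {b b0 F} [b|b k Eb k0|b g F E H|b d d0 r n F h1 h2 h3 h4 h5 IH|b d r n F h1 h2 h3 h4 h5 IH] F'.
- by case: F' => // _ _; exact: Sch_empty.
- case: F' => [|x [|y F']]; [by move=> *; exact: Sch_empty| |by rewrite /= andbF].
  by move=> /fs_cons[x0 _ _] _; exact: Sch_zero.
- move=> fsF' D; apply: (Sch_succE E).
  have QP : pclosed (Q g) by move=> F1 F2 HQ h1 h2 F3 h3 h4; apply: HQ h3 (dom_trans h4 h2).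
  have [Es [E1 [E2 [E3 E4]]]] := comp_pclosed S1_pclosed QP H fsF' D.
  exists Es; split=> //; split=> //; split=> // E0 HE.
  by apply: (E3 _ HE) (dom_refl _); case: E2 => /(_ _ HE) [].
- case: F' => [|x F'] fsF' D; first exact: Sch_empty.
  apply: (Sch_lim_succ h1 h2 h3) (IH _ fsF' D) => //; exact: leq_trans h5 (dom_smin D _).
- case: F' => [|x F'] fsF' D; first exact: Sch_empty.
  apply: (Sch_lim_lim h1 h2 h3) (IH _ fsF' D) => //; exact: leq_trans h5 (dom_smin D _).
Qed.

Lemma cnf_exp0 d r : oeq d OZ -> is_succ (omul (wexp d) (OS r)).
Proof.
move=> E; exists (omul (OS OZ) r).
exact: (oeq_omul (oeq_wexp E) (oeq_refl (OS r))).
Qed.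

Lemma is_succ_oeq a b : oeq a b -> is_succ a -> is_succ b.
Proof. by move=> /oeq_sym E [c Ec]; exists c; exact: oeq_trans E Ec. Qed.

Lemma succ_not_zero a : is_succ a -> ~ oeq a OZ.
Proof. by case=> c [h1 h2] [h3 _]; exact: (ole_trans h2 h3). Qed.

Lemma cnf_pos d r : ~ oeq (omul (wexp d) (OS r)) OZ.
Proof.
case=> h _; have := olt_ole_trans (wexp_pos d) (oadd_ge_r (omul (wexp d) r) (wexp d)).
by move/olt_ole_trans => /(_ _ h).
Qed.

Lemma nonzero_gt0 a : ~ oeq a OZ -> olt OZ a.
Proof. by move=> H; apply: not_ole_lt => h; apply: H; split. Qed.

Lemma limit_cnf b : is_limit b -> exists d r, oeq b (omul (wexp d) (OS r)) /\ ~ oeq d OZ.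
Proof.
case=> b0 bS; have [d [r E]] := cnf_last (nonzero_gt0 b0).
exists d, r; split=> // d0; apply: bS; exact: is_succ_oeq (oeq_sym E) (cnf_exp0 _ d0).
Qed.

(* The paper's [\hat b_n], which is determined only up to [oeq]. *)
Definition hat b n h := exists d r, oeq b (omul (wexp d) (OS r)) /\
  ((exists d0, oeq d (OS d0) /\ oeq h (oadd (omul (wexp d) r) (omul (wexp d0) (fin n)))) \/
   (is_limit d /\ oeq h (oadd (omul (wexp d) r) (wexp (zeta d n))))).

Lemma Sch_hat b n h F : hat b n h -> 1 <= n -> F <> [::] -> n <= smin F -> Sch zeta h F -> Sch zeta b F.
Proof.
case=> d [r [E [[d0 [Ed Eh]]|[Ld Eh]]]] n1 F0 nF /(Sch_oeq Eh) H.
- exact: Sch_lim_succ E Ed n1 F0 nF H.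
- exact: Sch_lim_lim E Ld n1 F0 nF H.
Qed.

Lemma Sch_limit_inv b F : is_limit b -> Sch zeta b F ->
  F = [::] \/ exists n h, 1 <= n <= smin F /\ hat b n h /\ Sch zeta h F.
Proof.
move=> Lb H; case: H Lb => {b F} [b|b k E k0|b g F E _ _|b d d0 r n F h1 h2 h3 h4 h5 h6|b d r n F h1 h2 h3 h4 h5 h6] Lb.
- by left.
- by case: Lb.
- by case: Lb => _ []; exists g.
- right; exists n; eexists; split; last split; last exact: h6; first by apply/andP.
  by exists d, r; split=> //; left; exists d0.
- right; exists n; eexists; split; last split; last exact: h6; first by apply/andP.
  by exists d, r; split=> //; right.
Qed.

(** Indices matter only up to [oeq], so the limit constructors are excluded by the normal form: w^d
    (r + 1) with d > 0 is not a successor. *)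
Lemma Sch_succ_inv b g F : oeq b (OS g) -> Sch zeta b F -> comp S1 (Sch zeta g) F.
Proof.
move=> Eb H; case: H Eb => {b F} [b|b k E k0|b g' F E fsF H|b d d0 r n F h1 h2 h3 h4 h5 h6|b d r n F h1 h2 h3 h4 h5 h6] Eb.
- by apply: comp_nil.
- by case: (@succ_not_zero b); first exists g.
- have Eg : oeq g' g by exact: (oeq_trans (oeq_sym E) Eb).
  by apply: comp_mono H => // E'; exact: Sch_oeq.
- case: (@cnf_not_succ d r g).
    exact: (olt_ole_trans (_ : olt OZ (OS d0)) (proj2 h2)).
  exact: oeq_trans (oeq_sym h1) Eb.
- case: (@cnf_not_succ d r g); first by apply: nonzero_gt0; case: h2.
  exact: oeq_trans (oeq_sym h1) Eb.
Qed.

Lemma Sch_zero_inv b F : oeq b OZ -> Sch zeta b F -> size F <= 1.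
Proof.
move=> Eb H; case: H Eb => {b F} // [b g F E _ _|b d d0 r n F h1 _ _ _ _ _|b d r n F h1 _ _ _ _ _] Eb.
- by case: (@succ_not_zero b); first exists g.
- by case: (@cnf_pos d r); exact: oeq_trans (oeq_sym h1) Eb.
- by case: (@cnf_pos d r); exact: oeq_trans (oeq_sym h1) Eb.
Qed.

Hypothesis Hzeta : fund_seqs zeta.

Lemma zeta_lt d n : is_limit d -> 1 <= n -> olt (zeta d n) d.
Proof.
move=> Ld n1; have [h1 [h2 _]] := proj1 Hzeta d Ld.
exact: olt_ole_trans (h1 n n1) (h2 n).
Qed.

(** Uniqueness of the last term of the normal form, together with the invariance of [zeta] under
    [oeq]. *)
Lemma hat_uniq b n h h' : hat b n h -> hat b n h' -> oeq h h'.
Proof.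
case=> d [r [E H]] [d' [r' [E' H']]].
have [Ed Er] := cnf_last_unique (oeq_trans (oeq_sym E) E').
have Em := oeq_omul (oeq_wexp Ed) Er.
have nLS e e0 : is_limit e -> oeq e (OS e0) -> False by case=> _ H1 H2; apply: H1; exists e0.
case: H H' => [[d0 [Ed0 Eh]]|[Ld Eh]] [[d0' [Ed0' Eh']]|[Ld' Eh']].
- apply: oeq_trans Eh _; apply: oeq_trans (oeq_sym Eh'); apply: oeq_oadd => //.
  apply: oeq_omul => //; apply: oeq_wexp.
  exact: (oeq_trans (oeq_sym Ed0) (oeq_trans Ed Ed0')).
- by case: (nLS _ _ Ld' (oeq_trans (oeq_sym Ed) Ed0)).
- by case: (nLS _ _ Ld (oeq_trans Ed Ed0')).
- apply: oeq_trans Eh _; apply: oeq_trans (oeq_sym Eh'); apply: oeq_oadd => //.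
  by apply: oeq_wexp; exact: (proj2 Hzeta).
Qed.

Lemma hat_exists b n : is_limit b -> exists h, hat b n h.
Proof.
move=> /limit_cnf [d [r [E d0]]].
case: (zero_succ_limit d) => [//|[[d1 Ed]|Ld]].
- by eexists; exists d, r; split=> //; left; exists d1.
- by eexists; exists d, r; split=> //; right.
Qed.

Lemma hat_lt b n h : 1 <= n -> hat b n h -> olt h b.
Proof.
move=> n1 [d [r [E H]]]; apply: olt_ole_trans (proj2 E) => /=.
case: H => [[d0 [Ed Eh]]|[Ld Eh]]; apply: ole_olt_trans (proj1 Eh) _; apply: oadd_lt_r.
- apply: olt_ole_trans (wexp_mono (proj2 Ed)).
  apply: (@olt_ole_trans (omul (wexp d0) (fin n.+1))); first exact: (omul_lt_r (wexp_pos d0) (fin_olt (ltnSn n))).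
  exact: (@ole_sup _ (fun n => omul (wexp d0) (fin n)) n.+1).
- exact: wexp_lt (zeta_lt Ld n1).
Qed.

(** Needed for lower bounds of ranks at a limit: the powers of omega with exponents hat b_n are
    cofinal in w^b. *)
Lemma hat_sup b e : is_limit b -> olt e (wexp b) -> exists n h, 1 <= n /\ hat b n h /\ olt e (wexp h).
Proof.
move=> /limit_cnf [d [r [E d0]]] He.
case: (zero_succ_limit d) => [//|[[d1 Ed]|Ld]].
- have H : ole b (OL (fun n => oadd (omul (wexp d) r) (omul (wexp d1) (fin n)))).
    apply: ole_trans (proj1 E) _; exact: (oadd_mono_r _ (wexp_mono (proj1 Ed))).
  case: (olt_ole_trans He (wexp_mono H)) => n Hn.
  exists n.+1; eexists; split=> //; split; first by exists d, r; split=> //; left; exists d1.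
  apply: olt_ole_trans Hn (wexp_mono _); apply: oadd_mono_r; apply: omul_mono_r; exact: fin_ole.
- have H : ole b (OL (fun n => oadd (omul (wexp d) r) (wexp (zeta d n.+1)))).
    apply: ole_trans (proj1 E) _; have [_ [_ h2]] := proj1 Hzeta d Ld.
    exact: (oadd_mono_r _ (wexp_mono h2)).
  case: (olt_ole_trans He (wexp_mono H)) => n Hn.
  by exists n.+1; eexists; split=> //; split; first by exists d, r; split=> //; right.
Qed.

(** As b < w^(z+1), its last exponent [d] is at most [z], so w^z k is a multiple of w^d. A prefix
    w^z k thus changes only the part of the normal form which the attached sequence leaves alone. *)
Lemma hat_shift z k b n h : olt b (wexp (OS z)) -> hat b n h ->
  hat (oadd (omul (wexp z) (fin k)) b) n (oadd (omul (wexp z) (fin k)) h).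
Proof.
move=> bz [d [r [E H]]].
have dz : ole d z.
  apply: (wexp_lt_inv (c := OS z)); apply: ole_olt_trans bz; apply: ole_trans (proj2 E).
  exact: oadd_ge_r.
have [e Ee] := osub_exists dz.
have Em : oeq (omul (wexp z) (fin k)) (omul (wexp d) (omul (wexp e) (fin k))).
  by rewrite -omulA -wexpD; apply: oeq_omul => //; exact: oeq_wexp.
exists d, (oadd (omul (wexp e) (fin k)) r); split.
  rewrite -[OS (oadd _ _)]/(oadd _ (OS r)) omulDr; exact: oeq_oadd.
have E2 X : oeq h (oadd (omul (wexp d) r) X) -> oeq (oadd (omul (wexp z) (fin k)) h)
    (oadd (omul (wexp d) (oadd (omul (wexp e) (fin k)) r)) X).
  by move=> Eh; rewrite omulDr oaddA; exact: (oeq_oadd Em Eh).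
by case: H => [[d0 [Ed /E2 Eh]]|[Ld /E2 Eh]]; [left; exists d0|right].
Qed.

Lemma limit_add a b : is_limit b -> is_limit (oadd a b).
Proof.
move=> [b0 bS]; case: (ord_cases b) => [//|[//|[f [H1 H2]]]].
apply: (@is_limit_of_sup _ (fun n => oadd a (f n))); first exact: (oeq_oadd (oeq_refl a) H1).
by move=> n; exact: oadd_lt_r.
Qed.

Lemma S1_seq1 k : 0 < k -> S1 [:: k]. Proof. by move=> k0; split=> //; exact: fs_seq1. Qed.

(** An inclusion without exception for small minima. At a successor the set is taken as a single
    block; at a limit the index n = 1 is allowed for every nonempty set. *)
Lemma Sch_extend z k b F : olt b (wexp (OS z)) ->
  Sch zeta (omul (wexp z) (fin k)) F -> Sch zeta (oadd (omul (wexp z) (fin k)) b) F.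
Proof.
elim/ord_ind: b => b IH bz H; case: (F =P [::]) => [->|F0]; first exact: Sch_empty.
case: (zero_succ_limit b) => [b0|[[g Eg]|Lb]].
- by apply: Sch_oeq H; apply: oeq_sym; exact: (oeq_oadd (oeq_refl _) b0).
- have gb : olt g b by exact: (olt_ole_trans (ole_refl (OS g)) (proj2 Eg)).
  apply: (@Sch_succE _ (oadd (omul (wexp z) (fin k)) g)); first exact: (oeq_oadd (oeq_refl _) Eg).
  apply: comp_single => //; first exact: Sch_fs H.
    by apply/S1_seq1/fs_smin_gt0 => //; exact: Sch_fs H.
  by apply: IH => //; exact: olt_trans gb bz.
- have [h Hh] := hat_exists 1 Lb.
  apply: (Sch_hat (hat_shift k bz Hh)) => //; first by apply: fs_smin_gt0 => //; exact: Sch_fs H.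
  have hb := hat_lt (leqnn 1) Hh; apply: IH => //; exact: olt_trans hb bz.
Qed.

(* Below [w^(z+1)] the attached sequences are compatible with prefixing a multiple of [w^z]. *)
Lemma Sch_split z k b F : olt b (wexp (OS z)) ->
  Sch zeta (oadd (omul (wexp z) (fin k)) b) F -> comp (Sch zeta b) (Sch zeta (omul (wexp z) (fin k))) F.
Proof.
elim/ord_ind: b F => b IH F bz H; case: (F =P [::]) => [->|F0].
  apply: comp_nil; exact: Sch_empty.
have fsF := Sch_fs H.
case: (zero_succ_limit b) => [b0|[[g Eg]|Lb]].
- apply: comp_single => //; first by apply: Sch_zero => //; exact: fs_smin_gt0.
  by apply: Sch_oeq H; exact: (oeq_oadd (oeq_refl _) b0).
- have gb : olt g b by exact: (olt_ole_trans (ole_refl (OS g)) (proj2 Eg)).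
  have E : oeq (oadd (omul (wexp z) (fin k)) b) (OS (oadd (omul (wexp z) (fin k)) g)).
    exact: (oeq_oadd (oeq_refl _) Eg).
  have HI E' : Sch zeta (oadd (omul (wexp z) (fin k)) g) E' ->
      comp (Sch zeta g) (Sch zeta (omul (wexp z) (fin k))) E'.
    by apply: IH => //; exact: olt_trans gb bz.
  have := comp_assoc (comp_mono (fun E h => h) HI (Sch_succ_inv E H)).
  by apply: comp_mono => // E'; exact: Sch_succE.
- case: (Sch_limit_inv (limit_add _ Lb) H) => [//|[n [h' [/andP[n1 nF] [Hh' H']]]]].
  have [h Hh] := hat_exists n Lb.
  have E := hat_uniq Hh' (hat_shift k bz Hh).
  have hb := hat_lt n1 Hh.
  have [Es [E1 [E2 [E3 E4]]]] := IH h hb F (olt_trans hb bz) (Sch_oeq E H').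
  exists Es; do !split=> //; try (by case: E2).
  apply: (Sch_hat Hh) => //.
    by move=> E0; apply: F0; rewrite E1; case: (Es) E0.
  (* The bound n <= min F passes to the outer set, because the set of minima has the same minimum as
     [F]. *)
  by rewrite -smin_flatten // -E1.
Qed.

End Schreier.

(** * Ranks of families *)

Definition der k (G : fam) : fam := fun F => G (k :: F).

(** An upper bound for the rank of the tree of initial segments of members. No closure of [G] is
    assumed, and the empty set costs nothing. *)
Inductive rk : Ord -> fam -> Prop :=
| rk_intro e G : (forall k, (exists F, G (k :: F)) -> exists e', olt e' e /\ rk e' (der k G)) -> rk e G.

Lemma rk_inv e G : rk e G -> forall k, (exists F, G (k :: F)) -> exists e', olt e' e /\ rk e' (der k G).
Proof. by case. Qed.

Lemma rk_mono e e' (G G' : fam) : rk e G -> ole e e' -> (forall F, G' F -> G F) -> rk e' G'.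
Proof.
elim/ord_ind: e e' G G' => e IH e' G G' /rk_inv HG ee' GG'.
apply: rk_intro => k [F HF]; have [|d [de Hd]] := HG k; first by exists F; exact: GG'.
exists d; split; first exact: olt_ole_trans de ee'.
by apply: (IH _ de d (der k G)) => // F'; exact: GG'.
Qed.

Lemma rk_le e e' G : rk e G -> ole e e' -> rk e' G.
Proof. by move=> H ee'; exact: rk_mono H ee' _. Qed.

Lemma rk_empty e G : (forall k F, ~ G (k :: F)) -> rk e G.
Proof. by move=> H; apply: rk_intro => k [F /H]. Qed.

Lemma rk_der e k G : rk e G -> rk e (der k G).
Proof.
move=> H; case: (classic (exists F, G (k :: F))) => [HF|HF].
  by have [e' [h1 h2]] := rk_inv H HF; apply: rk_le h2 (olt_ole h1).
by apply: rk_empty => x F HG; apply: HF; exists (x :: F).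
Qed.

Lemma rk_prefix e G F : rk e G -> rk e (fun R => G (F ++ R)).
Proof. by elim: F G => [//|k F IH] G H; apply: (IH (der k G)); exact: rk_der. Qed.

(** Ranks do not add under unions: reading one element advances in both families, and the larger of
    the two new ranks remains. *)
Lemma rk_union e G1 G2 : rk e G1 -> rk e G2 -> rk e (fun F => G1 F \/ G2 F).
Proof.
elim/ord_ind: e G1 G2 => e IH G1 G2 H1 H2; apply: rk_intro => k [F HF].
have key e1 e2 : olt e1 e -> olt e2 e -> rk e1 (der k G1) -> rk e2 (der k G2) ->
    exists e', olt e' e /\ rk e' (der k (fun F => G1 F \/ G2 F)).
  move=> h1 h2 r1 r2; case: (ole_or_lt e1 e2) => [|/olt_ole] h.
    by exists e2; split=> //; apply: (IH _ h2 (der k G1) (der k G2)) => //; exact: rk_le h.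
  by exists e1; split=> //; apply: (IH _ h1 (der k G1) (der k G2)) => //; exact: rk_le h.
have e0 : olt OZ e.
  by case: HF => HF; [case: (rk_inv H1 (ex_intro _ F HF))|case: (rk_inv H2 (ex_intro _ F HF))];
    move=> d [hd _]; apply: ole_olt_trans hd.
have side G : rk e G -> exists d, olt d e /\ rk d (der k G).
  move=> H; case: (classic (exists F, G (k :: F))) => [/(rk_inv H)//|HG].
  by exists OZ; split=> //; apply: rk_empty => x F' HF'; apply: HG; exists (x :: F').
have [d1 [h1 r1]] := side _ H1; have [d2 [h2 r2]] := side _ H2; exact: key h1 h2 r1 r2.
Qed.

Definition rklt rho G := exists e, olt e rho /\ rk e G.

Lemma rklt_mono rho rho' (G G' : fam) : rklt rho G -> ole rho rho' -> (forall F, G' F -> G F) -> rklt rho' G'.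
Proof.
case=> e [he H] h HG; exists e; split; first exact: olt_ole_trans he h.
exact: rk_mono H _ HG.
Qed.

Lemma rklt_union rho G1 G2 : rklt rho G1 -> rklt rho G2 -> rklt rho (fun F => G1 F \/ G2 F).
Proof.
move=> [e1 [h1 r1]] [e2 [h2 r2]]; case: (ole_or_lt e1 e2) => [|/olt_ole] h.
- by exists e2; split=> //; apply: rk_union => //; exact: rk_le h.
- by exists e1; split=> //; apply: rk_union => //; exact: rk_le h.
Qed.

Lemma rklt_bigcup (T : eqType) rho (s : seq T) (G : T -> fam) : olt OZ rho ->
  (forall x, x \in s -> rklt rho (G x)) -> rklt rho (fun F => exists2 x, x \in s & G x F).
Proof.
move=> rho0; elim: s => [|x s IH] H.
  by exists OZ; split=> //; apply: rk_empty => k F [].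
have [e [h1 h2]] : rklt rho (fun F => G x F \/ exists2 y, y \in s & G y F).
  apply: rklt_union; first exact: H (mem_head _ _).
  by apply: IH => y ys; apply: H; rewrite inE ys orbT.
exists e; split=> //; apply: rk_mono h2 _ _ => // F [y]; rewrite inE => /predU1P[->|ys] HG; [by left|].
by right; exists y.
Qed.

Lemma rklt_prefix rho G F : rklt rho G -> rklt rho (fun R => G (F ++ R)).
Proof. by case=> e [h r]; exists e; split=> //; exact: rk_prefix. Qed.

(* A set of [CC N' M N] ends a block with a set of [N'] and goes on with a set of [comp M N]. *)
Definition CC (N' M N : fam) : fam := fun F => exists E R, [/\ F = E ++ R, N' E & comp M N R].

(** Induction on [m], then on [e'], the rank left in the current block. The next element either
    continues this block and lowers [e'], or opens a new one; then m falls to m', n' < n is left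
    inside the new block, and n m' + n' < n m. *)
Lemma rk_CC m n e' (M N N' : fam) : rk m M -> rk n N -> rk e' N' -> rk (oadd (omul n m) e') (CC N' M N).
Proof.
move=> + HN; elim/ord_ind: m M e' N' => m IHm M e' N' HM.
elim/ord_ind: e' N' => e' IHe N' HN'; apply: rk_intro => k [F0 HF0].
pose G1 : fam := CC (der k N') M N; pose G2 : fam := CC (der k N) (der k M) N.
have sub F : der k (CC N' M N) F -> ((exists E, N' (k :: E)) /\ G1 F) \/
    ((exists E, M (k :: E)) /\ (exists E, N (k :: E)) /\ G2 F).
  case=> -[|x E] [R [/= E1 HE [Es [E2 [HB [HNE HME]]]]]].
    right; case: Es E2 HB HNE HME => [|[|y E] Es]; first by move=> E2; rewrite E2 in E1.
      by move=> _ /blocks_cons[].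
    rewrite -{R}E1 => -[kE ->] /blocks_cons[h1 h2 h3 h4]; rewrite /= -kE => HNE HME.
    split; first by exists (map smin Es).
    split; first by exists E; apply: HNE; exact: mem_head.
    exists E, (flatten Es); split=> //; first by apply: HNE; exact: mem_head.
    by exists Es; do !split=> //; try (by case: h3); move=> D HD; apply: HNE; rewrite inE HD orbT.
  left; case: E1 => kx ->; split; first by exists E; rewrite kx.
  by exists E, R; split=> //; [rewrite /der kx|exists Es].
have P1 : (exists E, N' (k :: E)) -> rklt (oadd (omul n m) e') G1.
  move=> H; have [e'' [h r]] := rk_inv HN' H.
  by exists (oadd (omul n m) e''); split; [exact: oadd_lt_r|exact: IHe].
have P2 : (exists E, M (k :: E)) /\ (exists E, N (k :: E)) -> rklt (oadd (omul n m) e') G2.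
  case=> H1 H2; have [m' [h r]] := rk_inv HM H1; have [n' [h' r']] := rk_inv HN H2.
  exists (oadd (omul n m') n'); split; last exact: IHm.
  apply: olt_ole_trans (oadd_lt_r (omul n m') h') _; apply: ole_trans (oadd_ge_l _ e').
  exact: (@omul_mono_r n (OS m') m h).
case: (classic (exists E, N' (k :: E))) => [/P1 R1|H1];
  case: (classic ((exists E, M (k :: E)) /\ exists E, N (k :: E))) => [/P2 R2|H2].
- by apply: (rklt_mono (rklt_union R1 R2)) => // F /sub[[]|[? []]]; [left|right].
- by apply: (rklt_mono R1) => // F /sub[[]//|[? [? _]]]; case: H2.
- by apply: (rklt_mono R2) => // F /sub[[/H1]|[? []]].
- by case: (sub _ HF0) => [[]//|[? [? _]]]; case: H2.
Qed.

Lemma rk_comp m n M N : rk m M -> rk n N -> rk (omul n m) (comp M N).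
Proof.
move=> HM HN; have H0 : rk OZ (fun E => E = [::]) by exact: rk_empty.
by apply: rk_mono (rk_CC HM HN H0) _ _ => // F HF; exists [::], F.
Qed.

Lemma rk_size n : rk (fin n) (fun F => size F <= n).
Proof.
elim: n => [|n IH]; first by apply: rk_empty.
by apply: rk_intro => k _; exists (fin n); split=> //; exact: ole_refl.
Qed.

Lemma rk_S1 : rk omega S1.
Proof.
apply: rk_intro => k _; exists (fin k); split; first exact: fin_olt_omega.
by apply: rk_mono (rk_size k) _ _ => // F [_] /=; lia.
Qed.

(** At a limit the first element [k] restricts the index to 1, ..., k, and a finite union of
    families of rank below w^b stays below w^b. *)
Lemma rk_Sch zeta (Hz : fund_seqs zeta) b : rk (wexp b) (Sch zeta b).
Proof.
elim/ord_ind: b => b IH; case: (zero_succ_limit b) => [b0|[[g Eg]|Lb]].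
- apply: rk_mono (rk_size 1) _ _; first exact: (wexp_mono (_ : ole OZ b)).
  by move=> F; exact: Sch_zero_inv.
- have gb : olt g b by exact: (olt_ole_trans (ole_refl (OS g)) (proj2 Eg)).
  apply: rk_mono (rk_comp rk_S1 (IH g gb)) _ _; first exact: (wexp_mono (proj2 Eg)).
  by move=> F; exact: Sch_succ_inv.
- have [h Hh] := choice_on (P := fun _ : nat => True) (Q := fun n h => hat zeta b n h) OZ (fun n _ => hat_exists zeta n Lb).
  apply: rk_intro => k _.
  have [|n|e [h1 h2]] := @rklt_bigcup _ (wexp b) (iota 1 k) (fun n F => Sch zeta (h n) (k :: F)).
  + exact: wexp_pos.
  + rewrite mem_iota => /andP[n1 _]; have hb := hat_lt Hz n1 (Hh n I).
    exists (wexp (h n)); split; first exact: wexp_lt.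
    by apply: (@rk_der _ k); exact: IH.
  + exists e; split=> //; apply: rk_mono h2 _ _ => // F /(Sch_limit_inv Lb)[//|[n [h' [/andP[n1 nk] [Hh' HF]]]]].
    exists n; first by rewrite mem_iota n1 /= add1n ltnS.
    apply: Sch_oeq HF; exact (hat_uniq Hz Hh' (Hh n I)).
Qed.

(** * Regular families and the Cantor-Bendixson index *)

Definition spread_closed (X : fam) := forall s t, X s -> fs t -> size t = size s -> dom t s -> X t.

Lemma dom_cat_same s t v : size t = size s -> dom t s -> dom (t ++ v) (s ++ v).
Proof.
elim: s t => [|x s IH] [|y t] //=; first by rewrite dom_refl.
by case=> /IH H /andP[-> /H].
Qed.

Lemma sorted_low_high p (F : seq nat) : sorted ltn F ->
  F = filter (fun x => x <= p) F ++ filter (fun x => p < x) F.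
Proof.
elim: F => [//|x F IH] /= H.
have /IH E := path_sorted H; have /allP Hx := order_path_min ltn_trans H.
case: (leqP x p) => xp /=; first by rewrite -E.
have lt y : y \in F -> p < y by move=> /Hx; exact: ltn_trans.
rewrite (eq_in_filter (a2 := pred0)) ?filter_pred0 /=; last by move=> y /lt; rewrite ltnNge => /negbTE.
by rewrite (eq_in_filter (a2 := predT)) ?filter_predT.
Qed.

(** An approximation of [s] that agrees with it far enough has the form s ++ v with [v] beyond both
    [s] and [t]; then t ++ v approximates [t]. *)
Lemma deriv_spread X : (forall s, X s -> fs s) -> spread_closed X -> spread_closed (deriv X).
Proof.
move=> Xfs HX s t [Xs Ds] fst st D; split; first exact: HX Xs fst st D.
move=> n; pose n' := maxn n (maxn (smax s) (smax t)).
have [u [Xu [us Hu]]] := Ds n'.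
have Es : filter (fun x => x <= n') u = s.
  apply: (irr_sorted_eq ltn_trans ltnn).
  - by apply: (sorted_filter ltn_trans); case: (Xfs _ Xu).
  - by case: (Xfs _ Xs).
  - move=> x; rewrite mem_filter; case: (leqP x n') => xn /=; first exact: Hu.
    by apply/esym/negP => /(fs_smax (Xfs _ Xs)); rewrite /n' in xn; lia.
have Eu : u = s ++ filter (fun x => n' < x) u.
  by rewrite -[X in X ++ _]Es; apply: sorted_low_high; case: (Xfs _ Xu).
set v := filter (fun x => n' < x) u in Eu.
have Hv x : x \in v -> n' < x by rewrite mem_filter => /andP[].
have fsv : fs v by apply: fs_subseq (Xfs _ Xu) (filter_subseq _ _).
exists (t ++ v); split; last split.
- apply: (HX u) => //.
  + apply/fs_cat; split=> // x y /(fs_smax fst) h /Hv; rewrite /n'; lia.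
  + by rewrite Eu !size_cat st.
  + by rewrite Eu; exact: dom_cat_same.
- move=> E; apply: us; have /(congr1 size) := E; rewrite size_cat => h.
  have v0 : size v = 0 by lia.
  by rewrite Eu; case: (v) v0 => //; rewrite cats0.
- move=> k kn; rewrite mem_cat; case: (boolP (k \in v)) => [/Hv|_]; last by rewrite orbF.
  by rewrite /n'; lia.
Qed.

Lemma iter_deriv_sub X b s : iter_deriv X b s -> X s.
Proof. by elim: b s => [//|b IH|f IH] s /=; [case=> /IH|move=> /(_ 0)/IH]. Qed.

Lemma iter_deriv_spread X b : (forall s, X s -> fs s) -> spread_closed X -> spread_closed (iter_deriv X b).
Proof.
move=> Xfs HX; elim: b => [//|b IH|f IH] /=.
- by apply: deriv_spread => // s /iter_deriv_sub/Xfs.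
- by move=> s t H h1 h2 h3 n; exact: IH (H n) h1 h2 h3.
Qed.

Lemma fs_rcons s k : fs s -> smax s < k -> fs (rcons s k).
Proof.
move=> h1 h2; rewrite -cats1; apply/fs_cat; split=> //; first by apply: fs_seq1; lia.
by move=> x y /(fs_smax h1) h3; rewrite inE => /eqP->; lia.
Qed.

Lemma dom_rcons s k k' : k <= k' -> dom (rcons s k') (rcons s k).
Proof. by move=> h; elim: s => [|x s IH] /=; rewrite ?h // leqnn. Qed.

(** If s with one further element [k] lay in the derivative of order [b], spreading would put s with
    any large k' there. These sets converge to [s], which would survive one more derivation. *)
Lemma rk_not_deriv (F0 : fam) (Hreg : regular F0) b s : ~ iter_deriv F0 b s -> rk b (fun R => F0 (s ++ R)).
Proof.
have Ffs := proj1 Hreg; have Fp := regular_pclosed Hreg.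
have sprd b' : spread_closed (iter_deriv F0 b').
  by apply: iter_deriv_spread => // u t h1 h2 _; exact: Fp h1 h2.
elim: b s => [|b IH|f IH] s /= H.
- apply: rk_empty => k F HF; apply: H; apply: (Fp _ _ HF).
    exact: fs_subseq (Ffs _ HF) (prefix_subseq _ _).
  by apply: subseq_dom (Ffs _ HF) (prefix_subseq _ _).
- case: (classic (iter_deriv F0 b s)) => [Hs|/IH Hr]; last by apply: rk_le Hr (oleS _).
  have [n Hn] : exists n, ~ exists t, iter_deriv F0 b t /\ t <> s /\ forall k, k <= n -> (k \in t) = (k \in s).
    by apply: not_all_ex_not => HA; apply: H; split.
  apply: rk_intro => k [F HF]; exists b; split; first exact: ole_refl.
  apply: (@rk_mono b _ (fun R => F0 (rcons s k ++ R))) => //; last by move=> R; rewrite cat_rcons.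
  apply: IH => Hk; apply: Hn; pose k' := (maxn n (maxn k (smax s))).+1.
  have fss : fs s := Ffs _ (iter_deriv_sub Hs).
  exists (rcons s k'); split; last split.
  + apply: (sprd b _ _ Hk); first by apply: fs_rcons => //; rewrite /k'; lia.
      by rewrite !size_rcons.
    by apply: dom_rcons; rewrite /k'; lia.
  + by move/(congr1 size); rewrite size_rcons; lia.
  + by move=> x xn; rewrite mem_rcons inE; case: eqP => // xk; rewrite /k' in xk; lia.
- have [n Hn] := not_all_ex_not _ _ H.
  by apply: rk_le (IH n s Hn) _; exact: (ole_sup (g := f)).
Qed.

Lemma rk_regular (F0 : fam) a0 : regular F0 -> cb_index F0 a0 -> rk (OS a0) F0.
Proof.
move=> Hreg Hcb; apply: rk_intro => k _; exists a0; split; first exact: ole_refl.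
by apply: (@rk_not_deriv F0 Hreg a0 [:: k]) => /Hcb.
Qed.

(** A lower bound for the rank above [H], in the form of a strategy: for each smaller ordinal there
    is a next element beyond any prescribed [p]. This freedom lets the construction move past
    supports already used. *)
Inductive lr (G : fam) : Ord -> seq nat -> Prop :=
| lr_intro e H : G H -> (forall e' p, olt e' e -> exists k, p < k /\ lr G e' (rcons H k)) -> lr G e H.

Lemma lr_in G e H : lr G e H -> G H. Proof. by case. Qed.

Lemma lr_inv G e H e' p : lr G e H -> olt e' e -> exists k, p < k /\ lr G e' (rcons H k).
Proof. by case=> e0 H0 _ IH; exact: IH. Qed.

Lemma lr_le G e e' H : lr G e H -> ole e' e -> lr G e' H.
Proof.
move=> h ee'; apply: lr_intro; first exact: lr_in h.
by move=> d p hd; apply: lr_inv h _; exact: olt_ole_trans hd ee'.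
Qed.

Lemma lr_transfer (G G' : fam) e H : (forall R, G (H ++ R) -> G' (H ++ R)) -> lr G e H -> lr G' e H.
Proof.
elim/ord_ind: e H => e IH H HG h; apply: lr_intro.
  by have := HG [::]; rewrite cats0; apply; exact: lr_in h.
move=> e' p he; have [k [pk hk]] := lr_inv p h he; exists k; split=> //.
by apply: IH => // R; rewrite cat_rcons; exact: HG.
Qed.

Lemma olt_mulS_split e a n : olt OZ a -> olt e (omul a (fin n.+1)) ->
  exists e1, olt e1 a /\ ole e (oadd (omul a (fin n)) e1).
Proof. by move=> a0 /olt_add_split[/olt_ole h|//]; exists OZ. Qed.

(** At a successor, w^g (n + 1) steps are obtained by filling n + 1 blocks one after another; a
    first element beyond [n] admits that many. At a limit, a first element beyond [n] makes the
    index [n] admissible. *)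
Lemma lr_Sch zeta (Hz : fund_seqs zeta) b : lr (Sch zeta b) (wexp b) [::].
Proof.
elim/ord_ind: b => b IH; apply: lr_intro; first exact: Sch_empty.
case: (zero_succ_limit b) => [b0|[[g Eg]|Lb]] e p He.
- exists p.+1; split=> //; apply: lr_intro; first exact: Sch_zero.
  move=> e'; have h : ole e OZ by exact: (olt_ole_trans He (wexp_mono (proj1 b0))).
  by move=> q /olt_ole_trans /(_ h).
- have gb : olt g b by exact: (olt_ole_trans (ole_refl (OS g)) (proj2 Eg)).
  (* Here [E] is the block being filled, with [e1] steps left in it, and [r] further blocks may
     still be opened. *)
  have key r e1 Es E : blocks_ok (rcons Es E) -> (forall D, D \in Es -> Sch zeta g D) ->
     lr (Sch zeta g) e1 E -> size Es + r < smin (flatten (rcons Es E)) ->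
     lr (Sch zeta b) (oadd (omul (wexp g) (fin r)) e1) (flatten (rcons Es E)).
    elim/ltn_ind: r e1 Es E => r IHr e1; elim/ord_ind: e1 => e1 IHe Es E HB HEs hE hsz.
    have HF : Sch zeta b (flatten (rcons Es E)).
      apply: (Sch_succE Eg); exists (rcons Es E); do 2 split=> //; split.
        by move=> D; rewrite mem_rcons inE => /predU1P[->|/HEs//]; exact: lr_in hE.
      by split; [exact: mins_fs|rewrite -smin_flatten // size_map size_rcons; lia].
    have [fsE noE] := proj1 (blocks_fs _) HB.
    have szk k : smin (rcons (flatten (rcons Es E)) k) = smin (flatten (rcons Es E)).
      by case: (flatten _) hsz.
    apply: lr_intro => // e' q /olt_add_split[|[e1' [h1 h2]]].
    - case: r IHr {IHe} hsz => [//|r] IHr hsz /(olt_mulS_split (wexp_pos g)) [e1' [h1 h2]].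
      have [k [qk hk]] := lr_inv (maxn q (smax (flatten (rcons Es E)))) (IH g gb) h1.
      have EE : flatten (rcons (rcons Es E) [:: k]) = rcons (flatten (rcons Es E)) k.
        by rewrite flatten_rcons cats1.
      exists k; split; first by lia.
      rewrite -EE; apply: lr_le h2; apply: IHr => //.
      + apply/blocks_fs; rewrite EE; split; first by apply: fs_rcons => //; lia.
        by rewrite mem_rcons inE.
      + by move=> D; rewrite mem_rcons inE => /predU1P[->|/HEs//]; exact: lr_in hE.
      + by rewrite EE szk size_rcons; lia.
    - have [k [qk hk]] := lr_inv (maxn q (smax (flatten (rcons Es E)))) hE h1.
      have EE : flatten (rcons Es (rcons E k)) = rcons (flatten (rcons Es E)) k.
        by rewrite !flatten_rcons -!cats1 catA.
      exists k; split; first by lia.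
      rewrite -EE; apply: lr_le h2; apply: IHe => //; last by rewrite EE szk.
      apply/blocks_fs; rewrite EE; split; first by apply: fs_rcons => //; lia.
      move: noE; rewrite !mem_rcons !inE !negb_or => /andP[_ ->]; rewrite andbT.
      by case: (E).
  case: (olt_ole_trans He (wexp_mono (proj1 Eg))) => -[//|n] /(olt_mulS_split (wexp_pos g)) [e1 [h1 h2]].
  have [k [pk hk]] := lr_inv (maxn p n) (IH g gb) h1.
  exists k; split; first by lia.
  apply: lr_le h2; apply: (key n e1 [::] [:: k]) => //.
  + apply/blocks_cons; split=> //; apply: fs_seq1; lia.
  + by rewrite /=; lia.
- have [n [h [n1 [Hh eh]]]] := hat_sup Hz Lb He.
  have [k [pk hk]] := lr_inv (maxn p n) (IH h (hat_lt Hz n1 Hh)) eh.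
  exists k; split; first by lia.
  apply: lr_transfer hk => R /=; apply: (Sch_hat Hh) => //=; lia.
Qed.

(** * Averages with small mass on families of small rank *)

Local Open Scope R_scope.

Lemma Rplus_assoc_mc : associative Rplus. Proof. by move=> x y z; rewrite Rplus_assoc. Qed.
HB.instance Definition _ := Monoid.isComLaw.Build R 0 Rplus Rplus_assoc_mc Rplus_comm Rplus_0_l.

Local Notation "\rsum_ ( i <- s ) F" := (\big[Rplus/0]_(i <- s) F)
  (at level 34, F at level 41, i, s at level 60, format "\rsum_ ( i  <-  s )  F").

Lemma rsum_le (T : Type) (s : seq T) (f g : T -> R) :
  List.Forall (fun x => f x <= g x) s -> \rsum_(x <- s) f x <= \rsum_(x <- s) g x.
Proof.
by elim=> [|x {}s h _ IH]; rewrite ?big_nil ?big_cons; lra.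
Qed.

Lemma rsum_eq (T : Type) (s : seq T) (f g : T -> R) :
  List.Forall (fun x => f x = g x) s -> \rsum_(x <- s) f x = \rsum_(x <- s) g x.
Proof. by elim=> [|x {}s h _ IH]; rewrite ?big_nil ?big_cons ?h ?IH. Qed.

Lemma Forall_all (T : Type) (P : T -> Prop) s : (forall x, P x) -> List.Forall P s.
Proof. by move=> H; apply/List.Forall_forall => x _. Qed.

Lemma Forall_In (T : Type) (P : T -> Prop) s x : List.Forall P s -> List.In x s -> P x.
Proof. by move/List.Forall_forall; apply. Qed.

Lemma Forall_mem (T : eqType) (P : T -> Prop) (s : seq T) : (forall x, x \in s -> P x) -> List.Forall P s.
Proof.
elim: s => [|x s IH] H; constructor; first exact: H (mem_head _ _).
by apply: IH => y ys; apply: H; rewrite inE ys orbT.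
Qed.

Lemma rsum_scal (T : Type) (s : seq T) c (f : T -> R) : \rsum_(x <- s) (c * f x) = c * \rsum_(x <- s) f x.
Proof. by elim: s => [|x s IH]; rewrite ?big_nil ?big_cons ?IH; lra. Qed.

Lemma rsum_ge0 (T : Type) (s : seq T) (f : T -> R) : List.Forall (fun x => 0 <= f x) s -> 0 <= \rsum_(x <- s) f x.
Proof. by elim=> [|x {}s h _ IH]; rewrite ?big_nil ?big_cons; lra. Qed.

Lemma finite_seqs (M n : nat) : exists L : seq (seq nat), forall s, all (fun x => (x < M)%N) s -> (size s <= n)%N -> s \in L.
Proof.
elim: n => [|n [L HL]]; first by exists [:: [::]] => -[].
exists ([::] :: [seq x :: s | x <- iota 0 M, s <- L]) => -[|x s] //= /andP[xM sM] sn.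
by rewrite inE allpairs_f ?orbT ?mem_iota ?HL.
Qed.

Lemma finite_subsets (p : nat) : exists L : seq (seq nat), forall s, sorted ltn s -> all (fun x => (x <= p)%N) s -> s \in L.
Proof.
have [L HL] := finite_seqs p.+1 p.+1; exists L => s Hs Ha; apply: HL => //.
rewrite -[X in (_ <= X)%N](size_iota 0 p.+1); apply: uniq_leq_size.
  exact: (sorted_uniq ltn_trans ltnn).
by move=> x /(allP Ha) xp; rewrite mem_iota.
Qed.

(** Members read only up to where the rank left over is still not bounded by [al]: the last [al] of
    the rank is cut off, which takes a rank al + e down to [e]. *)
Definition tr al (G : fam) : fam := fun F => ~ rk al (fun R => G (F ++ R)).

Lemma rk_tr al e G : rk (oadd al e) G -> rk e (tr al G).
Proof.
elim/ord_ind: e G => e IH G HG; apply: rk_intro => k [F HF].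
have big x : rk x (der k G) -> ole x al -> False.
  by move=> h1 h2; apply: HF; exact: (@rk_prefix al (der k G) F (rk_le h1 h2)).
have [|x [hx rx]] := rk_inv HG (k := k).
  apply: NNPP => H; apply: (big OZ) => //; apply: rk_empty => y F' H'.
  by apply: H; exists (y :: F').
case: (olt_add_split hx) => [/olt_ole /(big _ rx)//|[e' [h1 h2]]].
exists e'; split=> //; apply: (IH e' h1 (der k G)); exact: rk_le rx h2.
Qed.

Lemma archimed_pos d : 0 < d -> exists n : nat, (0 < n)%N /\ / INR n <= d.
Proof.
move=> d0; have [n [h1 h2]] := archimed_cor1 d d0.
by exists n; split; [lia|lra].
Qed.

(** * Averaging in an abstract game *)

Section Averages.
Variables (T St : Type) (lo hi : T -> nat) (top : St -> nat) (step : St -> T -> St -> Prop) (Rk : Ord -> St -> Prop).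

Definition hit (F : seq nat) (y : T) : bool := has (fun k => (lo y <= k <= hi y)%N) F.
Definition mass (ws : seq (R * T)) (F : seq nat) : R := \rsum_(p <- ws) (if hit F p.2 then p.1 else 0).
Definition wtotal (ws : seq (R * T)) : R := \rsum_(p <- ws) p.1.
Definition wnonneg (ws : seq (R * T)) := List.Forall (fun p => 0 <= p.1) ws.
Definition conv ws := wnonneg ws /\ wtotal ws = 1.
Definition scale c (ws : seq (R * T)) := [seq (c * p.1, p.2) | p <- ws].

Lemma mass_le_wtotal ws F : wnonneg ws -> mass ws F <= wtotal ws.
Proof. by elim=> [|p {}ws h _ IH]; rewrite /mass /wtotal ?big_nil ?big_cons; [lra|move: IH; rewrite /mass /wtotal; case: hit; lra]. Qed.

Lemma mass_cat ws ws' F : mass (ws ++ ws') F = mass ws F + mass ws' F.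
Proof. by rewrite /mass big_cat. Qed.

Lemma wtotal_cat ws ws' : wtotal (ws ++ ws') = wtotal ws + wtotal ws'.
Proof. by rewrite /wtotal big_cat. Qed.

Lemma mass_scale c ws F : mass (scale c ws) F = c * mass ws F.
Proof. by rewrite /mass /scale big_map -rsum_scal; apply: eq_bigr => p _ /=; case: hit; lra. Qed.

Lemma wtotal_scale c ws : wtotal (scale c ws) = c * wtotal ws.
Proof. by rewrite /wtotal /scale big_map -rsum_scal. Qed.

Lemma wnonneg_scale c ws : 0 <= c -> wnonneg ws -> wnonneg (scale c ws).
Proof. by move=> c0; elim=> [|p {}ws h _ IH]; constructor => //=; exact: Rmult_le_pos. Qed.

Lemma wnonneg_cat ws ws' : wnonneg ws -> wnonneg ws' -> wnonneg (ws ++ ws').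
Proof. by move=> h1 h2; apply/List.Forall_app. Qed.

Lemma mass_nil ws : mass ws [::] = 0.
Proof. by rewrite /mass big1. Qed.

Fixpoint chain (s : St) (ws : seq (R * T)) (s' : St) : Prop :=
  match ws with
  | [::] => s = s'
  | p :: ws' => exists s1, step s p.2 s1 /\ chain s1 ws' s'
  end.

Lemma chain_cat s ws s1 ws' s' : chain s ws s1 -> chain s1 ws' s' -> chain s (ws ++ ws') s'.
Proof.
elim: ws s => [|p ws IH] s /=; first by move=> ->.
by case=> s2 [h1 h2] h3; exists s2; split=> //; exact: IH.
Qed.

Lemma chain_scale c s ws s' : chain s ws s' -> chain s (scale c ws) s'.
Proof. by elim: ws s => [|p ws IH] s //= [s1 [h1 h2]]; exists s1; split=> //; exact: IH. Qed.

Hypothesis step_top : forall s y s', step s y s' -> (top s < lo y <= hi y)%N /\ (hi y <= top s')%N.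
Hypothesis Rk_le : forall e e' s, Rk e s -> ole e' e -> Rk e' s.
Hypothesis Rk_step : forall e e' s, Rk e s -> olt e' e -> exists y s', step s y s' /\ Rk e' s'.

Lemma chain_range s ws s' : chain s ws s' -> (top s <= top s')%N /\
  List.Forall (fun p => (top s < lo p.2 <= hi p.2)%N /\ (hi p.2 <= top s')%N) ws.
Proof.
elim: ws s => [|p ws IH] s /=; first by move=> ->.
case=> s1 [/step_top [h1 h2] /IH [h3 h4]]; split; first by lia.
constructor; first by lia.
by apply: List.Forall_impl h4 => q; lia.
Qed.

Lemma mass_ext p p' ws F F' :
  List.Forall (fun q => (p < lo q.2 <= hi q.2)%N /\ (hi q.2 <= p')%N) ws ->
  (forall k, (p < k <= p')%N -> (k \in F) = (k \in F')) -> mass ws F = mass ws F'.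
Proof.
move=> H HF; apply: rsum_eq; apply: List.Forall_impl H => q hq.
suff -> : hit F q.2 = hit F' q.2 by [].
by apply/hasP/hasP => -[k kF hk]; exists k => //; [rewrite -HF //|rewrite HF //]; lia.
Qed.

Definition averaged (G : fam) d t s := exists ws s', [/\ chain s ws s', Rk t s', conv ws &
  forall F, sorted ltn F -> G F -> mass ws F <= d].

Definition low p (F : seq nat) := filter (fun x => (x <= p)%N) F.
Definition high p (F : seq nat) := filter (fun x => (p < x)%N) F.

Lemma low_high p F : sorted ltn F -> F = low p F ++ high p F.
Proof. exact: sorted_low_high. Qed.

Lemma low_split p p' F : sorted ltn F -> (p <= p')%N -> low p' F = low p F ++ low p' (high p F).
Proof.
move=> hF pp'; rewrite {1}(low_high p hF) /low filter_cat -filter_predI; congr cat.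
by apply: eq_filter => x /=; lia.
Qed.

Lemma sorted_high p F : sorted ltn F -> sorted ltn (high p F).
Proof. exact: (sorted_filter ltn_trans). Qed.

Lemma sorted_low p F : sorted ltn F -> sorted ltn (low p F).
Proof. exact: (sorted_filter ltn_trans). Qed.

(* A sequence of averages, each of them small on the sets that have not yet used up all but [al] of
   the rank, and on the sets whose part up to now leaves a rank below [al]. *)
Fixpoint bchain al (G : fam) d (s : St) (Ws : seq (seq (R * T))) (s' : St) : Prop :=
  match Ws with
  | [::] => s = s'
  | W :: Ws' => exists s1, [/\ chain s W s1, conv W,
      forall F, sorted ltn F -> tr al G F -> mass W F <= d,
      forall F F', sorted ltn F -> all (fun x => (x <= top s)%N) F -> rklt al (fun R => G (F ++ R)) ->
        sorted ltn F' -> G (F ++ F') -> mass W F' <= d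
      & bchain al G d s1 Ws' s']
  end.

Lemma mass_le1 W F : conv W -> mass W F <= 1.
Proof. by case=> h <-; exact: mass_le_wtotal. Qed.

(* A set moves at most twice from one of the three cases to the next one. *)
Lemma bchain_mass al G d s Ws s' F : 0 <= d -> sorted ltn F -> G F -> bchain al G d s Ws s' ->
  let m := \rsum_(W <- Ws) mass W F in let after := fun R => G (low (top s) F ++ R) in
  [/\ rklt al after -> m <= INR (size Ws) * d,
      rk al after -> m <= INR (size Ws) * d + 1
    & m <= INR (size Ws) * d + 2].
Proof.
move=> d0 hF GF; elim: Ws s => [|W Ws IH] s /=; first by rewrite big_nil; split; lra.
case=> s1 [hc cW g1 g2 /IH {IH} [i0 i1 i2]].
have [tt1 rng] := chain_range hc.
rewrite big_cons -/(size Ws) -[match size Ws with 0%N => 1 | _ => _ end]/(INR (size Ws).+1) S_INR.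
have spl := low_split hF tt1.
have m1 := mass_le1 F cW.
have aft1 : (fun R => G (low (top s1) F ++ R)) =
            (fun R => G (low (top s) F ++ (low (top s1) (high (top s) F) ++ R))).
  by apply: functional_extensionality => R; rewrite spl catA.
split.
- move=> h; have mW : mass W F <= d.
    rewrite (mass_ext (F' := high (top s) F) rng); last first.
      by move=> k /andP[h1 _]; rewrite mem_filter h1.
    apply: (g2 (low (top s) F)) => //; [exact: sorted_low|exact: filter_all|exact: sorted_high|].
    by rewrite -low_high.
  suff : rklt al (fun R => G (low (top s1) F ++ R)) by move/i0; lra.
  by rewrite aft1; apply: (rklt_prefix (G := fun R => G (low (top s) F ++ R))).
(* Either the set has no point over this average, whose mass is then zero, or its first point there
   lowers the remaining rank strictly below [al]. *)
- move=> h; case E: (low (top s1) (high (top s) F)) => [|x X].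
    have -> : mass W F = 0.
      rewrite (mass_ext (F' := [::]) rng) ?mass_nil // => k /andP[h1 h2].
      rewrite in_nil; apply/negP => kF.
      by have : k \in low (top s1) (high (top s) F); [rewrite !mem_filter h1 h2|rewrite E].
    suff : rk al (fun R => G (low (top s1) F ++ R)) by move/i1; lra.
    by rewrite aft1 E.
  suff : rklt al (fun R => G (low (top s1) F ++ R)) by move/i0; lra.
  rewrite aft1 E; have [|e [h1 h2]] := rk_inv h (k := x).
    exists (X ++ high (top s1) (high (top s) F)).
    by rewrite -cat_cons -E -low_high -?low_high //; exact: sorted_high.
  exists e; split=> //; exact: (rk_prefix X h2).
- case: (classic (rk al (fun R => G (low (top s1) F ++ R)))) => [/i1|h]; first by lra.
  suff : mass W F <= d by lra.
  rewrite (mass_ext (F' := low (top s1) F) rng); first by apply: g1 => //; exact: sorted_low.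
  by move=> k /andP[_ h2]; rewrite mem_filter h2.
Qed.

Lemma bchain_chain al G d s Ws s' c : 0 <= c -> bchain al G d s Ws s' ->
  let ws := flatten (map (scale c) Ws) in
  [/\ chain s ws s', wnonneg ws, wtotal ws = INR (size Ws) * c
    & forall F, mass ws F = c * \rsum_(W <- Ws) mass W F].
Proof.
move=> c0; elim: Ws s => [|W Ws IH] s /=.
  by move=> ->; split=> //; [rewrite /wtotal big_nil /=; lra|move=> F; rewrite /mass !big_nil; lra].
case=> s1 [hc [nW tW] _ _ /IH [h1 h2 h3 h4]]; split.
- by apply: chain_cat h1; exact: chain_scale.
- by apply: wnonneg_cat => //; exact: wnonneg_scale.
- rewrite wtotal_cat h3 wtotal_scale tW -[match size Ws with 0%N => 1 | _ => _ end]/(INR (size Ws).+1) S_INR; lra.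
- by move=> F; rewrite mass_cat h4 mass_scale big_cons; lra.
Qed.

(** Induction on [a]. In the successor case [key] finds a multiple M of w^a depending on [r] and [d]
    but not on the family. This uniformity is essential, as the family to be controlled changes with
    the state reached. *)
Theorem averages a G d : rklt (wexp a) G -> 0 < d ->
  forall t s, Rk (oadd t (wexp a)) s -> averaged G d t s.
Proof.
elim: a G d => [|a IH|f IH] G d HG d0 t s Hs.
(* A family of rank below 1 has no nonempty member, so a single block suffices. *)
- have [y [s' [h1 h2]]] := Rk_step Hs (ole_refl (OS t)).
  exists [:: (1, y)], s'; split=> //; first by exists s'.
    by split; [constructor=> //=; lra|rewrite /wtotal big_seq1].
  case: HG => e [he hr] [|k F] _ HF; first by rewrite mass_nil; lra.
  have [|e' [h3 _]] := rk_inv hr (k := k); first by exists F.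
  by case: (olt_ole_trans h3 (he : ole e OZ)).
- have key r : forall d, 0 < d -> exists M, forall G, rklt (omul (wexp a) (fin r.+1)) G ->
      forall t s, Rk (oadd t (omul (wexp a) (fin M))) s -> averaged G d t s.
    elim: r => [|r IHr] {}d {}d0.
      exists 1%N => G1 HG1 t1 s1; rewrite omulo1 in HG1 *; exact: IH.
    have [M0 HM0] := IHr (d / 2) ltac:(lra).
    (* With each average at most d/2 on its families, the two exceptional ones among [Nb] cost at
       most 2 / Nb <= d / 2. *)
    have [Nb [Nb0 HNb]] := archimed_pos (d := d / 4) ltac:(lra).
    exists (M0 * Nb)%N => {HG Hs t s}G [x [hx rx]] t s Hs.
    set al := wexp a in hx *.
    (* Splitting off one w^a on the left leaves [tr al G] with rank below w^a (r+1), where the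
       induction hypothesis on [r] applies. *)
    have {hx} [e [he hxe]] : exists e, olt e (omul al (fin r.+1)) /\ ole x (oadd al e).
      have E : omul al (fin r.+2) = oadd al (omul al (fin r.+1)).
        by rewrite -{2}(omulo1 al) (omul_finD al 1).
      move: hx; rewrite E => /olt_add_split[/olt_ole h|//].
      by exists OZ; split=> //; apply: ole_olt_trans (omul_lt_r (wexp_pos a) (fin_olt (ltn0Sn r))).
    have {x rx hxe} rG := rk_le rx hxe.
    have al1 : ole al (omul al (fin r.+1)).
      by rewrite -{1}(omulo1 al); apply: omul_mono_r; apply: (@fin_ole 1).
    have bex j : forall t s, Rk (oadd t (omul al (fin (M0 * j)))) s ->
        exists Ws s', [/\ size Ws = j, bchain al G (d / 2) s Ws s' & Rk t s'].
      elim: j => [|j IHj] {Hs}t {}s; first by rewrite muln0 => h; exists [::], s.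
      rewrite mulnS addnC -omul_finD -oaddA => h.
      have [L HL] := finite_subsets (top s).
      pose D : fam := fun F' => exists2 F, F \in L & rklt al (fun R => G (F ++ R)) /\ G (F ++ F').
      have HD : rklt (omul al (fin r.+1)) (fun F => tr al G F \/ D F).
        apply: rklt_union; first by exists e; split=> //; exact: rk_tr.
        apply: (@rklt_mono al _ D) => //; apply: rklt_bigcup; first exact: wexp_pos.
        move=> F _; case: (classic (rklt al (fun R => G (F ++ R)))) => hF.
          by apply: rklt_mono hF _ _ => // F' [].
        by exists OZ; split; [exact: wexp_pos|apply: rk_empty => k F' [/hF]].
      have [W [s1 [c1 c2 c3 c4]]] := HM0 _ HD _ _ h.
      have [Ws [s' [e1 e2 e3]]] := IHj _ _ c2.
      exists (W :: Ws), s'; split=> //=; first by rewrite e1.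
      exists s1; split=> //; first by move=> F hF hT; apply: c4 => //; left.
      move=> F F' hF h1 h2 hF' h3; apply: c4 => //; right; exists F => //; exact: HL.
    have [Ws [s' [e1 e2 e3]]] := bex _ _ _ Hs.
    have Nb1 : 0 < INR Nb by apply: lt_0_INR; lia.
    have [f1 f2 f3 f4] := bchain_chain (Rlt_le _ _ (Rinv_0_lt_compat _ Nb1)) e2.
    exists (flatten (map (scale (/ INR Nb)) Ws)), s'; split=> //.
      by split=> //; rewrite f3 e1; field; lra.
    move=> F hF hG; rewrite f4.
    have [_ _] := bchain_mass (ltac:(lra) : 0 <= d / 2) hF hG e2; rewrite e1 => hm.
    apply: (Rle_trans _ (/ INR Nb * (INR Nb * (d / 2) + 2))).
      by apply: Rmult_le_compat_l => //; apply: Rlt_le; exact: Rinv_0_lt_compat.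
    by rewrite Rmult_plus_distr_l -Rmult_assoc Rinv_l; lra.
  have [n Hn] : exists n, rklt (omul (wexp a) (fin n.+1)) G.
    case: HG => e [[n hn] hr]; exists n, e; split=> //; apply: olt_ole_trans hn _.
    apply: omul_mono_r; exact: fin_ole.
  have [M HM] := key n d d0; apply: HM Hn _ _ _; apply: Rk_le Hs _; apply: oadd_mono_r.
  exact: (@ole_sup _ (fun n => omul (wexp a) (fin n)) M).
- case: HG => e [[n hn] hr]; apply: (IH n) => //; first by exists e.
  apply: Rk_le Hs _; apply: oadd_mono_r; exact: (@ole_sup _ (fun n => wexp (f n)) n).
Qed.

End Averages.

(** * The implicitly defined norm *)

Definition vadd (x y : vec) : vec := fun k => x k + y k.
Definition vscal (a : R) (x : vec) : vec := fun k => a * x k.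
Definition unit_vec (j : nat) : vec := fun k => if k == j then 1 else 0.
Definition blk : Type := vec * (nat * nat).
Definition blo (y : blk) := y.2.1.
Definition bhi (y : blk) := y.2.2.
Definition wsum (ws : seq (R * blk)) : vec := fun k => \rsum_(p <- ws) (p.1 * p.2.1 k).

Lemma c00_zero : c00 vzero. Proof. by exists 0%N. Qed.

Lemma c00_add x y : c00 x -> c00 y -> c00 (vadd x y).
Proof. by move=> [M hM] [M' hM']; exists (maxn M M') => k hk; rewrite /vadd hM ?hM'; [lra|lia|lia]. Qed.

Lemma c00_scal a x : c00 x -> c00 (vscal a x).
Proof. by move=> [M hM]; exists M => k hk; rewrite /vscal hM //; lra. Qed.

Lemma c00_restr E x : c00 x -> c00 (restr E x).
Proof. by move=> [M hM]; exists M => k hk; rewrite /restr hM //; case: ifP. Qed.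

Lemma c00_unit j : (0 < j)%N -> c00 (unit_vec j).
Proof. by move=> j0; exists j => k hk; rewrite /unit_vec; case: eqP => // kj; lia. Qed.

Lemma vadd0v x : vadd vzero x = x.
Proof. by apply: functional_extensionality => k; exact: Rplus_0_l. Qed.

Lemma vaddv0 x : vadd x vzero = x.
Proof. by apply: functional_extensionality => k; exact: Rplus_0_r. Qed.

Lemma wsum_nil : wsum [::] = vzero.
Proof. by apply: functional_extensionality => k; rewrite /wsum big_nil. Qed.

Lemma wsum_cons p ws : wsum (p :: ws) = vadd (vscal p.1 p.2.1) (wsum ws).
Proof. by apply: functional_extensionality => k; rewrite /wsum big_cons. Qed.

Lemma wsum_filter (P : pred (R * blk)) ws :
  wsum ws = vadd (wsum (filter P ws)) (wsum (filter (predC P) ws)).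
Proof.
apply: functional_extensionality => k; rewrite /wsum /vadd !big_filter.
by rewrite (bigID P) /=.
Qed.

Lemma c00_wsum ws : List.Forall (fun p => c00 p.2.1) ws -> c00 (wsum ws).
Proof.
elim=> [|p {}ws h _ IH]; first by rewrite wsum_nil; exact: c00_zero.
by rewrite wsum_cons; apply: c00_add => //; exact: c00_scal.
Qed.

Lemma restr_add E x y : restr E (vadd x y) = vadd (restr E x) (restr E y).
Proof. by apply: functional_extensionality => k; rewrite /restr /vadd; case: ifP => _ //; lra. Qed.

Lemma restr_scal E a x : restr E (vscal a x) = vscal a (restr E x).
Proof. by apply: functional_extensionality => k; rewrite /restr /vscal; case: ifP => _ //; lra. Qed.

Lemma restr_restr E E' x : restr E (restr E' x) = restr (filter (mem E') E) x.
Proof.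
apply: functional_extensionality => k; rewrite /restr mem_filter inE /=.
by case: (k \in E); case: (k \in E').
Qed.

Lemma restrC E E' x : restr E (restr E' x) = restr E' (restr E x).
Proof. by apply: functional_extensionality => k; rewrite /restr; case: ifP; case: ifP. Qed.

Lemma restr_sub E E' x : {subset E <= E'} -> restr E (restr E' x) = restr E x.
Proof. by move=> H; apply: functional_extensionality => k; rewrite /restr; case: ifP => // /H ->. Qed.

Lemma restr_id E x : (forall k, k \notin E -> x k = 0) -> restr E x = x.
Proof.
by move=> H; apply: functional_extensionality => k; rewrite /restr; case: ifP => // /negbT/H.
Qed.

Lemma restr0 E x : (forall k, k \in E -> x k = 0) -> restr E x = vzero.
Proof. by move=> H; apply: functional_extensionality => k; rewrite /restr; case: ifP => // /H. Qed.

Lemma sumabsE F x : sumabs F x = \rsum_(k <- F) Rabs (x k).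
Proof. by elim: F => [|k F IH]; rewrite ?big_nil ?big_cons //= IH. Qed.

Lemma sumabs_restr F E x : sumabs F (restr E x) = sumabs (filter (mem E) F) x.
Proof.
rewrite !sumabsE big_filter [RHS]big_mkcond /=; apply: eq_bigr => k _.
by rewrite /restr /=; case: ifP => // _; rewrite Rabs_R0.
Qed.

Lemma sumabs_ge0 F x : 0 <= sumabs F x.
Proof. by elim: F => [|k F IH] /=; [lra|have := Rabs_pos (x k); lra]. Qed.

Lemma foldr_rsum (T : Type) (f : T -> R) s : foldr (fun E acc => f E + acc) 0 s = \rsum_(E <- s) f E.
Proof. by elim: s => [|E s IH]; rewrite ?big_nil ?big_cons //= IH. Qed.

Lemma blocks_uniq Es : blocks_ok Es -> uniq Es.
Proof.
move=> /mins_fs [h _]; apply: (@map_uniq _ _ smin).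
exact: (sorted_uniq ltn_trans ltnn).
Qed.

Lemma blocks_disj Es E E' k : blocks_ok Es -> E \in Es -> E' \in Es -> k \in E -> k \in E' -> E = E'.
Proof.
elim: Es => [//|D Es IH] /blocks_cons[h1 h2 h3 h4].
rewrite !inE => /predU1P[->|hE] /predU1P[->|hE'] // kE kE'.
- by have := setlt_lt h1 (blocks_in_fs h3 hE') (h4 _ hE') kE kE'; rewrite ltnn.
- by have := setlt_lt h1 (blocks_in_fs h3 hE) (h4 _ hE) kE' kE; rewrite ltnn.
- exact: IH.
Qed.

Lemma rsum_single (T : eqType) (s : seq T) (f : T -> R) D : uniq s -> D \in s ->
  (forall E, E \in s -> E != D -> f E = 0) -> \rsum_(E <- s) f E = f D.
Proof.
move=> U HD H; rewrite (bigD1_seq D) //= big_seq_cond big1 ?Rplus_0_r // => E /andP[h1 h2].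
exact: H.
Qed.

Lemma rsum_flatten (T : Type) (f : T -> R) (s : seq (seq T)) :
  \rsum_(x <- flatten s) f x = \rsum_(t <- s) \rsum_(x <- t) f x.
Proof. by elim: s => [|t s IH]; rewrite ?big_nil ?big_cons //= big_cat IH. Qed.

Section Norm.
Variables (zeta : Ord -> nat -> Ord) (F0 : fam) (beta : nat -> Ord) (theta : nat -> R) (N : vec -> R).
Hypotheses (HF0 : regular F0) (HS0 : contains_S0 F0).
Hypothesis Hth : forall n, 0 < theta n < 1.
Hypothesis Hthdec : forall n, theta n.+1 <= theta n.
Hypothesis HN : is_T_norm zeta F0 theta beta N.

Lemma theta_mono m n : (m <= n)%N -> theta n <= theta m.
Proof.
move=> /subnKC <-; elim: (n - m)%N => [|j IH]; first by rewrite addn0; lra.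
by rewrite addnS; have := Hthdec (m + j); lra.
Qed.

Lemma N_lub x : c00 x -> is_lub (norming_set zeta F0 theta beta N x) (N x).
Proof. by case: HN => H _; exact: H. Qed.

Lemma N_ge0 x : c00 x -> 0 <= N x.
Proof. by case: HN => _ [H _]; exact: H. Qed.

Lemma N_scal a x : c00 x -> N (vscal a x) = Rabs a * N x.
Proof. by case: HN => _ [_ [_ [H _]]]; exact: H. Qed.

Lemma N_add x y : c00 x -> c00 y -> N (vadd x y) <= N x + N y.
Proof. by case: HN => _ [_ [_ [_ H]]]; exact: H. Qed.

Lemma rsum_N_ge0 Es x : c00 x -> 0 <= \rsum_(E <- Es) N (restr E x).
Proof. by move=> hx; apply: rsum_ge0; apply: Forall_all => E; apply: N_ge0; exact: c00_restr. Qed.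

Lemma N_zero : N vzero = 0.
Proof.
have -> : vzero = vscal 0 vzero by apply: functional_extensionality => k; rewrite /vscal Rmult_0_l.
by rewrite N_scal ?Rabs_R0 ?Rmult_0_l //; exact: c00_zero.
Qed.

Lemma N_F0 x F : c00 x -> F0 F -> sumabs F x <= N x.
Proof. by move=> /N_lub [H _] HF; apply: H; left; exists F. Qed.

Lemma N_adm x n Es : c00 x -> blocks_ok Es -> Sch zeta (beta n) (map smin Es) ->
  theta n * \rsum_(E <- Es) N (restr E x) <= N x.
Proof.
move=> /N_lub [H _] HB HE; apply: H; right; exists n, Es; split=> //.
by rewrite foldr_rsum.
Qed.

Lemma N_le x B : c00 x -> (forall F, F0 F -> sumabs F x <= B) ->
  (forall n Es, blocks_ok Es -> Sch zeta (beta n) (map smin Es) ->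
     theta n * \rsum_(E <- Es) N (restr E x) <= B) -> N x <= B.
Proof.
move=> /N_lub [_ H] h1 h2; apply: H => v [[F [HF ->]]|[n [Es [[HB HE] ->]]]]; first exact: h1.
by rewrite foldr_rsum; exact: h2.
Qed.

Lemma N_coord x k : c00 x -> (0 < k)%N -> Rabs (x k) <= N x.
Proof.
by move=> hx k0; have := N_F0 hx (proj2 HS0 _ k0); rewrite /= Rplus_0_r.
Qed.

(** Deduced from the implicit equation by induction on a set carrying the support. An admissible
    family with one set containing that support returns N (restr E x) times a factor at most
    [theta 0], less than 1, hence cannot dominate; for any other family each piece lives on a
    smaller set. *)
Lemma N_restr E x : c00 x -> N (restr E x) <= N x.
Proof.
move=> hx; have [S HS] : exists S : seq nat, forall k, k \notin S -> x k = 0.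
  case: hx => M hM; exists (iota 1 M) => k; rewrite mem_iota => h; apply: hM; lia.
elim: {S}(size S) {-2}S (leqnn (size S)) x hx HS => [|n IH] S hn x hx HS.
  have x0 : x = vzero.
    by apply: functional_extensionality => k; apply: HS; case: (S) hn.
  by rewrite x0 restr0 //; lra.
have hEx := c00_restr E hx.
have hBnd : N (restr E x) <= Rmax (N x) (theta 0%N * N (restr E x)).
  apply: N_le => // [F HF|m Es HB HEs].
    apply: Rle_trans (Rmax_l _ _); apply: Rle_trans (N_F0 hx HF).
    rewrite !sumabsE; apply: rsum_le; apply: Forall_all => k.
    by rewrite /restr; case: ifP => _; [lra|rewrite Rabs_R0; exact: Rabs_pos].
  case: (classic (exists D, D \in Es /\ {subset S <= D})) => [[D [DE SD]]|HD].
    apply: Rle_trans (Rmax_r _ _).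
    have -> : \rsum_(D <- Es) N (restr D (restr E x)) = N (restr E x).
      rewrite (rsum_single (D := D)) //; [|exact: blocks_uniq|].
        rewrite restrC (@restr_id D) // => k kD; apply: HS; apply: contra kD; exact: SD.
      move=> D' D'E DD'; rewrite restrC (@restr0 D' x) ?restr0 ?N_zero // => k kD'.
      apply: HS; apply/negP => /SD kD.
      by move: DD'; rewrite (blocks_disj HB D'E DE kD' kD) eqxx.
    apply: Rmult_le_compat_r; first exact: N_ge0.
    exact: (theta_mono (leq0n m)).
  apply: Rle_trans (Rmax_l _ _); apply: Rle_trans (N_adm hx HB HEs).
  apply: Rmult_le_compat_l; first by have := Hth m; lra.
  apply: rsum_le; apply: Forall_mem => D DE; rewrite restrC.
  pose S' := filter (mem D) S.
  have szS : (size S' <= n)%N.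
    rewrite -ltnS; apply: leq_trans hn; rewrite /S' size_filter ltnNge.
    apply/negP => h; apply: HD; exists D; split=> // k kS.
    have /allP : all (mem D) S by rewrite all_count eqn_leq count_size h.
    by move=> /(_ _ kS).
  apply: (IH S') => //; first exact: c00_restr.
  move=> k; rewrite mem_filter inE negb_and /restr => /orP[/negbTE->//|/HS->].
  by case: ifP.
case: (Rle_dec (N (restr E x)) (N x)) => // h; move: hBnd.
have h0 := N_ge0 hx; have [t0 t1] := Hth 0%N.
rewrite /Rmax; case: Rle_dec => _ h2 //; nra.
Qed.

(** The same contraction: an admissible family sees the vector in at most one of its sets, so it
    yields at most [theta 0] times the norm. *)
Lemma N_unit k : (0 < k)%N -> N (unit_vec k) = 1.
Proof.
move=> k0; have hx := c00_unit k0; apply: Rle_antisym; last first.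
  by have := N_coord hx k0; rewrite /unit_vec eqxx Rabs_R1.
have hBnd : N (unit_vec k) <= Rmax 1 (theta 0%N * N (unit_vec k)).
  apply: N_le => // [F HF|m Es HB HEs].
    apply: Rle_trans (Rmax_l _ _); rewrite sumabsE.
    case: (boolP (k \in F)) => kF.
      rewrite (rsum_single (D := k)) //; first by rewrite /unit_vec eqxx Rabs_R1; lra.
        by have [h _] := proj1 HF0 _ HF; exact: (sorted_uniq ltn_trans ltnn).
      by move=> j _ /negbTE jk; rewrite /unit_vec jk Rabs_R0.
    rewrite big_seq_cond big1; first by lra.
    by move=> j; rewrite andbT /unit_vec; case: eqP => [->|]; rewrite ?(negbTE kF) ?Rabs_R0.
  apply: Rle_trans (Rmax_r _ _).
  have h0 := N_ge0 hx.
  apply: (Rle_trans _ (theta m * N (unit_vec k))); last first.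
    by apply: Rmult_le_compat_r => //; exact: (theta_mono (leq0n m)).
  apply: Rmult_le_compat_l; first by have := Hth m; lra.
  have z D : k \notin D -> N (restr D (unit_vec k)) = 0.
    move=> kD; rewrite restr0 ?N_zero // => j; rewrite /unit_vec; case: eqP => // ->.
    by rewrite (negbTE kD).
  case: (classic (exists D, D \in Es /\ k \in D)) => [[D [DE kD]]|HD].
    rewrite (rsum_single (D := D)) //; [exact: N_restr|exact: blocks_uniq|].
    move=> D' D'E DD'; apply: z; apply/negP => kD'.
    by move: DD'; rewrite (blocks_disj HB D'E DE kD' kD) eqxx.
  rewrite big_seq_cond big1 // => D; rewrite andbT => DE; apply: z; apply/negP => kD.
  by apply: HD; exists D.
have [t0 t1] := Hth 0%N; move: hBnd.
rewrite /Rmax; case: Rle_dec => h1 h2; nra.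
Qed.

Lemma N_l1 (S : seq nat) x : all (fun k => (0 < k)%N) S -> c00 x ->
  N (restr S x) <= \rsum_(k <- S) Rabs (x k).
Proof.
move=> hS hx; elim: S hS => [|k S IH] /=; first by rewrite big_nil restr0 // N_zero; lra.
case/andP=> k0 /IH {}IH; rewrite big_cons.
case: (boolP (k \in S)) => kS.
  have -> : restr (k :: S) x = restr S x.
    by apply: functional_extensionality => j; rewrite /restr inE; case: eqP => // ->; rewrite kS.
  by have := Rabs_pos (x k); lra.
have -> : restr (k :: S) x = vadd (vscal (x k) (unit_vec k)) (restr S x).
  apply: functional_extensionality => j; rewrite /restr /vadd /vscal /unit_vec inE.
  by case: eqP => [->|_] /=; rewrite ?(negbTE kS); lra.
apply: Rle_trans (N_add _ _) _; [exact/c00_scal/c00_unit|exact: c00_restr|].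
by rewrite N_scal ?N_unit //; [lra|exact: c00_unit].
Qed.

(** Minima of families obtained by nesting admissible families: the last index of [l] is the
    outermost one, and the empty list allows one set only. *)
Fixpoint SL (l : seq nat) : fam :=
  match l with
  | [::] => Sch zeta OZ
  | n :: l' => comp (SL l') (Sch zeta (beta n))
  end.

Lemma SL_pclosed l : pclosed (SL l).
Proof.
elim: l => [|n l IH] /=; first exact: Sch_pclosed.
by apply: comp_pclosed => //; exact: Sch_pclosed.
Qed.

Lemma thprod_pos l : 0 < thprod theta l.
Proof. by elim: l => [|n l IH] /=; [lra|have [h _] := Hth n; exact: Rmult_lt_0_compat]. Qed.

Lemma thprod_le1 l : thprod theta l <= 1.
Proof. by elim: l => [|n l IH] /=; [lra|have := Hth n; have := thprod_pos l; nra]. Qed.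

(** The defining inequality applied once per index, grouping the blocks into superblocks at each
    level. *)
Lemma N_SL l Es x : c00 x -> blocks_ok Es -> SL l (map smin Es) ->
  thprod theta l * \rsum_(E <- Es) N (restr E x) <= N x.
Proof.
move=> hx; elim: l Es => [|n l IH] Es HB /=.
  move=> /(Sch_zero_inv (oeq_refl _)); rewrite size_map; case: (Es) => [|E [|//]] _.
    by rewrite big_nil; have := N_ge0 hx; lra.
  by rewrite big_seq1; have := N_restr E hx; lra.
move=> HE; have [Ess [-> B1 B2 B3]] := comp_group HB HE.
apply: Rle_trans (IH _ B1 B2); rewrite rsum_flatten big_map Rmult_comm (Rmult_comm (theta n)) -Rmult_assoc Rmult_comm.
rewrite (Rmult_comm _ (thprod theta l)) -Rmult_assoc (Rmult_comm (theta n)) Rmult_assoc.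
apply: Rmult_le_compat_l; first exact: Rlt_le (thprod_pos l).
rewrite -rsum_scal; apply: rsum_le; apply: Forall_mem => G /B3 [BG SG].
apply: Rle_trans (N_adm (c00_restr (flatten G) hx) BG SG).
apply: Rmult_le_compat_l; first by have := Hth n; lra.
apply: rsum_le; apply: Forall_mem => E EG; rewrite restr_sub; first by lra.
by move=> k kE; apply/flattenP; exists E.
Qed.

(** * Weighted sums of blocks of norm at most one *)

Definition okblk (y : blk) := [/\ c00 y.1, N y.1 <= 1, forall k, y.1 k <> 0 -> (blo y <= k <= bhi y)%N
  & (0 < blo y <= bhi y)%N].
Definition okws (ws : seq (R * blk)) := List.Forall (fun p => 0 <= p.1 /\ okblk p.2) ws.

Lemma okws_filter (P : pred (R * blk)) ws : okws ws -> okws (filter P ws).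
Proof. by elim=> [|p {}ws h _ IH] /=; [constructor|case: ifP => // _; constructor]. Qed.

Lemma okws_c00 ws : okws ws -> c00 (wsum ws).
Proof. by move=> h; apply: c00_wsum; apply: List.Forall_impl h => p [_ []]. Qed.

Lemma rsum_filter_le (P : pred (R * blk)) ws (f : R * blk -> R) : List.Forall (fun p => 0 <= f p) ws ->
  \rsum_(p <- filter P ws) f p <= \rsum_(p <- ws) f p.
Proof.
by elim=> [|p {}ws h _ IH] /=; [lra|rewrite big_cons; case: ifP => _; rewrite ?big_cons; lra].
Qed.

Lemma mass_filter (P : pred (R * blk)) ws F : okws ws -> mass blo bhi (filter P ws) F <= mass blo bhi ws F.
Proof.
by move=> h; apply: rsum_filter_le; apply: List.Forall_impl h => p [h _]; case: ifP => _ //; lra.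
Qed.

Lemma wtotal_filter (P : pred (R * blk)) ws : okws ws -> wtotal (filter P ws) <= wtotal ws.
Proof. by move=> h; apply: rsum_filter_le; apply: List.Forall_impl h => p []. Qed.

Lemma restr_nohit E y : okblk y -> ~~ hit blo bhi E y -> restr E y.1 = vzero.
Proof.
case=> _ _ h _ nh; apply: restr0 => k kE; case: (Req_EM_T (y.1 k) 0) => // /h hk.
by case/hasP: nh; exists k.
Qed.

Lemma N_restr_wsum E ws : okws ws ->
  N (restr E (wsum ws)) <= \rsum_(p <- ws) (p.1 * N (restr E p.2.1)).
Proof.
elim=> [|p {}ws [h1 [h2 h3 h4 h5]] okws IH].
  by rewrite wsum_nil big_nil restr0 // N_zero; lra.
rewrite wsum_cons big_cons restr_add; apply: Rle_trans (N_add _ _) _.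
- by apply/c00_restr/c00_scal.
- by apply/c00_restr/okws_c00.
- by rewrite restr_scal N_scal ?Rabs_pos_eq //; [lra|exact: c00_restr].
Qed.

Lemma rsum_N_wsum Es ws : okws ws ->
  \rsum_(E <- Es) N (restr E (wsum ws)) <= \rsum_(p <- ws) (p.1 * \rsum_(E <- Es) N (restr E p.2.1)).
Proof.
move=> h; apply: (Rle_trans _ (\rsum_(E <- Es) \rsum_(p <- ws) (p.1 * N (restr E p.2.1)))).
  by apply: rsum_le; apply: Forall_all => E; exact: N_restr_wsum.
rewrite exchange_big /=; apply: rsum_le; apply: Forall_all => p; rewrite rsum_scal; lra.
Qed.

Lemma sumabs_wsum F ws : okws ws ->
  sumabs F (wsum ws) <= \rsum_(p <- ws) (p.1 * sumabs F p.2.1).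
Proof.
elim=> [|p {}ws [h1 _] okws IH].
  rewrite wsum_nil big_nil sumabsE big1; first by lra.
  by move=> k _; rewrite Rabs_R0.
rewrite wsum_cons big_cons !sumabsE in IH *; rewrite -rsum_scal.
apply: Rle_trans (Rplus_le_compat_l _ _ _ IH); rewrite -big_split /=.
apply: rsum_le; apply: Forall_all => k; apply: Rle_trans (Rabs_triang _ _) _.
by rewrite Rabs_mult (Rabs_pos_eq p.1) //; lra.
Qed.

Lemma N_wsum_le ws : okws ws -> N (wsum ws) <= wtotal ws.
Proof.
elim=> [|p {}ws [h1 [h2 h3 h4 h5]] okws IH]; first by rewrite wsum_nil N_zero /wtotal big_nil; lra.
rewrite wsum_cons /wtotal big_cons; apply: Rle_trans (N_add _ _) _.
- exact: c00_scal.
- exact: okws_c00.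
- by rewrite N_scal // Rabs_pos_eq // -/(wtotal ws); have := Rmult_le_compat_l _ _ _ h1 h3; lra.
Qed.

(** If the interval of [y] met two of the sets, it would contain the minimum of the later one. *)
Lemma nohit_mins Es y : blocks_ok Es -> ~~ hit blo bhi (map smin Es) y ->
  \rsum_(E <- Es) (if hit blo bhi E y then 1 else 0) <= 1.
Proof.
move=> HB nh; case: (classic (exists D, D \in Es /\ hit blo bhi D y)) => [[D [DE hD]]|H].
  rewrite (rsum_single (D := D)) ?hD; [by lra|exact: blocks_uniq|by []|].
  move=> E EE ED; case: ifP => // hE; case/negP: nh.
  have key A B : A \in Es -> B \in Es -> setlt A B -> hit blo bhi A y -> hit blo bhi B y ->
      hit blo bhi (map smin Es) y.
    move=> AE BE AB /hasP[a aA ha] /hasP[b bB hb]; apply/hasP; exists (smin B); first exact: map_f.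
    have := fs_smin (blocks_in_fs HB BE) bB.
    have := fs_smax (blocks_in_fs HB AE) aA; move: AB; rewrite /setlt; lia.
  have trich : setlt E D \/ setlt D E.
    have /blocks_uniq U := HB.
    move: EE DE; rewrite -!index_mem => h1 h2.
    have [_ H] := HB.
    case: (ltngtP (index E Es) (index D Es)) => h.
    - by left; have := H _ _ (introT andP (conj h h2)); rewrite !nth_index -?index_mem.
    - by right; have := H _ _ (introT andP (conj h h1)); rewrite !nth_index -?index_mem.
    - by move: ED; rewrite -(nth_index [::] (x := E) (s := Es)) -?index_mem // h nth_index -?index_mem // eqxx.
  by case: trich => h; [apply: (key E D)|apply: (key D E)].
rewrite big_seq_cond big1; first by lra.
by move=> E; rewrite andbT => EE; case: ifP => // hE; case: H; exists E.
Qed.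

Lemma rsum_unhit Es ws : blocks_ok Es -> okws ws ->
  List.Forall (fun p => ~~ hit blo bhi (map smin Es) p.2) ws ->
  \rsum_(E <- Es) N (restr E (wsum ws)) <= wtotal ws.
Proof.
move=> HB ok nh; apply: Rle_trans (rsum_N_wsum Es ok) _; apply: rsum_le.
apply/List.Forall_forall => p pws.
have [p0 okp] := Forall_In ok pws.
have nhp := Forall_In nh pws.
rewrite -[X in _ <= X]Rmult_1_r; apply: Rmult_le_compat_l => //.
apply: Rle_trans (nohit_mins HB nhp); apply: rsum_le; apply: Forall_all => E.
case: ifP => [_|/negbT h]; last by rewrite restr_nohit // N_zero; lra.
by case: okp => h1 h2 _ _; apply: Rle_trans (N_restr _ h1) h2.
Qed.

(** Blocks over a minimum may be cut by many sets. They are estimated by their total weight, which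
    is a mass on a set of [SL l]. *)
Lemma rsum_hit l Es ws : blocks_ok Es -> okws ws -> SL l (map smin Es) ->
  thprod theta l * \rsum_(E <- Es) N (restr E (wsum (filter (fun p => hit blo bhi (map smin Es) p.2) ws)))
  <= mass blo bhi ws (map smin Es).
Proof.
move=> HB ok HE; set ws1 := filter _ _.
apply: (Rle_trans _ (wtotal ws1)).
  apply: (Rle_trans _ (N (wsum ws1))); first by apply: N_SL => //; exact/okws_c00/okws_filter.
  by apply: N_wsum_le; exact: okws_filter.
by rewrite /wtotal /ws1 big_filter big_mkcond /mass; apply: Req_le; apply: eq_bigr.
Qed.

End Norm.

(** * Upper estimates for the norm of a combination of blocks *)

Definition ind (b : bool) : R := if b then 1 else 0.

Lemma ind_ge0 b : 0 <= ind b. Proof. by case: b => /=; lra. Qed.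

Lemma rsum_const (T : Type) (s : seq T) c : \rsum_(x <- s) c = INR (size s) * c.
Proof.
elim: s => [|x s IH]; first by rewrite big_nil /=; lra.
by rewrite big_cons IH -[size (x :: s)]/(size s).+1 S_INR; lra.
Qed.

Lemma ind_has_le (T : Type) (P : pred T) s : ind (has P s) <= \rsum_(x <- s) ind (P x).
Proof.
elim: s => [|x s IH] /=; first by rewrite big_nil; exact: Rle_refl.
rewrite big_cons; case: (P x) => /=; last by lra.
have : 0 <= \rsum_(x <- s) ind (P x) by apply: rsum_ge0; apply: Forall_all => y; exact: ind_ge0.
by lra.
Qed.

Lemma massE ws F : mass blo bhi ws F = \rsum_(p <- ws) (p.1 * ind (hit blo bhi F p.2)).
Proof. by apply: eq_bigr => p _; rewrite /ind; case: hit; lra. Qed.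

Lemma rsum_filterE (T : Type) (P : pred T) (s : seq T) (f : T -> R) :
  \rsum_(x <- filter P s) f x = \rsum_(x <- s) (f x * ind (P x)).
Proof. by rewrite big_filter big_mkcond /=; apply: eq_bigr => x _; rewrite /ind; case: (P x); lra. Qed.

Lemma rsum_swap (T U : Type) (s : seq T) (u : seq U) (f : T -> U -> R) :
  \rsum_(x <- s) \rsum_(y <- u) f x y = \rsum_(y <- u) \rsum_(x <- s) f x y.
Proof. exact: exchange_big. Qed.

Lemma rsumD (T : Type) (s : seq T) (f g : T -> R) :
  \rsum_(x <- s) (f x + g x) = \rsum_(x <- s) f x + \rsum_(x <- s) g x.
Proof. exact: big_split. Qed.

Lemma hit_sub F F' y : {subset F <= F'} -> hit blo bhi F y -> hit blo bhi F' y.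
Proof. by move=> H /hasP[k kF hk]; apply/hasP; exists k => //; exact: H. Qed.

Lemma ind_le (b c : bool) : (b -> c) -> ind b <= ind c.
Proof. by case: b; case: c => //= H; rewrite /ind; try lra; have := H isT. Qed.

Lemma Forall_filter (T : Type) (P : T -> Prop) (Q : pred T) s : List.Forall P s ->
  List.Forall (fun x => P x /\ Q x) (filter Q s).
Proof. by elim=> [|x {}s h _ IH] /=; [constructor|case: ifP => // q; constructor]. Qed.

Definition unhit (Es : seq (seq nat)) (ws : seq (R * blk)) :=
  List.Forall (fun p => ~~ hit blo bhi (map smin Es) p.2) ws.

Section Upper.
Variables (zeta : Ord -> nat -> Ord) (F0 : fam) (beta : nat -> Ord) (theta : nat -> R) (N : vec -> R).
Hypotheses (HF0 : regular F0) (HS0 : contains_S0 F0).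
Hypothesis Hth : forall n, 0 < theta n < 1.
Hypothesis Hthdec : forall n, theta n.+1 <= theta n.
Hypothesis HN : is_T_norm zeta F0 theta beta N.

Local Notation SL := (SL zeta beta).
Local Notation okws := (okws N).
Local Notation mass := (mass blo bhi).
Local Notation hit := (hit blo bhi).

(** An unhit block meets at most one set of [Es], so adding the masses over the sets counts no block
    twice. *)
Lemma mass_flatten Es ws (D : seq nat -> seq nat) : blocks_ok Es -> okws ws -> unhit Es ws ->
  (forall E, E \in Es -> {subset D E <= E}) ->
  \rsum_(E <- Es) mass ws (D E) <= mass ws (flatten (map D Es)).
Proof.
move=> HB ok nh HD; under eq_bigr do rewrite massE.
rewrite rsum_swap massE; apply: rsum_le; apply/List.Forall_forall => p pws.
have [p0 okp] := Forall_In ok pws.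
have nhp := Forall_In nh pws.
rewrite rsum_scal; apply: Rmult_le_compat_l => //.
case: (boolP (hit (flatten (map D Es)) p.2)) => [h|h] /=; last first.
  rewrite big_seq_cond big1; first exact: Rle_refl.
  move=> E /andP[EE _]; rewrite /ind; case: ifP => // hE; case/negP: h.
  by apply: hit_sub hE => k kE; apply/flattenP; exists (D E) => //; exact: map_f.
apply: Rle_trans (nohit_mins HB nhp); apply: rsum_le; apply: Forall_mem => E EE.
by apply: ind_le; apply: hit_sub; exact: HD.
Qed.

(** A nearly norming alternative for the restriction of [x] to [E]: a set of [F0] or an admissible
    family, inside [E]. The supremum is not known to be attained, whence the error [eps]. *)
Definition wit_ok (E : seq nat) (x : vec) (eps : R) (w : seq nat + nat * seq (seq nat)) : Prop :=
  match w with
  | inl F => [/\ F0 F, {subset F <= E} & N (restr E x) <= sumabs F x + eps]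
  | inr (n, Es) => [/\ blocks_ok Es, Sch zeta (beta n) (map smin Es), forall D, D \in Es -> {subset D <= E}
      & N (restr E x) <= theta n * \rsum_(D <- Es) N (restr D x) + eps]
  end.

Lemma norm_witness E x eps : c00 x -> 0 < eps -> exists w, wit_ok E x eps w.
Proof.
move=> hx e0; have hEx := c00_restr E hx.
have [v [Hv hv]] : exists v, norming_set zeta F0 theta beta N (restr E x) v /\ N (restr E x) <= v + eps.
  apply: NNPP => H; have [_ h] := N_lub HN hEx.
  suff : N (restr E x) <= N (restr E x) - eps by lra.
  apply: h => v Hv; case: (Rle_dec v (N (restr E x) - eps)) => // hv.
  by case: H; exists v; split=> //; lra.
case: Hv => [[F [HF Ev]]|[n [Es [[HB HE] Ev]]]].
  exists (inl (filter (mem E) F)) => /=; split; last by rewrite -sumabs_restr -Ev.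
    have fsF := proj1 HF0 _ HF; apply: (regular_pclosed HF0 HF).
      exact: fs_subseq fsF (filter_subseq _ _).
    exact: subseq_dom fsF (filter_subseq _ _).
  by move=> k; rewrite mem_filter => /andP[].
have [|B d1 _] := shrink_blocks (D := fun D => filter (mem E) D) HB.
  move=> D DE; split; first exact: fs_subseq (blocks_in_fs HB DE) (filter_subseq _ _).
  by move=> k; rewrite mem_filter => /andP[].
eexists (inr (n, _)) => /=; split; first exact: B.
- exact: Sch_pclosed HE (mins_fs B) d1.
- by move=> D; rewrite mem_filter => /andP[_ /mapP[D' _ ->]] k; rewrite mem_filter => /andP[].
- apply: Rle_trans hv _; rewrite Ev foldr_rsum big_filter [X in _ <= theta n * X + _]big_mkcond big_map.
  apply: Rplus_le_compat_r; apply: Rmult_le_compat_l; first by have := Hth n; lra.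
  apply: rsum_le; apply: Forall_all => D; rewrite restr_restr.
  case: eqP => [->|_] /=; last exact: Rle_refl.
  by rewrite restr0 // (N_zero HN); lra.
Qed.

Variables (d d' kap : R) (bad : nat -> nat * nat).
Hypotheses (d'0 : 0 <= d') (kap0 : 0 <= kap).

(** The sequences along which the expansion of the norm is continued; once the product of the
    [theta]s is at most [d], the expansion stops. *)
Definition reach (l : seq nat) := l = [::] \/ thprod theta l > d.

(* For each [n] the blocks over one interval [bad n] are exempt from the last estimate. *)
Definition small_on ws := [/\ okws ws,
  forall l F, reach l -> SL l F -> mass ws F <= d',
  forall l F, reach l -> comp (SL l) F0 F -> mass ws F <= d'
  & forall n l Es, reach l -> thprod theta l * theta n <= d -> blocks_ok Es ->
      Sch zeta (beta n) (map smin Es) ->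
      List.Forall (fun p => p.2.2 <> bad n ->
        thprod theta l * theta n * \rsum_(E <- Es) N (restr E p.2.1) <= kap) ws].

Lemma small_filter (P : pred (R * blk)) ws : small_on ws -> small_on (filter P ws).
Proof.
case=> ok h1 h2 h3; split; first exact: okws_filter.
- by move=> l F hl HF; apply: Rle_trans (mass_filter P F ok) _; exact: h1 hl HF.
- by move=> l F hl HF; apply: Rle_trans (mass_filter P F ok) _; exact: h2 hl HF.
- move=> n l Es hl hn HB HE; apply: List.Forall_impl (Forall_filter P (h3 n l Es hl hn HB HE)).
  by move=> p [].
Qed.

Lemma restr_wsum0 D ws : okws ws -> List.Forall (fun p => ~~ hit D p.2) ws -> restr D (wsum ws) = vzero.
Proof.
move=> ok; elim: ok => [|p {}ws [h1 okp] _ IH] H; first by rewrite wsum_nil restr0.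
have [hp hws] : ~~ hit D p.2 /\ List.Forall (fun p => ~~ hit D p.2) ws by inversion H.
rewrite wsum_cons restr_add restr_scal (restr_nohit okp hp) IH //.
by apply: functional_extensionality => k; rewrite /vadd /vscal /vzero; lra.
Qed.

Lemma comp_S0 (M : fam) F : comp M (Sch zeta OZ) F -> M F.
Proof.
case=> Es [-> [HB [HE HM]]]; suff -> : flatten Es = map smin Es by [].
elim: Es HB HE {HM} => [//|E Es IH] /blocks_cons[h1 h2 h3 h4] HE /=.
have /(Sch_zero_inv (oeq_refl _)) := HE _ (mem_head _ _).
case: E h2 {h1 h4} HE => [//|x [|//]] _ HE _ /=; rewrite IH // => D DE.
by apply: HE; rewrite inE DE orbT.
Qed.

(** * One level in the expansion of the norm *)

Section Step.
Variables (l : seq nat) (Es : seq (seq nat)) (un : seq (R * blk)) (x : vec).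
Variable w : seq nat -> seq nat + nat * seq (seq nat).
Variables (n0 : nat) (eps : R).
Hypotheses (Hl : reach l) (HB : blocks_ok Es) (HE : SL l (map smin Es)) (Hun : small_on un)
  (Hunhit : unhit Es un) (Ex : x = wsum un) (eps0 : 0 < eps).
Hypothesis Hw : forall E, E \in Es -> wit_ok E x eps (w E).
Hypothesis Hn0 : forall n, (n0 <= n)%N -> theta n <= d.

Let t := thprod theta l.
Let DA E := if w E is inl F then F else [::].
(** A witness of index [n] is terminal when t times [theta n] is at most [d]. The other indices are
    below [n0], form the list [ns], and have their pieces [pc] passed to the next level. *)
Let cl n E := if w E is inr (n', _) then n' == n else false.
Let pc n E := if w E is inr (n', Es') then (if n' == n then Es' else [::]) else [::].
Let isterm n : bool := if Rle_dec (t * theta n) d then true else false.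
Let term E := if w E is inr (n, _) then isterm n else false.
Let vb E := if w E is inr (n, Es') then ind (isterm n) * (theta n * \rsum_(D <- Es') N (restr D x)) else 0.
Let ns := filter (fun n => ~~ isterm n) (iota 0 n0).
Let inbad n (k : nat) := ((bad n).1 <= k <= (bad n).2)%N.
(** For a terminal witness of index [n], one point of [E] in the exempt interval of [n]. One point
    per set yields a member of [SL l], so the exempt blocks are controlled by a mass. *)
Let DB E := if w E is inr (n, _) then (if isterm n then take 1 (filter (inbad n) E) else [::]) else [::].

Let t0 : 0 < t. Proof. exact: thprod_pos. Qed.
Let t1 : t <= 1. Proof. exact: thprod_le1. Qed.
Let ok : okws un. Proof. by case: Hun. Qed.
Let cx : c00 x. Proof. by rewrite Ex; exact: okws_c00 ok. Qed.

Let istermP n : reflect (t * theta n <= d) (isterm n).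
Proof. by rewrite /isterm; case: Rle_dec => h; constructor. Qed.

Let nterm_ns n : ~~ isterm n -> n \in ns.
Proof.
move=> h; rewrite mem_filter h mem_iota /= add0n ltnNge; apply/negP => /Hn0 hn.
move/istermP: h; have := Hth n; nra.
Qed.

Let val_le E : E \in Es -> N (restr E x) <= sumabs (DA E) x + vb E +
  \rsum_(n <- ns) (theta n * \rsum_(D <- pc n E) N (restr D x)) + eps.
Proof.
have Ngt0 Es' : 0 <= \rsum_(D <- Es') N (restr D x).
  exact: (rsum_N_ge0 HN).
have rest E' : 0 <= \rsum_(n <- ns) (theta n * \rsum_(D <- pc n E') N (restr D x)).
  apply: rsum_ge0; apply: Forall_all => n; apply: Rmult_le_pos => //; by have := Hth n; lra.
move=> /Hw; rewrite /DA /vb /wit_ok; case EW: (w E) => [F|[n Es']].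
  by case=> _ _ h; have := rest E; lra.
case=> _ _ _ h; case: (boolP (isterm n)) => hn /=; first by have := rest E; lra.
rewrite (rsum_single (D := n)) ?filter_uniq ?iota_uniq ?nterm_ns //.
  by rewrite /pc EW eqxx; lra.
by move=> m _ mn; rewrite /pc EW eq_sym (negbTE mn) big_nil; lra.
Qed.

Let fsE E : E \in Es -> fs E. Proof. exact: blocks_in_fs. Qed.

(** The chosen sets of [F0] lie in different sets of [Es], and their union belongs to the
    composition of [SL l] with [F0], on which the mass is small. *)
Let partA : t * \rsum_(E <- Es) sumabs (DA E) x <= d'.
Proof.
have DAs E : E \in Es -> [/\ fs (DA E), {subset DA E <= E} & F0 (DA E)].
  move=> /Hw; rewrite /DA /wit_ok; case: (w E) => [F [h1 h2 _]|[n Es' _]].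
    by split=> //; exact: (proj1 HF0).
  by split=> //; exact: (proj1 HS0).
apply: (Rle_trans _ (\rsum_(E <- Es) sumabs (DA E) x)).
  rewrite -[X in _ <= X]Rmult_1_l; apply: Rmult_le_compat_r => //.
  by apply: rsum_ge0; apply: Forall_all => E; exact: sumabs_ge0.
apply: (Rle_trans _ (mass un (flatten (map DA Es)))); last first.
  have [_ _ h _] := Hun; apply: (h l) => //; apply: comp_of_subsets => //; first exact: SL_pclosed.
  by move=> E /DAs[].
apply: Rle_trans (mass_flatten HB ok Hunhit (D := DA) _); last by move=> E /DAs[].
apply: rsum_le; apply: Forall_mem => E /DAs[_ _ HFE].
rewrite Ex massE; apply: Rle_trans (sumabs_wsum _ ok) _; apply: rsum_le.
apply: List.Forall_impl ok => p [p0 okp]; apply: Rmult_le_compat_l => //.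
rewrite /ind; case: ifP => [_|/negbT nh].
  by have [h1 h2 _ _] := okp; apply: Rle_trans (N_F0 HN h1 HFE) h2.
rewrite sumabsE big_seq_cond big1; first exact: Rle_refl.
move=> k /andP[kE _]; have := restr_nohit okp nh => /(congr1 (fun z => z k)).
by rewrite /restr kE => ->; rewrite Rabs_R0.
Qed.

(** An ordinary block meeting a terminal set costs [kap]. An exempt block costs at most its weight,
    since its terminal sum is at most its norm, and it is hit by the point in [DB E]. *)
Let partB : t * \rsum_(E <- Es) vb E <=
  kap * \rsum_(p <- un) (p.1 * \rsum_(E <- Es) (ind (term E) * ind (hit E p.2))) + d'.
Proof.
have DBs E : E \in Es -> [/\ fs (DB E), {subset DB E <= E} & DB E <> [::] -> Sch zeta OZ (DB E)].
  move=> EE; rewrite /DB; case: (w E) => [F|[n Es']]; first by split.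
  case: ifP => _; last by split.
  have S : subseq (take 1 (filter (inbad n) E)) E.
    exact: subseq_trans (take_subseq _ _) (filter_subseq _ _).
  split; [exact: fs_subseq (fsE EE) S|exact: mem_subseq|].
  have := fs_subseq (fsE EE) S; case: (filter _ _) => [//|k s] /=; rewrite take0.
  by case/fs_cons=> k0 _ _ _; exact: Sch_zero.
have massB : \rsum_(E <- Es) mass un (DB E) <= d'.
  apply: Rle_trans (mass_flatten HB ok Hunhit (D := DB) _) _; first by move=> E /DBs[].
  have [_ h _ _] := Hun; apply: (h l) => //; apply: comp_S0.
  by apply: comp_of_subsets => //; exact: SL_pclosed.
suff H : t * \rsum_(E <- Es) vb E <= \rsum_(E <- Es) (\rsum_(p <- un)
    (kap * (p.1 * (ind (term E) * ind (hit E p.2)))) + mass un (DB E)).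
  apply: Rle_trans H _; rewrite rsumD rsum_swap -rsum_scal.
  apply: Rplus_le_compat => //; apply: Req_le; apply: eq_bigr => p _.
  by rewrite rsum_scal rsum_scal.
rewrite -rsum_scal; apply: rsum_le; apply: Forall_mem => E EE.
have pos : 0 <= \rsum_(p <- un) (kap * (p.1 * (ind (term E) * ind (hit E p.2)))) + mass un (DB E).
  rewrite massE -rsumD; apply: rsum_ge0; apply: List.Forall_impl ok => p [p0 _].
  have := ind_ge0 (term E); have := ind_ge0 (hit E p.2); have := ind_ge0 (hit (DB E) p.2) => h1 h2 h3.
  by apply: Rplus_le_le_0_compat; do ?apply: Rmult_le_pos.
move: pos; rewrite /vb /term /DB; have := Hw EE; case: (w E) => [F _|[n Es']]; first by rewrite Rmult_0_r.
case=> HB' HE' Hsub _; case: (istermP n) => hn /= pos; last by rewrite Rmult_0_l Rmult_0_r.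
rewrite massE -rsumD Rmult_1_l -Rmult_assoc Ex.
apply: (Rle_trans _ (t * theta n * \rsum_(p <- un) (p.1 * \rsum_(D <- Es') N (restr D p.2.1)))).
  apply: Rmult_le_compat_l; last exact: (rsum_N_wsum HN).
  by apply: Rmult_le_pos; have := Hth n; lra.
rewrite -rsum_scal; have [_ _ _ /(_ n l Es' Hl hn HB' HE') Hbad] := Hun.
apply: rsum_le; apply/List.Forall_forall => p pun.
have [p0 okp] := Forall_In ok pun.
have {}Hbad := Forall_In Hbad pun.
rewrite -Rmult_assoc (Rmult_comm (_ * _) p.1) Rmult_assoc -!Rmult_assoc (Rmult_comm kap) !Rmult_assoc.
rewrite -Rmult_plus_distr_l; apply: Rmult_le_compat_l => //; rewrite Rmult_1_l -Rmult_assoc.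
case: (boolP (hit E p.2)) => hE; last first.
  rewrite big_seq_cond big1.
    by rewrite -[ind false]/0 !Rmult_0_r Rplus_0_l; exact: ind_ge0.
  move=> D /andP[DE _]; rewrite (restr_nohit okp) ?(N_zero HN) //.
  by apply: contra hE; apply: hit_sub; exact: Hsub.
case: (classic (p.2.2 = bad n)) => hb; last first.
  apply: Rle_trans (Hbad hb) _; rewrite -[ind true]/1 Rmult_1_r -[X in X <= _]Rplus_0_r.
  by apply: Rplus_le_compat_l; exact: ind_ge0.
have -> : hit (take 1 [seq k <- E | inbad n k]) p.2.
  case/hasP: hE => k kE hk; have : k \in [seq k <- E | inbad n k].
    by rewrite mem_filter kE andbT /inbad -hb.
  case EF: (filter _ _) => [//|j s] _ /=; rewrite take0 /hit /= orbF.
  have : j \in [seq k <- E | inbad n k] by rewrite EF mem_head.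
  by rewrite mem_filter /inbad -hb => /andP[].
have [h1 h2 _ _] := okp; have h3 := N_adm HN h1 HB' HE'.
have h4 : t * (theta n * \rsum_(D <- Es') N (restr D p.2.1)) <= 1 * 1.
  apply: Rmult_le_compat => //; [lra| |lra].
  apply: Rmult_le_pos; first by have := Hth n; lra.
  exact: (rsum_N_ge0 HN).
by rewrite /ind; lra.
Qed.

Let un_cl n := filter (fun p => has (fun E => cl n E && hit E p.2) Es) un.

Variable B : R.
Hypothesis Hrec : forall n Es', reach (n :: l) -> blocks_ok Es' -> SL (n :: l) (map smin Es') ->
  thprod theta (n :: l) * \rsum_(E <- Es') N (restr E (wsum (un_cl n))) <= kap * wtotal (un_cl n) + B.

(** All pieces of index [n] together form a family with minima in [SL (n :: l)], so the next level
    applies to the blocks which these pieces can see. *)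
Let partC n : n \in ns -> t * (theta n * \rsum_(E <- Es) \rsum_(D <- pc n E) N (restr D x)) <=
  kap * wtotal (un_cl n) + B.
Proof.
rewrite mem_filter => /andP[/istermP hn _].
have pcs E : E \in Es -> [/\ blocks_ok (pc n E), {subset flatten (pc n E) <= E},
    fs (map smin (pc n E)) & map smin (pc n E) <> [::] -> Sch zeta (beta n) (map smin (pc n E))].
  move=> /Hw; rewrite /pc; case: (w E) => [F _|[n' Es']]; first by split.
  case=> h1 h2 h3 _; case: eqP => [<-|_]; last by split.
  split=> //; last exact: mins_fs.
  by move=> k /flattenP[D DE kD]; exact: h3 DE _ kD.
pose Esn := flatten (map (pc n) Es).
have BEn : blocks_ok Esn.
  have [|B1 _ E1] := shrink_blocks (D := fun E => flatten (pc n E)) HB.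
    by move=> E /pcs[/blocks_fs[h1 h2] h3 _ _].
  apply/blocks_fs; split; first by rewrite flatten_flatten -map_comp -E1; case/blocks_fs: B1.
  by apply/flattenP => -[G /mapP[E /pcs[/blocks_fs[_ h] _ _ _] ->]] h'; rewrite h' in h.
have SEn : SL (n :: l) (map smin Esn).
  rewrite /Esn map_flatten -map_comp; apply: comp_of_subsets => //; first exact: SL_pclosed.
  move=> E /pcs[h1 h2 h3 h4]; split=> // k /(mins_sub h1); exact: h2.
have rch : reach (n :: l) by right; rewrite /= Rmult_comm -/t; lra.
apply: Rle_trans (Hrec rch BEn SEn); rewrite rsum_flatten big_map [thprod _ _]/= -/t -Rmult_assoc (Rmult_comm t).
apply: Req_le; congr (_ * _).
apply: rsum_eq; apply: Forall_mem => E EE.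
apply: rsum_eq; apply: Forall_mem => D DG.
rewrite Ex (wsum_filter (fun p => has (fun E => cl n E && hit E p.2) Es) un) restr_add.
rewrite (@restr_wsum0 D [seq x0 <- un | predC _ x0]).
- by rewrite vaddv0.
- exact: okws_filter.
have [hB hS _ _] := pcs _ EE.
apply: List.Forall_impl (Forall_filter _ ok) => p [_ /=]; apply: contra => hD.
apply/hasP; exists E => //; rewrite (hit_sub _ hD) ?andbT.
  by move: DG; rewrite /pc /cl; case: (w E) => [//|[n' Es']]; case: eqP.
by move=> k kD; apply: hS; apply/flattenP; exists D.
Qed.

(** Of the two terms [d'], one comes from the sets of [F0] and one from the exempt blocks. The error
    [B] occurs once per nonterminal index, but the weights do not. *)
Lemma norm_step : t * \rsum_(E <- Es) N (restr E x) <=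
  kap * wtotal un + 2 * d' + INR n0 * Rabs B + INR (size Es) * eps.
Proof.
pose f E := sumabs (DA E) x + vb E + \rsum_(n <- ns) (theta n * \rsum_(D <- pc n E) N (restr D x)).
have h1 : \rsum_(E <- Es) N (restr E x) <= \rsum_(E <- Es) (f E + eps).
  by apply: rsum_le; apply: Forall_mem => E /val_le.
have hC : t * \rsum_(E <- Es) \rsum_(n <- ns) (theta n * \rsum_(D <- pc n E) N (restr D x)) <=
    kap * \rsum_(n <- ns) wtotal (un_cl n) + INR n0 * Rabs B.
  rewrite rsum_swap -!rsum_scal.
  apply: (Rle_trans _ (\rsum_(n <- ns) (kap * wtotal (un_cl n) + Rabs B))).
    apply: rsum_le; apply: Forall_mem => n nn; rewrite rsum_scal.
    by have := partC nn; have := Rle_abs B; lra.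
  rewrite rsumD rsum_const; apply: Rplus_le_compat_l; apply: Rmult_le_compat_r; first exact: Rabs_pos.
  apply: le_INR; rewrite size_filter; have := count_size (fun n => ~~ isterm n) (iota 0 n0).
  by rewrite size_iota; lia.
(* Each unhit block lies over at most one set of [Es] and is charged to the class of that set only.
   Hence [kap] multiplies the total weight just once. *)
have key : \rsum_(p <- un) (p.1 * \rsum_(E <- Es) (ind (term E) * ind (hit E p.2))) +
    \rsum_(n <- ns) wtotal (un_cl n) <= wtotal un.
  have -> : \rsum_(n <- ns) wtotal (un_cl n) =
      \rsum_(p <- un) (p.1 * \rsum_(n <- ns) ind (has (fun E => cl n E && hit E p.2) Es)).
    under eq_bigr do rewrite /wtotal rsum_filterE.
    by rewrite rsum_swap; apply: eq_bigr => p _; rewrite rsum_scal.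
  rewrite -rsumD; apply: rsum_le; apply/List.Forall_forall => p pun.
  have [p0 okp] := Forall_In ok pun.
  have nhp := Forall_In Hunhit pun.
  rewrite -Rmult_plus_distr_l -[X in _ <= X]Rmult_1_r; apply: Rmult_le_compat_l => //.
  apply: Rle_trans (nohit_mins HB nhp).
  apply: (Rle_trans _ (\rsum_(E <- Es) (ind (term E) * ind (hit E p.2)) +
      \rsum_(n <- ns) \rsum_(E <- Es) ind (cl n E && hit E p.2))).
    by apply: Rplus_le_compat_l; apply: rsum_le; apply: Forall_all => n; exact: ind_has_le.
  rewrite rsum_swap -rsumD; apply: rsum_le; apply: Forall_all => E.
  case: (hit E p.2); last first.
    by rewrite big1 /ind; [lra|move=> n _; rewrite andbF].
  rewrite /= Rmult_1_r /term /cl; under eq_bigr do rewrite andbT.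
  case: (w E) => [F|[n Es']]; first by rewrite big1 //=; lra.
  case: (boolP (isterm n)) => hn /=.
    rewrite big_seq_cond big1; first by lra.
    move=> m /andP[mn _]; case: eqP => // nm; move: mn; rewrite -nm mem_filter hn.
    by [].
  rewrite (rsum_single (D := n)) ?filter_uniq ?iota_uniq ?nterm_ns ?eqxx //=; first by lra.
  by move=> m _ mn; rewrite eq_sym (negbTE mn).
have hA := partA; have hB := partB.
have hkey := Rmult_le_compat_l _ _ _ kap0 key.
have E1 : \rsum_(E <- Es) (f E + eps) = \rsum_(E <- Es) sumabs (DA E) x + \rsum_(E <- Es) vb E +
   \rsum_(E <- Es) \rsum_(n <- ns) (theta n * \rsum_(D <- pc n E) N (restr D x)) + INR (size Es) * eps.
  by rewrite rsumD rsum_const /f !rsumD.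
have h2 := Rmult_le_compat_l _ _ _ (Rlt_le _ _ t0) h1; rewrite E1 in h2.
have sz : 0 <= INR (size Es) * eps by apply: Rmult_le_pos; [exact: pos_INR|lra].
nra.
Qed.

End Step.

(** The 3 counts the blocks over minima, the sets of [F0] and the exempt blocks; the second summand
    pays for at most [n0] calls of the next level. *)
Fixpoint upper_const (n0 m : nat) : R :=
  if m is m'.+1 then 3 + INR n0 * upper_const n0 m' else 0.

Lemma upper_const_ge0 n0 m : 0 <= upper_const n0 m.
Proof.
elim: m => [|m IH] /=; first exact: Rle_refl.
have := Rmult_le_pos _ _ (pos_INR n0) IH; lra.
Qed.

(** Blocks over minima are removed at each level before [norm_step] is used. The depth is finite
    because sequences in [reach] have length below [D0]; this keeps the factor of [d'] independent
    of [ws]. *)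
Lemma norm_recursion n0 D0 (Hn0 : forall n, (n0 <= n)%N -> theta n <= d)
  (HD0 : forall l, reach l -> (size l < D0)%N) m l ws Es :
  (D0 <= size l + m)%N -> reach l -> small_on ws -> blocks_ok Es -> SL l (map smin Es) ->
  thprod theta l * \rsum_(E <- Es) N (restr E (wsum ws)) <= kap * wtotal ws + upper_const n0 m * d'.
Proof.
elim: m l ws Es => [|m IH] l ws Es hm Hl Hws HB HE; first by have := HD0 _ Hl; lia.
pose P (p : R * blk) := hit (map smin Es) p.2.
have ok : okws ws by case: Hws.
have t0 := thprod_pos Hth l; have t1 := thprod_le1 Hth l.
have ok1 := okws_filter P ok; have ok2 := okws_filter (predC P) ok.
have h1 : \rsum_(E <- Es) N (restr E (wsum ws)) <= \rsum_(E <- Es) N (restr E (wsum (filter P ws))) +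
    \rsum_(E <- Es) N (restr E (wsum (filter (predC P) ws))).
  rewrite -rsumD; apply: rsum_le; apply: Forall_all => E; rewrite {1}(wsum_filter P ws) restr_add.
  by apply: (N_add HN); apply: c00_restr; [exact: okws_c00 ok1|exact: okws_c00 ok2].
have h2 : thprod theta l * \rsum_(E <- Es) N (restr E (wsum (filter P ws))) <= d'.
  by apply: Rle_trans (rsum_hit Hth Hthdec HN HB ok HE) _; have [_ h _ _] := Hws; exact: h Hl HE.
have h3 : thprod theta l * \rsum_(E <- Es) N (restr E (wsum (filter (predC P) ws))) <=
    kap * wtotal (filter (predC P) ws) + 2 * d' + INR n0 * (upper_const n0 m * d').
  apply: le_epsilon => eps eps0.
  have sz0 : 0 < INR (size Es) + 1 by have := pos_INR (size Es); lra.
  have eps1 : 0 < eps / (INR (size Es) + 1) by apply: Rdiv_lt_0_compat.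
  have [w Hw] := @choice_on _ _ (fun E => E \in Es) (fun E w => wit_ok E (wsum (filter (predC P) ws))
     (eps / (INR (size Es) + 1)) w) (inl [::]) (fun E _ => norm_witness E (okws_c00 ok2) eps1).
  have cB : 0 <= upper_const n0 m * d' by apply: Rmult_le_pos => //; exact: upper_const_ge0.
  have Hrec n Es' : reach (n :: l) -> blocks_ok Es' -> SL (n :: l) (map smin Es') ->
     thprod theta (n :: l) * \rsum_(E <- Es') N (restr E (wsum (filter (fun p => has (fun E =>
        (if w E is inr (n', _) then n' == n else false) && hit E p.2) Es) (filter (predC P) ws)))) <=
     kap * wtotal (filter (fun p => has (fun E =>
        (if w E is inr (n', _) then n' == n else false) && hit E p.2) Es) (filter (predC P) ws)) + upper_const n0 m * d'.
    by move=> h4 h5 h6; apply: IH => //; [rewrite /=; lia|do 2 apply: small_filter].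
  have unh : unhit Es (filter (predC P) ws).
    by apply: List.Forall_impl (Forall_filter (predC P) ok) => p [].
  have := norm_step Hl HB HE (small_filter (predC P) Hws) unh erefl eps1 Hw Hn0 Hrec.
  rewrite (Rabs_pos_eq _ cB).
  have : INR (size Es) * (eps / (INR (size Es) + 1)) <= eps.
    rewrite /Rdiv -Rmult_assoc (Rmult_comm _ eps) Rmult_assoc -[X in _ <= X]Rmult_1_r.
    apply: Rmult_le_compat_l; first by lra.
    by apply: (Rmult_le_reg_r (INR (size Es) + 1)) => //; rewrite Rmult_assoc Rinv_l; lra.
  by lra.
have h4 := Rmult_le_compat_l _ _ _ (Rlt_le _ _ t0) h1.
have h5 := Rmult_le_compat_l _ _ _ kap0 (wtotal_filter (predC P) ok).
rewrite [upper_const _ _]/=; lra.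
Qed.

End Upper.

Lemma thprod_le_pow (theta : nat -> R) (Hth : forall n, 0 < theta n < 1) (Hthdec : forall n, theta n.+1 <= theta n) l :
  thprod theta l <= theta 0%N ^ size l.
Proof.
elim: l => [|n l IH] /=; first exact: Rle_refl.
apply: Rmult_le_compat => //; first by have := Hth n; lra.
  exact/Rlt_le/thprod_pos.
exact: (theta_mono Hthdec (leq0n n)).
Qed.

Lemma thprod_size_bound (theta : nat -> R) (Hth : forall n, 0 < theta n < 1)
    (Hthdec : forall n, theta n.+1 <= theta n) d : 0 < d ->
  exists D0, forall l, thprod theta l > d -> (size l < D0)%N.
Proof.
move=> d0; have [t0 t1] := Hth 0%N.
have [D0 HD0] := pow_lt_1_zero (theta 0%N) ltac:(rewrite Rabs_pos_eq; lra) d d0.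
exists D0 => l hl; rewrite ltnNge; apply/negP => h.
have := HD0 (size l) ltac:(lia); have := thprod_le_pow Hth Hthdec l.
by rewrite Rabs_pos_eq; [lra|apply: pow_le; lra].
Qed.

Lemma null_bound (theta : nat -> R) (Hth : forall n, 0 < theta n < 1) (Hnull : Un_cv theta 0) d : 0 < d ->
  exists n0, forall n, (n0 <= n)%N -> theta n <= d.
Proof.
move=> d0; have [n0 Hn0] := Hnull d d0; exists n0 => n hn.
have := Hn0 n ltac:(lia); rewrite /R_dist Rminus_0_r Rabs_pos_eq; have := Hth n; lra.
Qed.

(** The order of quantifiers matters: [C] depends on [d] but not on [d'], [kap] or the blocks, so
    the masses can afterwards be made small compared with 1 / C. *)
Theorem norm_upper_bound zeta F0 beta theta N (HF0 : regular F0) (HS0 : contains_S0 F0)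
  (Hth : forall n, 0 < theta n < 1) (Hthdec : forall n, theta n.+1 <= theta n) (Hnull : Un_cv theta 0)
  (HN : is_T_norm zeta F0 theta beta N) d : 0 < d ->
  exists C, 0 <= C /\ forall d' kap bad ws, 0 <= d' -> 0 <= kap ->
    small_on zeta F0 beta theta N d d' kap bad ws -> N (wsum ws) <= kap * wtotal ws + C * d'.
Proof.
move=> d0; have [D0 HD0] := thprod_size_bound Hth Hthdec d0.
have [n0 Hn0] := null_bound Hth Hnull d0.
exists (upper_const n0 D0.+1); split; first exact: upper_const_ge0.
move=> d' kap bad ws d'0 kap0 Hws; have ok : okws N ws by case: Hws.
have [M hM] := okws_c00 ok.
have E1 : restr (iota 1 M.+1) (wsum ws) = wsum ws.
  by apply: restr_id => k; rewrite mem_iota => hk; apply: hM; lia.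
(* The norm itself is the case of the empty sequence and one interval containing the support. *)
have HB : blocks_ok [:: iota 1 M.+1].
  apply/blocks_cons; split=> //; split; first exact: iota_ltn_sorted.
  by apply/allP => k; rewrite mem_iota; lia.
have := @norm_recursion _ _ _ _ _ HF0 HS0 Hth Hthdec HN d d' kap bad d'0 kap0 n0 D0.+1 Hn0 _ D0.+1 [::] ws [:: iota 1 M.+1].
rewrite big_seq1 E1 [thprod _ _]/= Rmult_1_l; apply=> //.
- by move=> l [->|/HD0] //; lia.
- by left.
- by apply: Sch_zero.
Qed.

(** * Trees of block sequences *)

Lemma iter_tderiv_in T e t : iter_tderiv T e t -> T t.
Proof. by elim: e t => [//|e IH|f IH] t /=; [case=> /IH|move=> /(_ 0%N)/IH]. Qed.

Lemma iter_tderiv_le T e e' t : ole e' e -> iter_tderiv T e t -> iter_tderiv T e' t.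
Proof.
elim: e' e t => [|e' IHe'|f IHf] e t; first by move=> _; exact: iter_tderiv_in.
- rewrite -/(olt e' e); elim: e t => [//|e _|g IHg] t.
    move=> h [h1 [t' [h2 h3]]]; split; first exact: IHe' h h1.
    by exists t'; split=> //; exact: IHe' h h2.
  by case/olt_sup => n /IHg h H; exact: h.
- by move=> h H n; exact: IHf (h n) H.
Qed.

Lemma iter_tderiv_step T e e' t : iter_tderiv T e t -> olt e' e ->
  exists t', [/\ iter_tderiv T e' t', (size t < size t')%N & take (size t) t' = t].
Proof.
move=> H /(iter_tderiv_le) /(_ H) [_ [t' [h1 [h2 h3]]]]; by exists t'.
Qed.

Lemma foldr_mkseq (f : nat -> R) n : foldr Rplus 0 (mkseq f n) = \rsum_(i <- iota 0 n) f i.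
Proof. by rewrite /mkseq; elim: (iota 0 n) => [|i s IH]; rewrite ?big_nil ?big_cons //= IH. Qed.

Lemma lincombE a xs k : lincomb a xs k = \rsum_(i <- iota 0 (size xs)) (a i * nth vzero xs i k).
Proof. exact: foldr_mkseq. Qed.

Lemma sumabs_coefE a n : sumabs_coef a n = \rsum_(i <- iota 0 n) Rabs (a i).
Proof. exact: foldr_mkseq. Qed.

Lemma sumabs_coefD a m n : sumabs_coef a (m + n) = sumabs_coef a m + sumabs_coef (fun i => a (m + i)%N) n.
Proof.
rewrite !sumabs_coefE iotaD big_cat add0n; congr Rplus.
by rewrite -{1}(addn0 m) iotaDl big_map.
Qed.

Lemma lincomb_cat a xs ys : lincomb a (xs ++ ys) = vadd (lincomb a xs) (lincomb (fun i => a (size xs + i)%N) ys).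
Proof.
apply: functional_extensionality => k; rewrite /vadd !lincombE size_cat iotaD big_cat add0n.
congr Rplus.
  rewrite big_seq_cond [RHS]big_seq_cond; apply: eq_bigr => i /andP[]; rewrite mem_iota => /andP[_ h] _.
  by rewrite nth_cat ifT.
rewrite -{1}(addn0 (size xs)) iotaDl big_map; apply: eq_bigr => i _.
by rewrite nth_cat ltnNge leq_addr /= addKn.
Qed.

Lemma lincomb_ext a a' xs : (forall i, (i < size xs)%N -> a i = a' i) -> lincomb a xs = lincomb a' xs.
Proof.
move=> H; apply: functional_extensionality => k; rewrite !lincombE big_seq_cond [RHS]big_seq_cond.
by apply: eq_bigr => i /andP[]; rewrite mem_iota => /andP[_ h] _; rewrite H.
Qed.

Lemma sumabs_coef_ext a a' n : (forall i, (i < n)%N -> a i = a' i) -> sumabs_coef a n = sumabs_coef a' n.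
Proof.
move=> H; rewrite !sumabs_coefE big_seq_cond [RHS]big_seq_cond.
by apply: eq_bigr => i /andP[]; rewrite mem_iota => /andP[_ h] _; rewrite H.
Qed.

Lemma lincomb_scal c a xs : lincomb (fun i => c * a i) xs = vscal c (lincomb a xs).
Proof.
apply: functional_extensionality => k; rewrite /vscal !lincombE -rsum_scal.
by apply: eq_bigr => i _; rewrite Rmult_assoc.
Qed.

Lemma c00_lincomb a xs : (forall i, (i < size xs)%N -> c00 (nth vzero xs i)) -> c00 (lincomb a xs).
Proof.
elim: xs a => [|x xs IH] a H; first exact: c00_zero.
rewrite -cat1s lincomb_cat; apply: c00_add; last by apply: IH => i hi; exact: (H i.+1).
have -> : lincomb a [:: x] = vscal (a 0%N) x.
  by apply: functional_extensionality => k; rewrite lincombE /= big_seq1.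
by apply: c00_scal; exact: (H 0%N).
Qed.

(** The vector is a nonnegative combination of the vectors that t' adds to [t], with total
    coefficient [c]; nodes passed over receive coefficient zero. *)
Definition comb (t t' : seq vec) c v := exists zs a, [/\ t' = t ++ zs, forall i, 0 <= a i,
  v = lincomb a zs & sumabs_coef a (size zs) = c].

Lemma comb_zero t zs : comb t (t ++ zs) 0 vzero.
Proof.
exists zs, (fun _ => 0); split=> //; first by move=> _; exact: Rle_refl.
  by apply: functional_extensionality => k; rewrite lincombE big1 // => i _; rewrite Rmult_0_l.
by rewrite sumabs_coefE big1 // => i _; rewrite Rabs_R0.
Qed.

Lemma comb_rcons t x : comb t (rcons t x) 1 x.
Proof.
exists [:: x], (fun _ => 1); split; [by rewrite cats1|by move=> _; lra| |].
  by apply: functional_extensionality => k; rewrite lincombE /= big_seq1 /= Rmult_1_l.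
by rewrite sumabs_coefE /= big_seq1 Rabs_R1.
Qed.

Lemma comb_trans t t1 t2 c1 c2 v1 v2 : comb t t1 c1 v1 -> comb t1 t2 c2 v2 -> comb t t2 (c1 + c2) (vadd v1 v2).
Proof.
move=> [z1 [a1 [e1 p1 e2 e3]]] [z2 [a2 [e4 p2 e5 e6]]].
exists (z1 ++ z2), (fun i => if (i < size z1)%N then a1 i else a2 (i - size z1)%N); split.
- by rewrite catA -e1.
- by move=> i; case: ifP.
- rewrite lincomb_cat e2 e5; congr vadd; apply: lincomb_ext => i hi; first by rewrite hi.
  by rewrite ltnNge leq_addr /= addKn.
- rewrite size_cat sumabs_coefD -e3 -e6; congr Rplus; apply: sumabs_coef_ext => i hi; first by rewrite hi.
  by rewrite ltnNge leq_addr /= addKn.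
Qed.

Lemma comb_scal t t' c v u : 0 <= u -> comb t t' c v -> comb t t' (u * c) (vscal u v).
Proof.
move=> u0 [zs [a [e1 p1 e2 e3]]]; exists zs, (fun i => u * a i); split=> //.
- by move=> i; apply: Rmult_le_pos.
- by rewrite lincomb_scal e2.
- rewrite -e3 !sumabs_coefE -rsum_scal; apply: eq_bigr => i _.
  by rewrite Rabs_mult (Rabs_pos_eq u).
Qed.

Lemma comb_lower N K t t' v : l1K_node N K t' -> comb t t' 1 v -> / K <= N v.
Proof.
case=> _ [_ H] hc; have [zs [a [e1 _ e2 e3]]] := comb_trans (comb_zero [::] t) hc.
by rewrite -[v]vadd0v; move: (H a); rewrite e2 [t']e1 /= e3; lra.
Qed.

Lemma support_interval x : c00 x -> x <> vzero -> exists lo hi, [/\ x lo <> 0, x hi <> 0 &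
  forall k, x k <> 0 -> (lo <= k <= hi)%N].
Proof.
move=> [M hM] x0.
pose s := filter (fun k => if Req_EM_T (x k) 0 then false else true) (iota 0 M.+1).
have Hs k : (k \in s) <-> x k <> 0.
  rewrite mem_filter mem_iota; case: Req_EM_T => h /=; first by split.
  split=> // _; rewrite add0n ltnS leqNgt; apply/negP => hk; apply: h; apply: hM; lia.
have ss : sorted ltn s by apply: (sorted_filter ltn_trans); exact: iota_ltn_sorted.
have s0 : s <> [::].
  move=> E; apply: x0; apply: functional_extensionality => k.
  by apply: NNPP => /Hs; rewrite E.
exists (smin s), (smax s); split; [by apply/Hs/smin_in|by apply/Hs/smax_in|].
move=> k /Hs; case: (s) ss => [//|z r] ss; rewrite inE => /predU1P[->|kr] /=.
  rewrite leqnn /=; have /allP h := order_path_min ltn_trans ss.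
  by case/lastP: (r) h => [//|r' w] h; rewrite /smax /= last_rcons ltnW // h // mem_rcons mem_head.
have /allP h := order_path_min ltn_trans ss; rewrite (ltnW (h _ kr)) /=.
have sr := path_sorted ss; case/lastP: r sr kr {ss h} => [//|r w] sr; rewrite /smax /= last_rcons mem_rcons inE.
case/predU1P=> [->//|kr]; move: sr; rewrite (sorted_pairwise ltn_trans) -cats1 pairwise_cat => /andP[/allrelP h _].
by apply/ltnW/h => //; rewrite inE.
Qed.

(** Both the length and the entries of such a sequence are bounded, since every factor is below 1
    and [theta] tends to zero. *)
Lemma reach_finite (theta : nat -> R) (Hth : forall n, 0 < theta n < 1)
    (Hthdec : forall n, theta n.+1 <= theta n) (Hnull : Un_cv theta 0) d : 0 < d ->
  exists L : seq (seq nat), forall l, reach theta d l -> l \in L.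
Proof.
move=> d0; have [D0 HD0] := thprod_size_bound Hth Hthdec d0.
have [n0 Hn0] := null_bound Hth Hnull d0.
have [L HL] := finite_seqs n0.+1 D0; exists ([::] :: L) => l [->|hl]; first exact: mem_head.
rewrite inE HL ?orbT //; last by apply: ltnW; exact: HD0.
elim: l hl => [//|n l IH] /= hl.
have [h0 h1] := Hth n; have h2 := thprod_pos Hth l; have h3 := thprod_le1 Hth l.
apply/andP; split; last by apply: IH; nra.
rewrite ltnS leqNgt; apply/negP => h; have := Hn0 n (ltnW h); nra.
Qed.

(** * Upper bound for the order of a tree *)

Section UpperTree.
Variables (zeta : Ord -> nat -> Ord) (F0 : fam) (beta : nat -> Ord) (theta : nat -> R) (N : vec -> R).
Hypotheses (HF0 : regular F0) (HS0 : contains_S0 F0).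
Hypothesis Hth : forall n, 0 < theta n < 1.
Hypothesis Hthdec : forall n, theta n.+1 <= theta n.
Hypothesis Hnull : Un_cv theta 0.
Hypothesis HN : is_T_norm zeta F0 theta beta N.

Local Notation SL := (SL zeta beta).
Local Notation okws := (okws N).
Local Notation mass := (mass blo bhi).
Local Notation hit := (hit blo bhi).

(** Group the sets into superblocks with minima in [H]. Blocks over these minima contribute at most
    [eps]. For the others the sum times [thprod theta l] is at most 1, so they contribute at most
    [theta n] when [l] is empty and at most [eps] otherwise. *)
Lemma average_small_sum (H : fam) n l Es ws eps : okws ws -> wtotal ws = 1 -> blocks_ok Es ->
  Sch zeta (beta n) (map smin Es) -> comp H (SL l) (map smin Es) ->
  (forall F, sorted ltn F -> H F -> mass ws F <= eps) -> 0 < eps ->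
  l = [::] \/ eps * thprod theta l > theta n ->
  theta n * \rsum_(E <- Es) N (restr E (wsum ws)) <= theta n + 2 * eps.
Proof.
move=> ok tot HB HE HH Hm e0 Hl; have [h0 h1] := Hth n.
have [Ess [EEs B1 B2 B3]] := comp_group HB HH.
pose P (p : R * blk) := hit (map smin (map flatten Ess)) p.2.
have ok1 := okws_filter P ok; have ok2 := okws_filter (predC P) ok.
have hA : theta n * \rsum_(E <- Es) N (restr E (wsum (filter P ws))) <= eps.
  apply: Rle_trans (N_adm HN (okws_c00 ok1) HB HE) _; apply: Rle_trans (N_wsum_le HN ok1) _.
  have -> : wtotal (filter P ws) = mass ws (map smin (map flatten Ess)).
    by rewrite /wtotal big_filter big_mkcond.
  by apply: Hm => //; case: (mins_fs B1).
have hB : thprod theta l * \rsum_(E <- Es) N (restr E (wsum (filter (predC P) ws))) <= 1.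
  apply: (Rle_trans _ (\rsum_(E <- map flatten Ess) N (restr E (wsum (filter (predC P) ws))))); last first.
    rewrite -tot; apply: Rle_trans (wtotal_filter (predC P) ok); apply: (rsum_unhit Hth Hthdec HN) => //.
    by apply: List.Forall_impl (Forall_filter (predC P) ok) => p [].
  rewrite EEs rsum_flatten big_map -rsum_scal; apply: rsum_le; apply: Forall_mem => G /B3 [BG SG].
  apply: Rle_trans (N_SL Hth Hthdec HN (c00_restr (flatten G) (okws_c00 ok2)) BG SG).
  apply: Rmult_le_compat_l; first exact/Rlt_le/thprod_pos.
  apply: rsum_le; apply: Forall_mem => E EG; rewrite restr_sub; first exact: Rle_refl.
  by move=> k kE; apply/flattenP; exists E.
have hC : theta n * \rsum_(E <- Es) N (restr E (wsum (filter (predC P) ws))) <= theta n + eps.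
  set S := \rsum_(E <- Es) _ in hB *.
  have S0 : 0 <= S := rsum_N_ge0 HN _ (okws_c00 ok2).
  case: Hl => [l0|hl]; first by rewrite l0 /= in hB; nra.
  have := thprod_pos Hth l; nra.
have : \rsum_(E <- Es) N (restr E (wsum ws)) <= \rsum_(E <- Es) N (restr E (wsum (filter P ws))) +
    \rsum_(E <- Es) N (restr E (wsum (filter (predC P) ws))).
  rewrite -rsumD; apply: rsum_le; apply: Forall_all => E; rewrite {1}(wsum_filter P ws) restr_add.
  by apply: (N_add HN); apply: c00_restr; [exact: okws_c00 ok1|exact: okws_c00 ok2].
move/(Rmult_le_compat_l _ _ _ (Rlt_le _ _ h0)); lra.
Qed.

(** A crude bound through the coordinates, each at most 1 in modulus; it serves when [theta n] is
    negligible against the position of the block. *)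
Lemma rsum_N_le_top y Es : okblk N y -> blocks_ok Es -> \rsum_(E <- Es) N (restr E y.1) <= INR (bhi y).
Proof.
case=> h1 h2 h3 h4 HB; have [fsE _] := proj1 (blocks_fs _) HB.
apply: (Rle_trans _ (\rsum_(k <- flatten Es) Rabs (y.1 k))).
  rewrite rsum_flatten; apply: rsum_le; apply: Forall_mem => E EE.
  by apply: (N_l1 HF0 HS0 Hth Hthdec HN) => //; case: (blocks_in_fs HB EE).
have -> : \rsum_(k <- flatten Es) Rabs (y.1 k) = \rsum_(k <- filter (fun k => (0 < k <= bhi y)%N) (flatten Es)) Rabs (y.1 k).
  rewrite big_filter [RHS]big_mkcond /=; apply: eq_bigr => k _; case: ifP => // hk.
  case: (Req_EM_T (y.1 k) 0) => [->|/h3 h]; first exact: Rabs_R0.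
  by move: hk; lia.
apply: (Rle_trans _ (\rsum_(k <- filter (fun k => (0 < k <= bhi y)%N) (flatten Es)) 1)).
  apply: rsum_le; apply: Forall_mem => k; rewrite mem_filter => /andP[/andP[k0 _] _].
  exact: Rle_trans (N_coord HS0 HN h1 k0) h2.
rewrite rsum_const Rmult_1_r; apply: le_INR; apply/leP.
rewrite -[X in (_ <= X)%N](size_iota 1 (bhi y)); apply: uniq_leq_size.
  by apply: filter_uniq; case: fsE => h _; exact: (sorted_uniq ltn_trans ltnn).
by move=> k; rewrite mem_filter mem_iota => /andP[]; lia.
Qed.

Variables (K : R) (T : tree).
Hypotheses (K1 : 1 <= K) (HT : l1K_tree N K T).

Let St := (seq vec * nat)%type.
Let top (s : St) := s.2.

(** The state records a coordinate where the last vector does not vanish: the block condition then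
    forces later vectors to live beyond it. *)
Definition node_rank e (s : St) := iter_tderiv T e s.1 /\ last vzero s.1 s.2 <> 0.
Definition node_step (s : St) (y : blk) (s' : St) :=
  [/\ comb s.1 s'.1 1 y.1, okblk N y, (s.2 < blo y <= bhi y)%N & (bhi y <= s'.2)%N].

Lemma node_step_top s y s' : node_step s y s' -> (top s < blo y <= bhi y)%N /\ (bhi y <= top s')%N.
Proof. by case. Qed.

Lemma node_rank_le e e' s : node_rank e s -> ole e' e -> node_rank e' s.
Proof. by case=> h1 h2 h; split=> //; exact: iter_tderiv_le h h1. Qed.

Lemma node_vec t x : T (rcons t x) -> [/\ c00 x, N x = 1 & x <> vzero].
Proof.
move=> /(proj1 HT) [_ [h1 _]]; have := h1 (size t); rewrite size_rcons ltnS leqnn nth_rcons ltnn eqxx.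
by case=> // hx Nx; split=> // x0; move: Nx; rewrite x0 (N_zero HN); lra.
Qed.

Lemma node_top t : T t -> exists p, last vzero t p <> 0.
Proof.
move=> Ht; have [t0 _] := proj1 HT _ Ht; case/lastP: t Ht t0 => [//|t x] Ht _.
have [hx _ x0] := node_vec Ht; have [lo [hi [h _ _]]] := support_interval hx x0.
by exists lo; rewrite last_rcons.
Qed.

Lemma node_rank_step e e' s : node_rank e s -> olt e' e -> exists y s', node_step s y s' /\ node_rank e' s'.
Proof.
case: s => t p [/= h1 h2] /(iter_tderiv_step h1) [t' [h3 h4 h5]].
case/lastP: t' h3 h4 h5 => [//|t' x] h3; rewrite size_rcons ltnS => h4 h5.
have Tx := iter_tderiv_in h3.
have [hx Nx x0] := node_vec Tx; have [lo [hi [l1 l2 l3]]] := support_interval hx x0.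
have Tt := iter_tderiv_in h1; have t0 : t <> [::] by case: (proj1 HT _ Tt).
have plo : (p < lo)%N.
  have [_ [_ [H _]]] := proj1 HT _ Tx; apply: (H (size t).-1 (size t')).
  - by rewrite size_rcons; case: (t) t0 h4 => //= *; lia.
  - rewrite -(@nth_take (size t)); last by case: (t) t0.
    by rewrite h5 nth_last.
  - by rewrite nth_rcons ltnn eqxx.
have lohi : (lo <= hi)%N by case/andP: (l3 _ l1).
exists (x, (lo, hi)), (rcons t' x, hi); split; split=> //=.
(* A derivation may skip several nodes; the skipped vectors enter with coefficient zero and only the
   last one is used. *)
- have -> : rcons t' x = rcons (t ++ drop (size t) t') x.
    have E : take (size t) t' = t by rewrite -[RHS]h5 -cats1 takel_cat.
    by rewrite -{1}(cat_take_drop (size t) t') E.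
  have := comb_trans (comb_zero t (drop (size t) t')) (comb_rcons (t ++ drop (size t) t') x).
  by rewrite Rplus_0_l vadd0v.
- by split=> //=; [lra|rewrite /blo /bhi /=; lia].
- by rewrite /blo /bhi /=; lia.
- by rewrite last_rcons.
Qed.

Lemma chain_okws (S : Type) (stp : S -> blk -> S -> Prop) : (forall s y s', stp s y s' -> okblk N y) ->
  forall s ws s', chain stp s ws s' -> wnonneg ws -> okws ws.
Proof.
move=> H s ws; elim: ws s => [|p ws IH] s s' /=; first by constructor.
case=> s1 [h1 h2] nn; inversion nn; constructor; last exact: IH h2 _.
by split=> //; exact: H h1.
Qed.

Lemma chain_comb (stp : St -> blk -> St -> Prop) : (forall s y s', stp s y s' -> comb s.1 s'.1 1 y.1) ->
  forall s ws s', chain stp s ws s' -> wnonneg ws -> comb s.1 s'.1 (wtotal ws) (wsum ws).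
Proof.
move=> H s ws; elim: ws s => [|p ws IH] s s' /=.
  move=> -> _; rewrite wsum_nil /wtotal big_nil; have := comb_zero s'.1 [::]; by rewrite cats0.
case=> s1 [h1 h2] nn; inversion nn; rewrite wsum_cons /wtotal big_cons.
apply: comb_trans (IH _ _ h2 _) => //; rewrite -[X in comb _ _ X]Rmult_1_r.
by apply: comb_scal => //; exact: H h1.
Qed.

Variables (a : Ord) (eps : R).
Hypothesis eps0 : 0 < eps.
Hypothesis Hcover : forall n, exists Hl : fam * seq nat, [/\ rklt (wexp a) Hl.1,
  Hl.2 = [::] \/ eps * thprod theta Hl.2 > theta n &
  forall F, Sch zeta (beta n) F -> comp Hl.1 (SL Hl.2) F].

Definition tame n (y : blk) := forall Es, blocks_ok Es -> Sch zeta (beta n) (map smin Es) ->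
  theta n * \rsum_(E <- Es) N (restr E y.1) <= theta n + 2 * eps.

(** One move of the second game is an average of nodes. It is required to be tame only for indices
    with [theta n] large against its position, which are finitely many. *)
Definition avg_step (s : St) (y : blk) (s' : St) :=
  node_step s y s' /\ forall n, theta n * INR (blo y) > eps -> tame n y.

Definition avg_rank e (s : St) := node_rank (omul (wexp a) e) s.

Lemma avg_step_top s y s' : avg_step s y s' -> (top s < blo y <= bhi y)%N /\ (bhi y <= top s')%N.
Proof. by case=> /node_step_top. Qed.

Lemma avg_rank_le e e' s : avg_rank e s -> ole e' e -> avg_rank e' s.
Proof. by move=> h1 h2; apply: node_rank_le h1 _; exact: omul_mono_r. Qed.

Lemma avg_rank_step e e' s : avg_rank e s -> olt e' e -> exists y s', avg_step s y s' /\ avg_rank e' s'.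
Proof.
move=> h /(omul_mono_r (wexp a)) /(node_rank_le h) {}h.
have [HH HHP] := @choice_on _ _ (fun _ : nat => True) (fun n (Hl : fam * seq nat) => [/\ rklt (wexp a) Hl.1,
  Hl.2 = [::] \/ eps * thprod theta Hl.2 > theta n & forall F, Sch zeta (beta n) F -> comp Hl.1 (SL Hl.2) F])
  ((fun _ => True), [::]) (fun n _ => Hcover n).
pose lo := (top s).+1; have lo0 : 0 < INR lo by apply: lt_0_INR; lia.
(* Beyond [n1] the product of [theta n] with [lo] is at most [eps], so only finitely many families
   have to be avoided and their union still has rank below w^a. *)
have [n1 Hn1] := null_bound Hth Hnull (Rdiv_lt_0_compat _ _ eps0 lo0).
have HG : rklt (wexp a) (fun F => exists2 n, n \in iota 0 n1 & (HH n).1 F).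
  apply: rklt_bigcup => // n _; by have [] := HHP n I.
have [ws [s' [c1 c2 c3 c4]]] := averages node_step_top node_rank_le node_rank_step HG eps0 h.
have ok : okws ws by apply: (chain_okws _ c1) => [? ? ? []|] //; case: c3.
have [tops rng] := chain_range node_step_top c1.
have tops' : (top s < top s')%N.
  case: (ws) c3 rng => [[_]|p ws' _ rng]; first by rewrite /wtotal big_nil; lra.
  by inversion rng; lia.
exists (wsum ws, (lo, top s')), s'; split; last exact: c2.
split.
  split.
  - have := chain_comb _ c1 (proj1 c3); rewrite (proj2 c3); apply; by move=> ? ? ? [].
  - split=> //=.
    + exact: okws_c00 ok.
    + by have := N_wsum_le HN ok; rewrite (proj2 c3).
    + move=> k; rewrite /blo /bhi /=; case: (boolP (lo <= k <= top s')%N) => // hk; case.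
      rewrite /wsum; elim: rng ok {c1 c2 c3 c4} => [|p {}ws hp _ IH] ok; first by rewrite big_nil.
      rewrite big_cons IH; last by inversion ok.
      have [_ [_ _ h3 _]] : 0 <= p.1 /\ okblk N p.2 by inversion ok.
      case: (Req_EM_T (p.2.1 k) 0) => [->|/h3]; first by lra.
      by move: hk; rewrite /lo; lia.
  - by rewrite /blo /bhi /= /lo leqnn.
  - by [].
move=> n hn Es HB HE.
have [_ Hl HC] := HHP n I.
apply: (average_small_sum (H := (HH n).1) (l := (HH n).2)) => //; first by case: c3.
  exact: HC.
move=> F hF HF; apply: c4 => //; exists n => //; rewrite mem_iota /= add0n ltnNge; apply/negP => /Hn1 hn'.
have := Rmult_le_compat_r _ _ _ (Rlt_le _ _ lo0) hn'; rewrite /Rdiv Rmult_assoc Rinv_l; last by lra.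
by move: hn; rewrite /blo /=; lra.
Qed.

Lemma chain_tame_after n s ws s' : chain avg_step s ws s' -> theta n * INR (top s) > eps ->
  List.Forall (fun p : R * blk => tame n p.2) ws.
Proof.
elim: ws s => [|p ws IH] s /=; first by constructor.
case=> s1 [h1 h2] hn; have [[_ _ r1 r2] hp] := h1.
have up m : (top s <= m)%N -> theta n * INR m > eps.
  move=> hm; have := le_INR _ _ (elimT leP hm); have := Hth n => -[t0 _].
  by move/(Rmult_le_compat_l _ _ _ (Rlt_le _ _ t0)); lra.
constructor; first by apply/hp/up; rewrite /top; lia.
by apply: IH h2 _; apply: up; rewrite /top; lia.
Qed.

(* Before a threshold [theta n] is negligible against the length of the averages, after it the
   averages were chosen to be tame for [n]; at most one of them lies across the threshold. *)
Lemma chain_tame n s ws s' : chain avg_step s ws s' -> wnonneg ws ->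
  exists bd, List.Forall (fun p : R * blk => p.2.2 <> bd -> tame n p.2) ws.
Proof.
have t0 := Hth n; elim: ws s => [|p ws IH] s /=; first by exists (0%N, 0%N).
case=> s1 [h1 h2] nn; have nn' : wnonneg ws by inversion nn.
case: (classic (tame n p.2)) => [ht|ht].
  by have [bd hbd] := IH _ h2 nn'; exists bd; constructor.
exists p.2.2; constructor=> //.
have hhi : theta n * INR (bhi p.2) > eps.
  apply: Rnot_le_gt => hle; apply: ht => Es HB HE.
  have [[_ okp _ _] _] := h1.
  have := Rmult_le_compat_l _ _ _ (Rlt_le _ _ (proj1 t0)) (rsum_N_le_top okp HB); lra.
have aft : List.Forall (fun q : R * blk => tame n q.2) ws.
  apply: (chain_tame_after h2).
  have [[_ _ _ hp] _] := h1; have := le_INR _ _ (elimT leP hp).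
  by move/(Rmult_le_compat_l _ _ _ (Rlt_le _ _ (proj1 t0))); rewrite /top; lra.
exact: List.Forall_impl aft.
Qed.

Lemma SL_fs l F : SL l F -> fs F.
Proof. by case: l => [|n l]; [exact: Sch_fs|exact: comp_fs]. Qed.

(** A branch of averages of averages yields a combination with coefficient sum 1 and norm at most 3
    eps + eps, whereas the tree forces at least 1/K = 8 eps. *)
Theorem tree_upper_bound b : (forall l, rklt (wexp b) (SL l)) -> (forall l, rklt (wexp b) (comp (SL l) F0)) ->
  eps = / (8 * K) -> forall t, ~ iter_tderiv T (omul (wexp a) (wexp b)) t.
Proof.
move=> HSL HSLF Eeps t Ht.
have [p hp] := node_top (iter_tderiv_in Ht).
have [C [C0 HC]] := norm_upper_bound HF0 HS0 Hth Hthdec Hnull HN eps0.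
have [L HL] := reach_finite Hth Hthdec Hnull eps0.
have b0 : olt OZ (wexp b) by exact: wexp_pos.
have HG : rklt (wexp b) (fun F => exists2 l, l \in L & SL l F \/ comp (SL l) F0 F).
  by apply: rklt_bigcup => // l _; exact: rklt_union.
(* Chosen so that C d' <= 1 / (8 K) = eps; the 1 added to [C] keeps the denominator positive. *)
pose d' := / (8 * K * (C + 1)).
have d'0 : 0 < d' by apply: Rinv_0_lt_compat; apply: Rmult_lt_0_compat; lra.
have Hs : avg_rank (oadd OZ (wexp b)) (t, p) by rewrite add0o; split.
have [ws [s' [c1 c2 c3 c4]]] := averages avg_step_top avg_rank_le avg_rank_step HG d'0 Hs.
have ok : okws ws by apply: (chain_okws _ c1) => [? ? ? [[]]|] //; case: c3.
have [bad Hbad] := @choice_on _ _ (fun _ : nat => True) (fun n bd =>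
   List.Forall (fun p : R * blk => p.2.2 <> bd -> tame n p.2) ws) (0%N, 0%N) (fun n _ => chain_tame n c1 (proj1 c3)).
have small : small_on zeta F0 beta theta N eps d' (3 * eps) bad ws.
  split=> //.
  - by move=> l F hl HF; apply: c4; [case: (SL_fs HF)|exists l; [exact: HL|left]].
  - by move=> l F hl HF; apply: c4; [case: (comp_fs HF)|exists l; [exact: HL|right]].
  - move=> n l Es hl hn HB HE; apply: List.Forall_impl (Hbad n I) => q hq /hq {}hq.
    have := hq Es HB HE; have h0 := thprod_pos Hth l; have h1 := thprod_le1 Hth l.
    have h2 := Rmult_le_compat_r _ _ _ (Rlt_le _ _ eps0) h1.
    move/(Rmult_le_compat_l _ _ _ (Rlt_le _ _ h0)) => h3; rewrite Rmult_assoc.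
    by apply: Rle_trans h3 _; rewrite Rmult_plus_distr_l; lra.
have up := HC d' (3 * eps) bad ws (Rlt_le _ _ d'0) ltac:(lra) small.
rewrite (proj2 c3) in up.
have cmb : comb t s'.1 1 (wsum ws).
  by rewrite -(proj2 c3); apply: (chain_comb _ c1 (proj1 c3)) => ? ? ? [[]].
have Ts : T s'.1 by case: c2 => /iter_tderiv_in.
have low := comb_lower (proj2 (proj1 HT _ Ts)) cmb.
have EK : / K = 8 * eps by rewrite Eeps; field; lra.
have Ed : C * d' <= eps.
  rewrite Eeps /d'; have -> : C * / (8 * K * (C + 1)) = / (8 * K) * (C / (C + 1)) by field; lra.
  rewrite -[X in _ <= X]Rmult_1_r; apply: Rmult_le_compat_l; first by rewrite -Eeps; lra.
  by apply: (Rmult_le_reg_r (C + 1)); first lra; rewrite /Rdiv Rmult_assoc Rinv_l; lra.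
lra.
Qed.

End UpperTree.

(** * Construction of trees of large order *)

(** [P] certifies ranks. The auxiliary induction compares an arbitrary index with the certified
    ordinal, since a supremum only provides inequalities. *)
Lemma iter_tderiv_intro T (P : Ord -> seq vec -> Prop) :
  (forall e t, P e t -> T t) ->
  (forall e e' t, P e t -> olt e' e -> exists t', [/\ P e' t', (size t < size t')%N & take (size t) t' = t]) ->
  forall e t, P e t -> iter_tderiv T e t.
Proof.
move=> H1 H2 e t HP; suff H e1 : forall e0 t0, ole e1 e0 -> P e0 t0 -> iter_tderiv T e1 t0 by exact: H HP.
elim: e1 => [|e1 IH|f IH] e0 t0 he h /=; first exact: H1 h.
- split; first by apply: IH h; exact: olt_ole he.
  by have [t' [h1 h2 h3]] := H2 _ _ _ h he; exists t'; split=> //; exact: IH h1.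
- by move=> n; apply: IH h; exact: he.
Qed.

Definition insupp (xs : seq vec) q := exists2 i, (i < size xs)%N & nth vzero xs i q <> 0.

Lemma insupp_cat xs ys q : insupp (xs ++ ys) q <-> insupp xs q \/ insupp ys q.
Proof.
split.
- case=> i; rewrite size_cat nth_cat; case: ifP => hi h1 h2; first by left; exists i.
  by right; exists (i - size xs)%N => //; lia.
- case=> -[i h1 h2]; first by exists i; [rewrite size_cat; lia|rewrite nth_cat h1].
  by exists (size xs + i)%N; [rewrite size_cat; lia|rewrite nth_cat ltnNge leq_addr /= addKn].
Qed.

Lemma insupp_nil q : ~ insupp [::] q. Proof. by case. Qed.

Lemma insupp_seq1 x q : insupp [:: x] q <-> x q <> 0.
Proof. by split=> [[[|i] //]|h]; exists 0%N. Qed.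

Lemma lincomb_supp a xs q : lincomb a xs q <> 0 -> insupp xs q.
Proof.
move=> h; apply: NNPP => H; apply: h; rewrite lincombE big_seq_cond big1 // => i /andP[].
rewrite mem_iota /= add0n => hi _; case: (Req_EM_T (nth vzero xs i q) 0) => [->|h]; first by lra.
by case: H; exists i.
Qed.

Lemma insupp_bound xs : (forall i, (i < size xs)%N -> c00 (nth vzero xs i)) ->
  exists M, forall q, insupp xs q -> (q < M)%N.
Proof.
elim/last_ind: xs => [|xs x IH] H; first by exists 0%N => q /insupp_nil.
have [|M hM] := IH.
  by move=> i hi; have := H i; rewrite size_rcons nth_rcons hi; apply; lia.
have := H (size xs); rewrite size_rcons nth_rcons ltnn eqxx => /(_ (ltnSn _)) [M' hM'].
exists (maxn M M'.+1) => q; rewrite -cats1 insupp_cat insupp_seq1 => -[/hM|h]; first by lia.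
by rewrite leq_max ltnS leqNgt; apply/orP; right; apply/negP => hq; apply: h; apply: hM'; lia.
Qed.

Definition normalized_blocks (N : vec -> R) xs :=
  (forall i, (i < size xs)%N -> c00 (nth vzero xs i) /\ N (nth vzero xs i) = 1) /\
  (forall i j p q, (i < j < size xs)%N -> nth vzero xs i p <> 0 -> nth vzero xs j q <> 0 -> (p < q)%N).

Lemma normalized_cat N xs ys : normalized_blocks N xs -> normalized_blocks N ys ->
  (forall p q, insupp xs p -> insupp ys q -> (p < q)%N) -> normalized_blocks N (xs ++ ys).
Proof.
move=> [h1 h2] [h3 h4] H; split.
  move=> i; rewrite size_cat nth_cat; case: ifP => hi hs; first exact: h1.
  by apply: h3; lia.
move=> i j p q; rewrite size_cat !nth_cat; case: (ltnP j (size xs)) => hj hs.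
  rewrite ifT; last by lia.
  by apply: h2; lia.
case: (ltnP i (size xs)) => hi; last by apply: h4; lia.
by move=> hp hq; apply: H; [exists i|exists (j - size xs)%N => //; lia].
Qed.

Lemma l1K_tree_nodes N K : l1K_tree N K (fun t => t <> [::] /\ l1K_node N K t).
Proof.
split=> // t [t0 [h1 [h2 h3]]] m /andP[m0 mt].
have szt : size (take m t) = m by rewrite size_takel.
split; first by move=> E; move: szt; rewrite E /=; lia.
split; [|split].
- by move=> i; rewrite szt => hi; rewrite nth_take //; apply: h1; lia.
- by move=> i j p q; rewrite szt => hij; rewrite !nth_take; try lia; apply: h2; lia.
- move=> a; pose a' i := if (i < m)%N then a i else 0.
  have := h3 a'; rewrite -{1 2}(cat_take_drop m t) lincomb_cat size_cat sumabs_coefD szt.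
  have -> : lincomb (fun i => a' (m + i)%N) (drop m t) = vzero.
    apply: functional_extensionality => k; rewrite lincombE big1 // => i _.
    by rewrite /a' ltnNge leq_addr /= Rmult_0_l.
  have -> : sumabs_coef (fun i => a' (m + i)%N) (size (drop m t)) = 0.
    by rewrite sumabs_coefE big1 // => i _; rewrite /a' ltnNge leq_addr /= Rabs_R0.
  have -> : lincomb a' (take m t) = lincomb a (take m t).
    by apply: lincomb_ext => i; rewrite szt /a' => ->.
  have -> : sumabs_coef a' m = sumabs_coef a m by apply: sumabs_coef_ext => i; rewrite /a' => ->.
  by rewrite vaddv0 Rplus_0_r.
Qed.

(** * Inner trees placed on a Schreier set *)

Section LowerTree.
Variables (zeta : Ord -> nat -> Ord) (F0 : fam) (beta : nat -> Ord) (theta : nat -> R) (N : vec -> R).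
Hypothesis Hzeta : fund_seqs zeta.
Hypotheses (HF0 : regular F0) (HS0 : contains_S0 F0).
Hypothesis Hth : forall n, 0 < theta n < 1.
Hypothesis Hthdec : forall n, theta n.+1 <= theta n.
Hypothesis Hnull : Un_cv theta 0.
Hypothesis HN : is_T_norm zeta F0 theta beta N.

Lemma node_normalized K xs : l1K_node N K xs -> normalized_blocks N xs.
Proof. by case=> h1 [h2 _]; split. Qed.

(** A pair (k, xs) is an element [k] of the Schreier set with the inner sequence placed at or beyond
    [k] and before the next element. *)
Definition groups := seq (nat * seq vec).
Definition vectors (L : groups) := flatten (map snd L).
Definition starts (L : groups) := map fst L.

Fixpoint okgroups K (L : groups) : Prop :=
  match L with
  | [::] => True
  | (k, xs) :: L' => [/\ l1K_node N K xs, forall q, insupp xs q -> (k <= q)%N,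
      forall q k', insupp xs q -> k' \in starts L' -> (q < k')%N & okgroups K L']
  end.

Lemma okgroups_rcons K L k xs : okgroups K L -> (forall q, insupp (vectors L) q -> (q < k)%N) ->
  l1K_node N K xs -> (forall q, insupp xs q -> (k <= q)%N) -> okgroups K (rcons L (k, xs)).
Proof.
move=> + + Hx Hk; elim: L => [|[k1 xs1] L IH] /=; first by split.
case=> h1 h2 h3 h4 H; split=> //.
- move=> q k' hq; rewrite /starts map_rcons mem_rcons inE => /predU1P[->|]; last exact: h3.
  by apply: H; apply/insupp_cat; left.
- by apply: IH => // q hq; apply: H; apply/insupp_cat; right.
Qed.

Lemma okgroups_replace K L k xs xs' : okgroups K (rcons L (k, xs)) ->
  l1K_node N K xs' -> (forall q, insupp xs' q -> (k <= q)%N) -> okgroups K (rcons L (k, xs')).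
Proof.
move=> + Hx Hk; elim: L => [|[k1 xs1] L IH] /=; first by split.
case=> h1 h2 h3 h4; split=> //; last exact: IH.
by move=> q k'; rewrite /starts !map_rcons => h5 h6; apply: h3 h5 _; rewrite /starts map_rcons.
Qed.

Lemma okgroups_start K L q : okgroups K L -> fs (starts L) -> insupp (vectors L) q ->
  exists2 k, k \in starts L & (k <= q)%N.
Proof.
elim: L => [|[k xs] L IH] /=; first by move=> _ _ /insupp_nil.
case=> _ h2 _ h4 /fs_cons[_ h5 _]; rewrite /vectors /= => /insupp_cat[/h2 h|h].
  by exists k => //; exact: mem_head.
by have [k' h6 h7] := IH h4 h5 h; exists k' => //; rewrite inE h6 orbT.
Qed.

Lemma okgroups_normalized K L : okgroups K L -> fs (starts L) -> normalized_blocks N (vectors L).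
Proof.
elim: L => [|[k xs] L IH] /=.
  by move=> _ _; split=> [i|i j p q] //=; rewrite ltn0 andbF.
case=> h1 h2 h3 h4 /fs_cons[k0 h5 h6]; apply: normalized_cat; [exact: node_normalized h1|exact: IH|].
move=> p q /h3 hp /(okgroups_start h4 h5) [k' /hp h7]; exact: leq_trans.
Qed.

(** Intervals from one start to the next, the last one ending before [M]: each isolates one group,
    and their minima are the starts. *)
Fixpoint spans (L : groups) M : seq (seq nat) :=
  match L with
  | [::] => [::]
  | (k, _) :: L' => iota k (head M (starts L') - k) :: spans L' M
  end.

Lemma spansP L M : fs (rcons (starts L) M) -> blocks_ok (spans L M) /\ map smin (spans L M) = starts L.
Proof.
elim: L => [|[k xs] L IH] //= /fs_cons[k0 h1 h2].
have [h3 h4] := IH h1.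
have kM : (k < head M (starts L))%N.
  by apply: h2; case: (starts L) => [|k' s] /=; rewrite mem_head.
have Ei : iota k (head M (starts L) - k) = k :: iota k.+1 (head M (starts L) - k).-1.
  by case E: (head M (starts L) - k)%N => [|j] //; lia.
split; last by rewrite h4 Ei.
apply/blocks_cons; split=> //.
- split; first exact: iota_ltn_sorted.
  by apply/allP => x; rewrite mem_iota; lia.
- by rewrite Ei.
- move=> E HE; have : smin E \in starts L by rewrite -h4; exact: map_f.
  have : smax (iota k (head M (starts L) - k)) \in iota k (head M (starts L) - k).
    by apply: smax_in; rewrite Ei.
  rewrite mem_iota /setlt subnKC; last exact: ltnW.
  move: (smax _) => mx /andP[_ hmx].
  case: (starts L) h1 hmx => [//|k' s] /= /fs_cons[_ _ h5] hmx; rewrite inE => /predU1P[->//|hs].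
  by have := h5 (smin E); rewrite mem_rcons inE hs orbT => /(_ isT); exact: ltn_trans.
Qed.

Lemma spans_sum K L M a : 1 <= K -> okgroups K L -> fs (rcons (starts L) M) ->
  (forall q, insupp (vectors L) q -> (q < M)%N) ->
  / K * sumabs_coef a (size (vectors L)) <= \rsum_(E <- spans L M) N (restr E (lincomb a (vectors L))).
Proof.
move=> K1; elim: L a => [|[k xs] L IH] a.
  by rewrite big_nil sumabs_coefE /= big_nil; lra.
move=> hok hfs hM; have := hok => -[h1 h2 h3 h4].
have := hfs; rewrite [starts _]/= rcons_cons => /fs_cons[k0 h5 h6].
rewrite /vectors [flatten _]/= -/(vectors L) size_cat sumabs_coefD lincomb_cat big_cons.
set u := lincomb a xs; set a' := fun i => a _; set v := lincomb a' _.
have hM' q : insupp (vectors L) q -> (q < M)%N by move=> hq; apply: hM; apply/insupp_cat; right.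
have fsL : fs (starts L) by apply: fs_subseq h5 _; rewrite -cats1; exact: prefix_subseq.
have hvs q : insupp (vectors L) q -> (head M (starts L) <= q)%N.
  move=> /(okgroups_start h4 fsL) [k' hk' h]; apply: leq_trans h; case: (starts L) fsL hk' => [//|k1 s] f hs.
  exact: fs_smin f hs.
have hus q : insupp xs q -> (k <= q < head M (starts L))%N.
  move=> hq; rewrite h2 //=; case E: (starts L) => [|k1 s] /=.
    by apply: hM; apply/insupp_cat; left.
  by apply: h3 hq _; rewrite E mem_head.
have kM : (k < head M (starts L))%N.
  by apply: h6; case: (starts L) => [|k' s] /=; rewrite mem_head.
have -> : restr (iota k (head M (starts L) - k)) (vadd u v) = u.
  apply: functional_extensionality => q; rewrite /restr mem_iota subnKC; last exact: ltnW.
  rewrite /vadd; case: ifP => hq.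
    case: (Req_EM_T (v q) 0) => [->|/lincomb_supp/hvs]; [by lra|by lia].
  by case: (Req_EM_T (u q) 0) => [->//|/lincomb_supp/hus]; rewrite hq.
have -> : \rsum_(E <- spans L M) N (restr E (vadd u v)) = \rsum_(E <- spans L M) N (restr E v).
  apply: rsum_eq; apply: Forall_mem => E HE; congr N; rewrite restr_add.
  have [B EB] := spansP h5.
  have -> : restr E u = vzero.
    apply: restr0 => q qE; case: (Req_EM_T (u q) 0) => // /lincomb_supp/hus /andP[_ hq].
    have h7 := fs_smin (blocks_in_fs B HE) qE.
    have : smin E \in starts L by rewrite -EB; exact: map_f.
    case: (starts L) fsL hq => [//|k1 s] f /= hq /(fs_smin f) /=; lia.
  exact: vadd0v.
have := IH a' h4 h5 hM'; have := proj2 (proj2 h1) a; rewrite -/u -/v; lra.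
Qed.

(** The spans are admissible, so the norm is at least [theta n] times the sum of the norms of the
    groups; this divides the lower constant by [K / theta n] in total. *)
Lemma okgroups_node K n L : 1 <= K -> okgroups K L -> Sch zeta (beta n) (starts L) ->
  l1K_node N (K / theta n) (vectors L).
Proof.
move=> K1 hok HS; have fsL := Sch_fs HS.
have [h1 h2] := okgroups_normalized hok fsL.
split=> //; split=> // a.
have [M0 hM0] := insupp_bound (fun i hi => proj1 (h1 i hi)).
pose M := maxn M0 (smax (starts L)).+1.
have fsM : fs (rcons (starts L) M) by apply: fs_rcons => //; rewrite /M; lia.
have hM q : insupp (vectors L) q -> (q < M)%N by move/hM0; rewrite /M; lia.
have [B EB] := spansP fsM.
have cx : c00 (lincomb a (vectors L)) by apply: c00_lincomb => i /h1[].
have := N_adm HN cx B; rewrite EB => /(_ n HS) hN.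
have := spans_sum a K1 hok fsM hM; have [t0 t1] := Hth n.
move/(Rmult_le_compat_l _ _ _ (Rlt_le _ _ t0)).
have -> : / (K / theta n) = theta n * / K by field; lra.
by lra.
Qed.

(** The certificate [I] may depend on [e] and on the position [p], but [K] may not; inner trees of
    different orders can come from different indices m. *)
Definition has_inner rho K := forall e p, olt e rho -> exists (I : Ord -> seq vec -> Prop) x, I e [:: x] /\
  forall e xs, I e xs -> [/\ l1K_node N K xs, forall q, insupp xs q -> (p <= q)%N &
    forall e', olt e' e -> exists x, I e' (rcons xs x)].

(** The rank is at most rho e1 + e2, with [e1] left in the Schreier set and [e2] in the current
    inner tree. A smaller ordinal is reached by extending the current group, or, once it is below
    rho e1, by opening a new one. *)
Theorem tree_lower_bound rho K n g : 1 <= K -> olt OZ rho -> has_inner rho K ->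
  olt g (omul rho (wexp (beta n))) ->
  exists T, l1K_tree N (K / theta n) T /\ exists t, iter_tderiv T g t.
Proof.
move=> K1 rho0 Hin Hg; exists (fun t => t <> [::] /\ l1K_node N (K / theta n) t).
split; first exact: l1K_tree_nodes.
pose P e t := exists e1 e2 L k xs (I : Ord -> seq vec -> Prop),
  [/\ ole e (oadd (omul rho e1) e2), t = vectors (rcons L (k, xs)),
      lr (Sch zeta (beta n)) e1 (starts (rcons L (k, xs))) & okgroups K (rcons L (k, xs))] /\
  [/\ I e2 xs, xs <> [::] &
  forall e xs, I e xs -> [/\ l1K_node N K xs, forall q, insupp xs q -> (k <= q)%N &
    forall e', olt e' e -> exists x, I e' (rcons xs x)]].
have Evec L k xs : vectors (rcons L (k, xs)) = vectors L ++ xs.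
  by rewrite /vectors map_rcons flatten_rcons.
(* Opening a group: the next element of the Schreier set is taken beyond all supports so far, and
   the inner tree is started there. *)
have new e e1 L : okgroups K L -> lr (Sch zeta (beta n)) e1 (starts L) -> olt e (omul rho e1) ->
    exists x, P e (vectors L ++ [:: x]).
  move=> hok hlr /olt_mul_split [e1' [h1 h2]].
  have [e2 [h3 h4]] : exists e2, olt e2 rho /\ ole e (oadd (omul rho e1') e2).
    by case: (olt_add_split h2) => [/olt_ole h|//]; exists OZ.
  have fsL := Sch_fs (lr_in hlr).
  have [h5 _] := okgroups_normalized hok fsL.
  have [M hM] := insupp_bound (fun i hi => proj1 (h5 i hi)).
  have [k [Mk hk]] := lr_inv M hlr h1.
  have [I [x [Ix HI]]] := Hin e2 k h3.
  have [nx kx _] := HI _ _ Ix.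
  exists x; exists e1', e2, L, k, [:: x], I; split; split=> //.
  - by rewrite /starts map_rcons.
  - by apply: okgroups_rcons => // q /hM; lia.
have [x Px] : exists x, P g [:: x] by apply: (new g (wexp (beta n)) [::]) => //; exact: lr_Sch.
exists [:: x]; apply: (iter_tderiv_intro (P := P)) Px => [e t|e e' t].
  case=> e1 [e2 [L [k [xs [I [[h1 -> h2 h3] [h4 h5 _]]]]]]]; split.
    by rewrite Evec; case: (vectors L) => //; case: (xs) h5.
  by apply: okgroups_node => //; exact: lr_in h2.
case=> e1 [e2 [L [k [xs [I [[h1 -> h2 h3] [h4 h5 h6]]]]]]] he.
case: (olt_add_split (olt_ole_trans he h1)) => [he'|[e2' [h7 h8]]].
  have [y Py] := new e' e1 _ h3 h2 he'; eexists; split; first exact: Py.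
    by rewrite size_cat /= addn1.
  by rewrite take_size_cat.
have [_ _ h9] := h6 _ _ h4; have [y Iy] := h9 _ h7; have [n1 n2 _] := h6 _ _ Iy.
exists (vectors (rcons L (k, rcons xs y))); split.
- exists e1, e2', L, k, (rcons xs y), I; split; split=> //.
  + by move: h2; rewrite /starts !map_rcons.
  + exact: okgroups_replace h3 n1 n2.
  + by case: (xs).
- by rewrite !Evec !size_cat size_rcons; lia.
- by rewrite !Evec -cats1 catA take_size_cat.
Qed.

Lemma unit_inner : has_inner (OS OZ) 1.
Proof.
move=> e p he; have p1 := ltn0Sn p.
exists (fun e xs => ole e OZ /\ xs = [:: unit_vec p.+1]), (unit_vec p.+1); split=> // e1 xs [h1 ->].
split.
- split; first by case=> // _; split; [exact: c00_unit|exact: (N_unit HF0 HS0 Hth Hthdec HN)].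
  split; first by move=> i j q r /=; lia.
  move=> a; have -> : lincomb a [:: unit_vec p.+1] = vscal (a 0%N) (unit_vec p.+1).
    by apply: functional_extensionality => k; rewrite lincombE /= big_seq1.
  rewrite sumabs_coefE /= big_seq1 (N_scal HN) ?(N_unit HF0 HS0 Hth Hthdec HN) //; last exact: c00_unit.
  by rewrite Rinv_1; lra.
- by move=> q /insupp_seq1; rewrite /unit_vec; case: eqP => // -> _; exact: leqnSn.
- by move=> e' /olt_ole_trans /(_ h1).
Qed.

End LowerTree.

(** * Flat averages of the unit vector basis *)

Section Flat.
Variables (zeta : Ord -> nat -> Ord) (F0 : fam) (beta : nat -> Ord) (theta : nat -> R) (N : vec -> R).
Hypotheses (HF0 : regular F0) (HS0 : contains_S0 F0).
Hypothesis Hth : forall n, 0 < theta n < 1.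
Hypothesis Hthdec : forall n, theta n.+1 <= theta n.
Hypothesis Hnull : Un_cv theta 0.
Hypothesis HN : is_T_norm zeta F0 theta beta N.

Local Notation SL := (SL zeta beta).
Local Notation mass := (mass blo bhi).

Definition unit_blk k : blk := (unit_vec k, (k, k)).

Lemma okblk_unit k : (0 < k)%N -> okblk N (unit_blk k).
Proof.
move=> k0; split=> /=; [exact: c00_unit| | |by rewrite /blo /bhi /= k0 leqnn].
  by rewrite (N_unit HF0 HS0 Hth Hthdec HN) //; lra.
by move=> j; rewrite /unit_vec /blo /bhi /=; case: eqP => // -> _; rewrite leqnn.
Qed.

Lemma rsum_N_unit Es k : (0 < k)%N -> blocks_ok Es -> \rsum_(E <- Es) N (restr E (unit_vec k)) <= 1.
Proof.
move=> k0 HB; apply: (Rle_trans _ (\rsum_(j <- flatten Es) Rabs (unit_vec k j))).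
  rewrite rsum_flatten; apply: rsum_le; apply: Forall_mem => E EE.
  by apply: (N_l1 HF0 HS0 Hth Hthdec HN); [case: (blocks_in_fs HB EE)|exact: c00_unit].
case: (boolP (k \in flatten Es)) => kE.
  rewrite (rsum_single (D := k)) //; first by rewrite /unit_vec eqxx Rabs_R1; lra.
    by have [[h _] _] := proj1 (blocks_fs _) HB; exact: (sorted_uniq ltn_trans ltnn).
  by move=> j _ /negbTE jk; rewrite /unit_vec jk Rabs_R0.
rewrite big_seq_cond big1; first by lra.
by move=> j; rewrite andbT /unit_vec; case: eqP => [->|]; rewrite ?(negbTE kE) ?Rabs_R0.
Qed.

(** The elements of [H] as one-point sets are admissible, which gives a lower l1 estimate on [H]. *)
Lemma N_singletons n H x : c00 x -> Sch zeta (beta n) H -> theta n * sumabs H x <= N x.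
Proof.
move=> hx HH; have fsH := Sch_fs HH.
have Ef : flatten [seq [:: k] | k <- H] = H by elim: (H) => //= k s ->.
have Em : map smin [seq [:: k] | k <- H] = H by rewrite -map_comp; exact: map_id.
have B : blocks_ok [seq [:: k] | k <- H].
  by apply/blocks_fs; rewrite Ef; split=> //; apply/negP => /mapP[].
apply: Rle_trans (N_adm (n := n) HN hx B _); last by rewrite Em.
rewrite big_map sumabsE; apply: Rmult_le_compat_l; first by have := Hth n; lra.
apply: rsum_le; apply: Forall_mem => k kH.
have k0 : (0 < k)%N by case: fsH => _ /allP; apply.
by have := N_coord HS0 HN (c00_restr [:: k] hx) k0; rewrite /restr inE eqxx.
Qed.

(** * Averaging along one Schreier set *)

Section Game.
Variable p : nat.

Definition set_top (s : seq nat) := maxn p (smax s).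
Definition set_step (s : seq nat) (y : blk) (s' : seq nat) :=
  exists k, [/\ y = unit_blk k, s' = rcons s k & (set_top s < k)%N].

Lemma set_step_top s y s' : set_step s y s' -> (set_top s < blo y <= bhi y)%N /\ (bhi y <= set_top s')%N.
Proof.
case=> k [-> -> h]; rewrite /blo /bhi /= h leqnn; split=> //.
by rewrite /set_top /smax last_rcons; exact: leq_maxr.
Qed.

Lemma set_chain s ws s' : chain set_step s ws s' -> wnonneg ws ->
  okws N ws /\ List.Forall (fun q : R * blk => exists2 k, (0 < k)%N & q.2 = unit_blk k) ws /\
  exists ks, [/\ s' = s ++ ks, forall k, k \in ks -> (set_top s < k)%N,
    forall q, wsum ws q <> 0 -> q \in ks & sumabs ks (wsum ws) = wtotal ws].
Proof.
elim: ws s => [|q ws IH] s /=.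
  move=> <- _; split; first by constructor.
  split; first by constructor.
  exists [::]; rewrite cats0 wsum_nil /wtotal big_nil; by split.
case=> s1 [[k [Eq Es1 hk]] h2] nn; have q0 : 0 <= q.1 by inversion nn.
have nn' : wnonneg ws by inversion nn.
have [ok [un [ks [e1 e2 e3 e4]]]] := IH _ h2 nn'.
have k0 : (0 < k)%N by lia.
have ks1 j : j \in ks -> (k < j)%N.
  by move/e2; rewrite Es1 /set_top /smax last_rcons; lia.
split; first by constructor=> //; rewrite Eq; split=> //; exact: okblk_unit.
split; first by constructor=> //; exists k.
exists (k :: ks); rewrite wsum_cons Eq; split.
- by rewrite e1 Es1 cat_rcons.
- by move=> j; rewrite inE => /predU1P[->//|/ks1]; exact: ltn_trans.
- move=> j; rewrite inE /vadd /vscal /= /unit_vec; case: eqP => //= _ h; apply: e3; lra.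
- have Ak : wsum ws k = 0.
    by case: (Req_EM_T (wsum ws k) 0) => // /e3/ks1; rewrite ltnn.
  rewrite /= /vadd /vscal {1}/unit_vec eqxx Ak /wtotal big_cons -/(wtotal ws) -e4.
  rewrite Rmult_1_r Rplus_0_r Rabs_pos_eq //; congr Rplus; rewrite !sumabsE.
  rewrite big_seq_cond [RHS]big_seq_cond; apply: eq_bigr => j /andP[/ks1 hj _].
  by rewrite /= /unit_vec; case: eqP => [jk|_]; [lia|congr Rabs; lra].
Qed.

Variables (m : nat) (eps : R) (a : Ord).
Hypothesis eps0 : 0 < eps.
Hypothesis Hrk : forall l, l = [::] \/ eps * thprod theta l > theta m ->
  rklt (wexp a) (SL l) /\ rklt (wexp a) (comp (SL l) F0).

(** Any vector with l1 norm 1 on a set of S_(beta_m) has norm at least [theta m]; this average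
    reaches that order, with a factor independent of [m]. *)
Lemma flat_average t H : lr (Sch zeta (beta m)) (oadd t (wexp a)) H ->
  exists ks v, [/\ lr (Sch zeta (beta m)) t (H ++ ks), forall k, k \in ks -> (set_top H < k)%N,
     forall q, v q <> 0 -> q \in ks & sumabs ks v = 1] /\ c00 v /\ N v <= theta m * (1 + / eps).
Proof.
have [t0 t1] := Hth m; move=> Hlr.
pose d := theta m / eps; have d0 : 0 < d by exact: Rdiv_lt_0_compat.
have Ed : d * eps = theta m by rewrite /d; field; lra.
have [L HL] := reach_finite Hth Hthdec Hnull d0.
have [C [C0 HC]] := norm_upper_bound HF0 HS0 Hth Hthdec Hnull HN d0.
have HG : rklt (wexp a) (fun F => exists2 l, l \in L & reach theta d l /\ (SL l F \/ comp (SL l) F0 F)).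
  apply: rklt_bigcup => // l _; case: (classic (reach theta d l)) => hl.
    have [|h1 h2] := Hrk (l := l).
      by case: hl => hl; [left|right; have := Rmult_lt_compat_l _ _ _ eps0 hl; lra].
    by apply: rklt_mono (rklt_union h1 h2) _ _ => // F [].
  by exists OZ; split=> //; apply: rk_empty => k F [/hl].
pose d' := theta m / (C + 1).
have d'0 : 0 < d' by apply: Rdiv_lt_0_compat => //; lra.
have step s e e' : lr (Sch zeta (beta m)) e s -> olt e' e ->
    exists y s', set_step s y s' /\ lr (Sch zeta (beta m)) e' s'.
  by move=> h /(lr_inv (set_top s) h) [k [hk hk']]; exists (unit_blk k), (rcons s k); split=> //; exists k.
have [ws [s' [c1 c2 c3 c4]]] := averages set_step_top (fun e e' s h1 h2 => lr_le h1 h2)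
   (fun e e' s => step s e e') HG d'0 Hlr.
have [ok [un [ks [e1 e2 e3 e4]]]] := set_chain c1 (proj1 c3).
exists ks, (wsum ws); split; first by rewrite -e1 e4 (proj2 c3).
split; first exact: okws_c00 ok.
have small : small_on zeta F0 beta theta N d d' d (fun _ => (0%N, 0%N)) ws.
  split=> //.
  - by move=> l F hl HF; apply: c4; [case: (SL_fs HF)|exists l; [exact: HL|split=> //; left]].
  - by move=> l F hl HF; apply: c4; [case: (comp_fs HF)|exists l; [exact: HL|split=> //; right]].
  - move=> n l Es hl hn HB HE; apply: List.Forall_impl un => q [k k0 ->] _.
    have h := rsum_N_unit k0 HB; have h1 : 0 <= thprod theta l * theta n.
      by apply: Rmult_le_pos; apply: Rlt_le; [exact: thprod_pos|case: (Hth n)].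
    by have := Rmult_le_compat_l _ _ _ h1 h; rewrite [unit_blk k]/unit_blk /=; lra.
have := HC d' d _ ws (Rlt_le _ _ d'0) (Rlt_le _ _ d0) small; rewrite (proj2 c3).
suff : C * d' <= theta m by rewrite /d /Rdiv; lra.
apply: (Rmult_le_reg_r (C + 1)); first by lra.
have -> : C * d' * (C + 1) = C * theta m by rewrite /d'; field; lra.
nra.
Qed.

End Game.

(** All averages are taken along a single set of S_(beta_m), each using up w^a of its rank. After
    normalization each has l1 norm at least 1 / (theta m (1 + 1/eps)), and applying [theta m] times
    the l1 norm on the set cancels [theta m]. *)
Lemma flat_inner m eps a c : 0 < eps -> lr (Sch zeta (beta m)) (omul (wexp a) (wexp c)) [::] ->
  (forall l, l = [::] \/ eps * thprod theta l > theta m ->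
    rklt (wexp a) (SL l) /\ rklt (wexp a) (comp (SL l) F0)) ->
  forall e p, olt e (wexp c) -> exists (I : Ord -> seq vec -> Prop) x, I e [:: x] /\
    forall e xs, I e xs -> [/\ l1K_node N (1 + / eps) xs, forall q, insupp xs q -> (p <= q)%N &
      forall e', olt e' e -> exists x, I e' (rcons xs x)].
Proof.
move=> eps0 Hlr Hrk e p he; have [t0 t1] := Hth m.
have ie0 := Rinv_0_lt_compat _ eps0.
pose K0 := 1 + / eps; have K0p : 0 < theta m * K0 by apply: Rmult_lt_0_compat; rewrite /K0; lra.
(* The invariant is an l1 estimate on [H], which is additive over disjoint supports; the estimate
   for the norm is derived from it only at the end. *)
pose J H xs := [/\ normalized_blocks N xs, forall q, insupp xs q -> q \in H &
  forall b, / (theta m * K0) * sumabs_coef b (size xs) <= sumabs H (lincomb b xs)].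
pose I e xs := exists H, [/\ lr (Sch zeta (beta m)) (omul (wexp a) e) H, forall k, k \in H -> (p < k)%N & J H xs].
have ext e1 e2 xs : I e1 xs -> olt e2 e1 -> exists x, I e2 (rcons xs x).
  move=> [H [h1 h2 [j1 j2 j3]]] /(omul_mono_r (wexp a)) /(lr_le h1) h3.
  have [ks [v [[f1 f2 f3 f4] [cv Nv]]]] := flat_average p eps0 Hrk h3.
  have fsH := Sch_fs (lr_in f1); have /fs_cat[fsH1 fsks hlt] := fsH.
  have z0 : sumabs H v = 0.
    rewrite sumabsE big_seq_cond big1 // => k; rewrite andbT => kH.
    case: (Req_EM_T (v k) 0) => [->|/f3 h]; first exact: Rabs_R0.
    by have := hlt _ _ kH h; rewrite ltnn.
  have sumabs_cat F F' y : sumabs (F ++ F') y = sumabs F y + sumabs F' y by rewrite !sumabsE big_cat.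
  have Nv0 : 0 < N v.
    have := N_singletons cv (lr_in f1); rewrite sumabs_cat f4 z0; lra.
  pose x := vscal (/ N v) v; exists x, (H ++ ks).
  have iN := Rinv_0_lt_compat _ Nv0.
  have cx : c00 x by exact: c00_scal.
  have Nx : N x = 1 by rewrite /x (N_scal HN) // Rabs_pos_eq ?Rinv_l; lra.
  have xs0 q : x q <> 0 -> q \in ks.
    by move=> h; apply: f3 => v0; apply: h; rewrite /x /vscal v0 Rmult_0_r.
  split=> //.
  - move=> k; rewrite mem_cat => /orP[/h2//|/f2]; rewrite /set_top; lia.
  - rewrite -cats1; split.
    + apply: normalized_cat => //.
        by split=> [[|i] //=|i j q r /=]; lia.
      by move=> q r /j2 hq /insupp_seq1 /xs0; exact: hlt.
    + by move=> q /insupp_cat[/j2 h|/insupp_seq1/xs0 h]; rewrite mem_cat h ?orbT.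
    + move=> b; rewrite lincomb_cat size_cat sumabs_coefD.
      have -> : lincomb (fun i => b (size xs + i)%N) [:: x] = vscal (b (size xs)) x.
        by apply: functional_extensionality => k; rewrite lincombE /= big_seq1 addn0.
      have -> : sumabs_coef (fun i => b (size xs + i)%N) (size [:: x]) = Rabs (b (size xs)).
        by rewrite sumabs_coefE /= big_seq1 addn0.
      rewrite sumabs_cat Rmult_plus_distr_l; apply: Rplus_le_compat.
        apply: Rle_trans (j3 b) _; apply: Req_le; rewrite !sumabsE.
        rewrite big_seq_cond [RHS]big_seq_cond; apply: eq_bigr => k /andP[kH _].
        rewrite /vadd /vscal; case: (Req_EM_T (x k) 0) => [->|/xs0 h]; first by rewrite Rmult_0_r Rplus_0_r.
        by have := hlt _ _ kH h; rewrite ltnn.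
      have -> : sumabs ks (vadd (lincomb b xs) (vscal (b (size xs)) x)) = Rabs (b (size xs)) * (/ N v * 1).
        rewrite -f4 !sumabsE -!rsum_scal big_seq_cond [RHS]big_seq_cond.
        apply: eq_bigr => k /andP[kk _]; rewrite /vadd.
        have -> : lincomb b xs k = 0.
          by case: (Req_EM_T (lincomb b xs k) 0) => // /lincomb_supp/j2 h; have := hlt _ _ h kk; rewrite ltnn.
        by rewrite Rplus_0_l /vscal Rabs_mult /x /vscal Rabs_mult (Rabs_pos_eq (/ N v)) //; lra.
      rewrite Rmult_1_r Rmult_comm; apply: Rmult_le_compat_l; first exact: Rabs_pos.
      exact: Rinv_le_contravar.
have I0 : I (wexp c) [::].
  exists [::]; split=> //; split.
  - by split=> [i|i j q r] //=; rewrite ltn0 andbF.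
  - by move=> q /insupp_nil.
  - by move=> b; rewrite sumabs_coefE /= big_nil; lra.
have [x Ix] := ext _ _ _ I0 he.
exists I, x; split=> // e1 xs Ixs; split; last by move=> e' h; exact: ext Ixs h.
- have [H [h1 h2 [[j0 j1] j2 j3]]] := Ixs.
  split=> //; split=> // b.
  have cx : c00 (lincomb b xs) by apply: c00_lincomb => i /j0[].
  have := N_singletons cx (lr_in h1); have := Rmult_le_compat_l _ _ _ (Rlt_le _ _ t0) (j3 b).
  rewrite -Rmult_assoc; have -> : theta m * / (theta m * K0) = / K0 by field; rewrite /K0; lra.
  by rewrite /K0; lra.
- by have [H [h1 h2 [_ j2 _]]] := Ixs => q /j2/h2/ltnW.
Qed.

End Flat.

(** * The two cases of the dichotomy *)

Lemma ole_fin_omul z n : ole (fin n) (omul (wexp z) (fin n)).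
Proof.
elim: n => [//|n IH]; have h : ole (oadd (fin n) (OS OZ)) (oadd (omul (wexp z) (fin n)) (wexp z)).
  by apply: oadd_mono => //; exact: wexp_pos.
exact: h.
Qed.

Lemma finite_max (T : eqType) (P : T -> Prop) (f : T -> Ord) (L : seq T) x0 : P x0 ->
  exists x, P x /\ forall y, y \in x0 :: L -> P y -> ole (f y) (f x).
Proof.
move=> P0; elim: L => [|z L [x [Px Hx]]].
  by exists x0; split=> // y; rewrite inE => /eqP->.
case: (classic (P z /\ ole (f x) (f z))) => [[Pz h]|h].
  exists z; split=> // y; rewrite !inE => /or3P[/eqP->|/eqP->//|yL] Py.
    by apply: ole_trans (Hx _ _ _) h; rewrite ?mem_head.
  by apply: ole_trans (Hx _ _ _) h; rewrite ?inE ?yL ?orbT.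
exists x; split=> // y; rewrite !inE => /or3P[/eqP->|/eqP->|yL] Py.
- by apply: Hx => //; exact: mem_head.
- by apply: NNPP => h'; apply: h; split=> //; exact: olt_ole (not_ole_lt h').
- by apply: Hx => //; rewrite inE yL orbT.
Qed.

Lemma comp_S0_intro zeta (M : fam) F : fs F -> M F -> comp M (Sch zeta OZ) F.
Proof.
move=> fsF MF; have Ef : flatten [seq [:: k] | k <- F] = F by elim: (F) => //= k s ->.
exists [seq [:: k] | k <- F]; split=> //; split; first by apply/blocks_fs; rewrite Ef; split=> //; apply/negP => /mapP[].
split; last by rewrite -map_comp map_id.
move=> E /mapP[k kF ->]; apply: Sch_zero => //.
by case: fsF => _ /allP; apply.
Qed.

Section Dichotomy.
Variables (zeta : Ord -> nat -> Ord) (F0 : fam) (beta : nat -> Ord) (theta : nat -> R) (N : vec -> R).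
Variables (xi z a0 la : Ord).
Hypothesis Hzeta : fund_seqs zeta.
Hypothesis Hxi : oeq xi (OS z).
Hypothesis Hblt : forall n, olt (beta n) (wexp xi).
Hypothesis Hbsup : oeq (OL beta) (wexp xi).
Hypotheses (HF0 : regular F0) (HS0 : contains_S0 F0).
Hypothesis Ha0 : cb_index F0 a0.
Hypothesis Ha0lt : olt a0 (wexp (wexp xi)).
Hypothesis Hla : lead_exp a0 la.
Hypothesis Hth : forall n, 0 < theta n < 1.
Hypothesis Hthdec : forall n, theta n.+1 <= theta n.
Hypothesis Hnull : Un_cv theta 0.
Hypothesis HN : is_T_norm zeta F0 theta beta N.

Local Notation SL := (SL zeta beta).

(** For x < w^xi = w^(z+1) this is the coefficient of w^z in the normal form of [x]. *)
Definition digit x k := ole (omul (wexp z) (fin k)) x /\ olt x (omul (wexp z) (fin k.+1)).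

Lemma digit_below x : olt x (wexp xi) -> exists k, digit x k.
Proof. by move/olt_ole_trans => /(_ _ (wexp_mono (proj1 Hxi))); exact: digit_exists. Qed.

Lemma below_fin n : olt (omul (wexp z) (fin n)) (wexp xi).
Proof.
apply: olt_ole_trans (wexp_mono (proj2 Hxi)).
apply: olt_ole_trans (omul_lt_r (wexp_pos z) (fin_olt (ltnSn n))) _.
exact: (@ole_sup _ (fun n => omul (wexp z) (fin n)) n.+1).
Qed.

Lemma digits_beta : exists kb : nat -> nat, forall n, digit (beta n) (kb n).
Proof.
have [kb H] := @choice_on _ _ (fun _ : nat => True) (fun n k => digit (beta n) k) 0%N (fun n _ => digit_below (Hblt n)).
by exists kb => n; exact: H.
Qed.

Lemma la_below : olt (OS la) (wexp xi).
Proof.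
have xi0 : olt OZ xi by exact: (olt_ole_trans (_ : olt OZ (OS z)) (proj2 Hxi)).
apply: olt_S_wexp => //; case: Hla => [[_ [h _]]|[h _]]; first exact: ole_olt_trans h (wexp_pos xi).
by apply: wexp_lt_inv; exact: ole_olt_trans h Ha0lt.
Qed.

(** From a0 < w^(la+1) the bound a0 + 1 on the rank is still at most w^(la+1). *)
Lemma rank_F0 : rk (wexp (OS la)) F0.
Proof.
apply: rk_le (rk_regular HF0 Ha0) _; case: Hla => [[[h _] _]|[_ h]]; last exact: h.
exact: (ole_olt_trans h (wexp_pos (OS la))).
Qed.

Variable kb : nat -> nat.
Hypothesis Hkb : forall n, digit (beta n) (kb n).

Definition ksum (l : seq nat) := foldr (fun n acc => (kb n + acc)%N) 0%N l.
(** The exponent of the rank of [SL l]. Multiplying ranks puts the summands in the order opposite to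
    [osum]; for the coefficient of w^z this makes no difference. *)
Definition bsum (l : seq nat) := foldr (fun n acc => oadd (beta n) acc) OZ l.

Lemma bsum_lt l : olt (bsum l) (omul (wexp z) (fin (ksum l).+1)).
Proof.
elim: l => [|n l IH] /=; first by rewrite add0o.
by apply: olt_omul_finD => //; case: (Hkb n).
Qed.

Lemma osum_lt l : olt (osum beta l) (omul (wexp z) (fin (ksum l).+1)).
Proof.
elim: l => [|n l IH] /=; first by rewrite add0o.
by rewrite addnC; apply: olt_omul_finD => //; case: (Hkb n).
Qed.

Lemma osum_ge l : ole (omul (wexp z) (fin (ksum l))) (osum beta l).
Proof.
elim: l => [//|n l IH]; rewrite [ksum _]/= addnC -omul_finD; apply: oadd_mono => //.
by case: (Hkb n).
Qed.

Lemma rk_SL l : rk (wexp (bsum l)) (SL l).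
Proof.
elim: l => [|n l IH]; first exact: rk_Sch.
rewrite [bsum _]/= wexpD; apply: rk_comp => //; exact: rk_Sch.
Qed.

Lemma rk_SLF0 l : rk (wexp (oadd (OS la) (bsum l))) (comp (SL l) F0).
Proof. by rewrite wexpD; apply: rk_comp; [exact: rk_SL|exact: rank_F0]. Qed.

Lemma below_bsum l : olt (bsum l) (wexp xi).
Proof. exact: olt_trans (bsum_lt l) (below_fin _). Qed.

Lemma rklt_SL l : rklt (wexp (wexp xi)) (SL l).
Proof. by exists (wexp (bsum l)); split; [exact/wexp_lt/below_bsum|exact: rk_SL]. Qed.

Lemma rklt_SLF0 l : rklt (wexp (wexp xi)) (comp (SL l) F0).
Proof.
exists (wexp (oadd (OS la) (bsum l))); split; last exact: rk_SLF0.
by apply: wexp_lt; apply: olt_oadd_wexp; [exact: la_below|exact: below_bsum].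
Qed.

Definition dich_cond := exists eps, eps > 0 /\ forall b, olt b (wexp xi) ->
  exists m g, gamma_is la beta theta eps m g /\ olt (oadd (oadd g (fin 2)) b) (beta m).

Lemma cond_digits : dich_cond -> exists eps, 0 < eps /\ forall c, exists m, forall l,
  l = [::] \/ eps * thprod theta l > theta m -> (ksum l + c <= kb m)%N.
Proof.
case=> eps [e0 H]; exists eps; split=> // c.
have [m [g [Hg Hm]]] := H _ (below_fin c); exists m => l hl.
have key x : ole x g -> ole (omul (wexp z) (fin (ksum l))) x -> (ksum l + c <= kb m)%N.
  move=> h1 h2; rewrite -ltnS; apply: fin_ole_inv; apply: (@omul_cancel_lt (wexp z) (fin (ksum l + c))).
  apply: olt_trans (proj2 (Hkb m)); apply: ole_olt_trans Hm; rewrite -omul_finD.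
  by apply: oadd_mono_l; apply: ole_trans h2 (ole_trans h1 (oadd_ge_l _ _)).
case: (l =P [::]) => [l0|l0].
  by apply: (key OZ) => //; rewrite l0.
have al : gamma_adm theta eps m l by case: hl => // hl; split.
case: Hg => [[l' [_ [_ h]]]|[h _]]; last by case: (h l).
apply: key (h _ al) _; apply: ole_trans (osum_ge l) (oadd_ge_r _ _).
Qed.

Lemma gamma_exists eps m : 0 < eps -> exists g, gamma_is la beta theta eps m g.
Proof.
move=> e0; case: (classic (exists l, gamma_adm theta eps m l)) => [[l0 Hl0]|H]; last first.
  by exists OZ; right; split=> // l Hl; apply: H; exists l.
have d0 : 0 < theta m / eps by apply: Rdiv_lt_0_compat => //; case: (Hth m).
have [L HL] := reach_finite Hth Hthdec Hnull d0.
have [l [Hl Hmax]] := finite_max (fun l => oadd la (osum beta l)) L Hl0.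
exists (oadd la (osum beta l)); left; exists l; split=> //; split=> // l' Hl'.
apply: Hmax => //; rewrite inE HL ?orbT //; right.
case: Hl' => _ h; apply: (Rmult_lt_reg_l eps) => //.
by have -> : eps * (theta m / eps) = theta m by field; lra.
Qed.

Lemma not_cond_digits : ~ dich_cond -> forall eps, 0 < eps -> exists c, forall m, exists l,
  (l = [::] \/ eps * thprod theta l > theta m) /\ (kb m <= ksum l + c)%N.
Proof.
move=> HC eps e0.
have [b Hb] : exists b, olt b (wexp xi) /\ forall m g, gamma_is la beta theta eps m g ->
    ole (beta m) (oadd (oadd g (fin 2)) b).
  apply: NNPP => H; apply: HC; exists eps; split=> // b hb.
  apply: NNPP => H2; apply: H; exists b; split=> // m g hg.
  by apply: NNPP => h; apply: H2; exists m, g; split=> //; exact: not_ole_lt.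
case: Hb => /digit_below [k3 [_ h3]] Hb.
have [k1 [_ h1]] := digit_below (olt_trans (ole_refl (OS la)) la_below).
have h2 : olt (fin 2) (omul (wexp z) (fin 3)).
  exact: ole_olt_trans (ole_fin_omul z 2) (omul_lt_r (wexp_pos z) (fin_olt (ltnSn 2))).
(* The coefficients of [la], of the finite ordinal 2 and of [b]; the second is 2 when z = 0 and
   smaller otherwise. *)
exists (k1 + 2 + k3)%N => m.
have [g Hg] := gamma_exists m e0; have {}Hb := Hb _ _ Hg.
have fin_le k x : ole (beta m) x -> olt x (omul (wexp z) (fin k.+1)) -> (kb m <= k)%N.
  move=> hx hk; rewrite -ltnS; apply: fin_ole_inv; apply: (@omul_cancel_lt (wexp z) (fin (kb m))).
  exact: ole_olt_trans (ole_trans (proj1 (Hkb m)) hx) hk.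
case: Hg => [[l [[_ Hl] [[Eg _] _]]]|[_ [Eg _]]].
  exists l; split; first by right.
  apply: (fin_le _ (oadd (oadd (oadd la (osum beta l)) (fin 2)) b)).
    by apply: ole_trans Hb _; do 2 apply: oadd_mono_l.
  have -> : (ksum l + (k1 + 2 + k3) = k1 + ksum l + 2 + k3)%N by lia.
  by do 2 apply: olt_omul_finD => //; apply: olt_omul_finD => //; exact: osum_lt.
exists [::]; split; first by left.
apply: (@leq_trans (2 + k3)); last by rewrite /=; lia.
apply: (fin_le _ (oadd (oadd OZ (fin 2)) b)); last by rewrite add0o; exact: olt_omul_finD.
by apply: ole_trans Hb _; do 2 apply: oadd_mono_l.
Qed.

(** * Exact inclusions at multiples of w^z *)

Lemma mult_below j : olt (omul (wexp z) (fin j)) (wexp (OS z)).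
Proof. exact: olt_ole_trans (below_fin j) (wexp_mono (proj1 Hxi)). Qed.

Lemma Sch_extend_mult k j F : (k <= j)%N ->
  Sch zeta (omul (wexp z) (fin k)) F -> Sch zeta (omul (wexp z) (fin j)) F.
Proof.
move=> /subnKC <-; rewrite -omul_finD; apply: Sch_extend => //; exact: mult_below.
Qed.

Lemma beta_split n : exists y, olt y (wexp z) /\ oeq (beta n) (oadd (omul (wexp z) (fin (kb n))) y).
Proof.
have [h1 h2] := Hkb n; have [y Ey] := osub_exists h1; exists y; split=> //.
apply: (@oadd_cancel_lt (omul (wexp z) (fin (kb n)))); exact: ole_olt_trans (proj2 Ey) h2.
Qed.

Lemma wz_below y : olt y (wexp z) -> olt y (wexp (OS z)).
Proof. by move/olt_trans; apply; exact: wexp_ltS. Qed.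

(** One factor w^(kb n) of the coefficient is split off per index, and S_(w^z kb n) is contained in
    S_(beta_n), whose index exceeds it by less than w^z. *)
Lemma Sch_SL l F : Sch zeta (omul (wexp z) (fin (ksum l))) F -> SL l F.
Proof.
elim: l F => [//|n l IH] F; rewrite [ksum _]/= -omul_finD => /(Sch_split Hzeta (mult_below _)).
apply: comp_mono => // E HE; have [y [hy Ey]] := beta_split n.
apply: Sch_oeq (oeq_sym Ey) _; apply: Sch_extend => //; exact: wz_below.
Qed.

Lemma no_large_tree_upper a K T : 1 <= K -> l1K_tree N K T ->
  (forall n, exists Hl : fam * seq nat, [/\ rklt (wexp a) Hl.1,
    Hl.2 = [::] \/ / (8 * K) * thprod theta Hl.2 > theta n &
    forall F, Sch zeta (beta n) F -> comp Hl.1 (SL Hl.2) F]) ->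
  forall t, ~ iter_tderiv T (wexp (oadd a (wexp xi))) t.
Proof.
move=> K1 HT Hcov t; rewrite wexpD.
have e0 : 0 < / (8 * K) by apply: Rinv_0_lt_compat; lra.
exact: (tree_upper_bound HF0 HS0 Hth Hthdec Hnull HN K1 HT e0 Hcov rklt_SL rklt_SLF0).
Qed.

(** The trivial cover: H_n = S_(beta_n), of rank below w^(w^xi), with the empty sequence. *)
Lemma upper_always K T : 1 <= K -> l1K_tree N K T -> forall t, ~ iter_tderiv T (wexp (omul (wexp xi) (fin 2))) t.
Proof.
move=> K1 HT t.
have -> : omul (wexp xi) (fin 2) = oadd (wexp xi) (wexp xi) by rewrite /= add0o.
apply: (no_large_tree_upper K1 HT) => n; exists (Sch zeta (beta n), [::]); split=> /=.
- by exists (wexp (beta n)); split; [exact: wexp_lt|exact: rk_Sch].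
- by left.
- by move=> F HF; apply: comp_S0_intro => //; exact: Sch_fs HF.
Qed.

Lemma upper_not_cond : ~ dich_cond -> forall K T, 1 <= K -> l1K_tree N K T ->
  forall t, ~ iter_tderiv T (wexp (wexp xi)) t.
Proof.
move=> HC K T K1 HT t Ht.
have e0 : 0 < / (8 * K) by apply: Rinv_0_lt_compat; lra.
have [c Hc] := not_cond_digits HC e0.
(* The covering family is S_y[S_(w^z c)] with y < w^z, of rank at most w^(w^z c + y); the successor
   of [c] bounds this for all n. As a < w^xi, the product of w^a and w^(w^xi) is again w^(w^xi). *)
pose a := omul (wexp z) (fin c.+1).
apply: (@no_large_tree_upper a K T K1 HT _ t); last first.
  by apply: iter_tderiv_le Ht; apply: wexp_mono; apply: oadd_absorb; exact: below_fin.
move=> n; have [l [Hl kl]] := Hc n; have [y [hy Ey]] := beta_split n.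
exists (comp (Sch zeta y) (Sch zeta (omul (wexp z) (fin c))), l); split=> //=.
  exists (omul (wexp (omul (wexp z) (fin c))) (wexp y)); split; last by apply: rk_comp; exact: rk_Sch.
  by rewrite -wexpD; apply: wexp_lt; exact: oadd_lt_r.
move=> F /(Sch_oeq Ey) /(Sch_split Hzeta (wz_below hy)) HF.
apply: comp_assoc; apply: comp_mono HF => // E /(Sch_extend_mult kl).
rewrite -omul_finD => /(Sch_split Hzeta (mult_below c)).
by apply: comp_mono => // E'; exact: Sch_SL.
Qed.

(** * Lower bounds for the index *)

Lemma below_wexp_sup rho g : olt g (omul rho (wexp (wexp xi))) -> exists n, olt g (omul rho (wexp (beta n))).
Proof. by move/olt_ole_trans => /(_ _ (omul_mono_r rho (wexp_mono (proj2 Hbsup)))) [n]; exists n. Qed.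

Lemma lower_from_inner rho K g : 1 <= K -> olt OZ rho -> has_inner N rho K ->
  olt g (omul rho (wexp (wexp xi))) ->
  exists K, 1 <= K /\ exists T, l1K_tree N K T /\ exists t, iter_tderiv T g t.
Proof.
move=> K1 r0 Hin /below_wexp_sup [n Hn]; exists (K / theta n); split.
  have [t0 t1] := Hth n; apply: (Rmult_le_reg_r (theta n)) => //.
  by rewrite /Rdiv Rmult_assoc Rinv_l; lra.
exact: (tree_lower_bound Hzeta Hth HN K1 r0 Hin Hn).
Qed.

Lemma lower_always g : olt g (wexp (wexp xi)) ->
  exists K, 1 <= K /\ exists T, l1K_tree N K T /\ exists t, iter_tderiv T g t.
Proof.
move=> Hg; apply: (@lower_from_inner (wexp OZ) 1) => //; first exact: Rle_refl.
- exact: (unit_inner HF0 HS0 Hth Hthdec HN).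
- by rewrite -wexpD add0o.
Qed.

Lemma cond_inner : dich_cond -> exists K, 1 <= K /\ has_inner N (wexp (wexp xi)) K.
Proof.
move=> /cond_digits [eps [e0 H]]; have ie0 := Rinv_0_lt_compat _ e0.
exists (1 + / eps); split; first by lra.
move=> e p /olt_ole_trans /(_ (wexp_mono (wexp_mono (proj1 Hxi)))) [c hc].
have [kl [_ hl]] := digit_below la_below.
(* The coefficient of beta_m is divided: [c] is kept for the order of the inner tree, and the rest,
   at least ksum l + kl + 1, exceeds what the ranks of [SL l] and of its composition with [F0]
   require. *)
have [m Hm] := H (c + kl.+1)%N.
have hcm : (c <= kb m)%N by have := Hm [::] (or_introl erefl); rewrite /=; lia.
apply: (flat_inner HF0 HS0 Hth Hthdec Hnull HN (m := m) (a := omul (wexp z) (fin (kb m - c))) (c := omul (wexp z) (fin c)) e0) => //.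
  rewrite -wexpD omul_finD subnK //; apply: lr_le (lr_Sch Hzeta (beta m)) _.
  by apply: wexp_mono; case: (Hkb m).
move=> l /Hm hkl; have hlt : olt (oadd (OS la) (bsum l)) (omul (wexp z) (fin (kb m - c))).
  apply: olt_ole_trans (olt_omul_finD hl (bsum_lt l)) _.
  by apply: omul_mono_r; apply: fin_ole; lia.
split.
  exists (wexp (bsum l)); split; last exact: rk_SL.
  by apply: wexp_lt; exact: ole_olt_trans (oadd_ge_r _ _) hlt.
by exists (wexp (oadd (OS la) (bsum l))); split; [exact: wexp_lt|exact: rk_SLF0].
Qed.

Lemma lower_cond : dich_cond -> forall g, olt g (wexp (omul (wexp xi) (fin 2))) ->
  exists K, 1 <= K /\ exists T, l1K_tree N K T /\ exists t, iter_tderiv T g t.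
Proof.
move=> /cond_inner [K [K1 Hin]] g.
have -> : omul (wexp xi) (fin 2) = oadd (wexp xi) (wexp xi) by rewrite /= add0o.
rewrite wexpD => Hg; exact: (lower_from_inner K1 (wexp_pos _) Hin Hg).
Qed.

End Dichotomy.

Theorem theorem26
  (zeta : Ord -> nat -> Ord) (Hzeta : fund_seqs zeta)
  (xi : Ord) (Hxi : is_succ xi)
  (beta : nat -> Ord)
  (Hbmono : forall n, ole (beta n) (beta n.+1))
  (Hblt : forall n, olt (beta n) (wexp xi))
  (Hbsup : oeq (OL beta) (wexp xi))
  (F0 : fam) (HF0 : regular F0) (HS0 : contains_S0 F0)
  (a0 : Ord) (Ha0 : cb_index F0 a0) (Ha0lt : olt a0 (wexp (wexp xi)))
  (la : Ord) (Hla : lead_exp a0 la)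
  (theta : nat -> R)
  (Hth : forall n, 0 < theta n < 1)
  (Hthdec : forall n, theta n.+1 <= theta n)
  (Hthnull : Un_cv theta 0)
  (N : vec -> R) (HN : is_T_norm zeta F0 theta beta N) :
  let cond :=
    exists eps, eps > 0 /\
      forall b, olt b (wexp xi) ->
        exists m g, gamma_is la beta theta eps m g /\
          olt (oadd (oadd g (fin 2)) b) (beta m) in
  (cond -> Ib_eq N (wexp (omul (wexp xi) (fin 2)))) /\
  (~ cond -> Ib_eq N (wexp (wexp xi))).
Proof.
case: Hxi => z Ez cond; have [kb Hkb] := digits_beta Ez Hblt; split=> HC.
- split.
  + move=> K K1 T HT; exact: (upper_always Hzeta Ez Hblt HF0 HS0 Ha0 Ha0lt Hla Hth Hthdec Hthnull HN Hkb K1 HT).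
  + exact: (lower_cond Hzeta Ez Hbsup HF0 HS0 Ha0 Ha0lt Hla Hth Hthdec Hthnull HN Hkb HC).
- split.
  + move=> K K1 T HT; exact: (upper_not_cond Hzeta Ez HF0 HS0 Ha0 Ha0lt Hla Hth Hthdec Hthnull HN Hkb HC K1 HT).
  + exact: (lower_always Hzeta Hbsup HF0 HS0 Hth Hthdec HN).
Qed.
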